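(* Let $\sigma\ge 1$ be a real number and let $u_0\in H^1(\mathbb{T};\mathbb{C})$. Then there exist $T>0$ and $u\in L^\infty(0,T;H^1)$ such that $u$ is a mild solution of $iu_t+i|u|^{2\sigma}u_x+u_{xx}=0$ with initial data $u_0$, i.e. $$u(\cdot,t)=e^{i\partial_x^2t}u_0-\int_0^te^{i\partial_x^2(t-s)}\left(|u|^{2\sigma}u_x\right)(\cdot,s)\,ds ,\qquad t\in[0,T].$$ Furthermore, for all $s$ such that $0\le s<1$, $u\in C(0,T;H^s)$.
   Context: $\mathbb{T}=[0,2\pi)$ is the one-dimensional torus (periodic functions), and $H^s=H^s(\mathbb{T};\mathbb{C})$ is the $L^2$-based Sobolev space of complex-valued periodic functions. $e^{i\partial_x^2t}$ is the free Schrödinger group, i.e. the Fourier multiplier with symbol $e^{-ik^2t}$. $C(0,T;H^s)$ denotes functions continuous in time on $[0,T]$ with values in $H^s$. The mild equation is understood as an equality in $L^2$. *)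

(* Defs.v *)
From HB Require Import structures.
From mathcomp Require Import all_boot all_order all_algebra.
From mathcomp Require Import all_classical all_reals all_analysis.
From mathcomp.real_closed Require Export complex.

Set Implicit Arguments.
Unset Strict Implicit.
Unset Printing Implicit Defensive.

Import Order.TTheory GRing.Theory Num.Theory numFieldNormedType.Exports.

Local Open Scope classical_set_scope.
Local Open Scope ring_scope.
Local Open Scope complex_scope.

(* A function on the torus [0, 2 pi) is represented by any f : R -> R[i]; only
   its values on [0, 2 pi[ matter.  Elements of L^2 and H^s are such functions,
   identified when they agree almost everywhere on [0, 2 pi[. *)

Section Torus.
Context {R : realType}.
Local Notation mu := (@lebesgue_measure R).
Local Notation normc := (@ComplexField.Normc.normc R).
Implicit Types (f g : R -> R[i]) (s t : R) (k : int).

Definition torus : set R := `[0, 2 * pi[.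

Definition expi (x : R) : R[i] := cos x +i* sin x.

Definition torus_measurable f : Prop :=
  measurable_fun torus (fun x => complex.Re (f x)) /\
  measurable_fun torus (fun x => complex.Im (f x)).

Definition cintegral (D : set R) f : R[i] :=
  Rintegral mu D (fun x => complex.Re (f x)) +i*
  Rintegral mu D (fun x => complex.Im (f x)).

(* The norms below are extended by +oo outside of their space, so that f
   belongs to L^2 (resp. H^s) iff its norm is < +oo. *)
Definition L2norm f : \bar R :=
  if `[< torus_measurable f >]
  then ((\int[mu]_(x in torus) ((normc (f x) ^+ 2)%:E)) `^ 2^-1)%E
  else +oo%E.

Definition fourier f k : R[i] :=
  (2 * pi)^-1%:C * cintegral torus (fun x => expi (- (k%:~R * x)) * f x).

Definition Hnorm s f : \bar R :=
  if `[< (L2norm f < +oo)%E >]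
  then ((\esum_(k in [set: int])
          ((1 + k%:~R ^+ 2) `^ s * normc (fourier f k) ^+ 2)%:E) `^ 2^-1)%E
  else +oo%E.

(* The Fourier multiplier with symbol m, as an operator in L^2: m need not be
   bounded, and the value is meaningful only if f is in the domain, that is if
   some g in L^2 has Fourier coefficients m k * fourier f k. *)
Definition fmult (m : int -> R[i]) f : R -> R[i] :=
  xget (fun=> 0)
    [set g | (L2norm g < +oo)%E /\ forall k, fourier g k = m k * fourier f k].

Definition dx : (R -> R[i]) -> (R -> R[i]) := fmult (fun k => 0 +i* k%:~R).

Definition schrodinger t : (R -> R[i]) -> (R -> R[i]) :=
  fmult (fun k => expi (- (k%:~R ^+ 2 * t))).

(* Bochner integration on a set D of times, for functions with values in a
   space of functions on the torus given by an extended norm N. *)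
Section Bochner.
Variable N : (R -> R[i]) -> \bar R.

Record simple_function := SimpleFunction {
  sf_size : nat;
  sf_set : 'I_sf_size -> set R;
  sf_val : 'I_sf_size -> R -> R[i];
  sf_measurable : forall j, measurable (sf_set j);
  sf_finite : forall j, (N (sf_val j) < +oo)%E }.

Definition sf_eval (S : simple_function) t : R -> R[i] :=
  fun x => \sum_(j < sf_size S) (\1_(sf_set j) t : R)%:C * sf_val j x.

Definition sf_integral (D : set R) (S : simple_function) : R -> R[i] :=
  fun x => \sum_(j < sf_size S) (fine (mu (sf_set j `&` D)))%:C * sf_val j x.

Definition strongly_measurable (D : set R) (F : R -> R -> R[i]) : Prop :=
  exists S : nat -> simple_function,
    {ae mu, forall t, D t ->
      (N (F t \- sf_eval (S n) t)) @[n --> \oo] --> 0%E}.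

(* D is meant to have finite measure. *)
Definition is_bochner_integral (D : set R) (F : R -> R -> R[i])
    (v : R -> R[i]) : Prop :=
  strongly_measurable D F /\
  exists S : nat -> simple_function,
    (\int[mu]_(t in D) N (F t \- sf_eval (S n) t)%R)%E @[n --> \oo] --> 0%E /\
    (N (v \- sf_integral D (S n))) @[n --> \oo] --> 0%E.

Definition Linfty (T : R) (F : R -> R -> R[i]) : Prop :=
  strongly_measurable `]0, T[ F /\
  exists M : R, {ae mu, forall t, t \in `]0, T[ -> (N (F t) <= M%:E)%E}.

Definition continuous_in_time (T : R) (F : R -> R -> R[i]) : Prop :=
  forall t, t \in `[0, T] ->
    (N (F t) < +oo)%E /\
    (N (F t' \- F t)) @[t' --> within `[0, T] (nbhs t)] --> 0%E.

End Bochner.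

Definition nonlinearity (sigma : R) f : R -> R[i] :=
  fun x => (normc (f x) `^ (2 * sigma))%:C * dx f x.

Definition mild_solution (sigma T : R) (u0 : R -> R[i])
    (u : R -> R -> R[i]) : Prop :=
  forall t, t \in `[0, T] ->
    exists2 I : R -> R[i],
      is_bochner_integral L2norm `[0, t]
        (fun s => schrodinger (t - s) (nonlinearity sigma (u s))) I &
      {ae mu, forall x, torus x -> u t x = schrodinger t u0 x - I x}.

End Torus.

(* Main.v *)
(* Compactness.  Keep only the frequencies |k| <= N, replace |u|^(2 sigma) by
   q(|u|^2) for a polynomial q close to r^sigma, and step in time by an
   exponential Euler scheme.  If q = 2 (g + X g'), then
     Re mean (|u_x|^2 / 2 - i g(|u|^2) conj(u) u_x)
   is conserved by the truncated flow, hence changes by O(h^2) at each step.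
   While |u| <= K it controls the H^1 norm; conversely the H^1 bound makes every
   Fourier coefficient Lipschitz in time and so keeps |u| <= K up to a time T
   independent of N.  Along a diagonal subsequence all Fourier coefficients
   converge; by the H^1 bound u then converges uniformly in x and u_x weakly, so
   that the coefficients of |u|^(2 sigma) u_x converge too, and Duhamel's formula
   passes to the limit, coefficient by coefficient, by dominated convergence.
   Since the coefficients are continuous in time, u and the Duhamel integrand are
   limits of functions that are piecewise constant in time and truncated in
   frequency, which gives strong measurability and the Bochner integral. *)

(* The obstacle is a loss of derivative: differentiating |u_x|^2 / 2 along the equation leaves a
   term cubic in u_x, which H^1 does not control. The correction - i g(|u|^2) conj(u) u_x removes
   it, because the truncated equation reads u_t = - i P (gradient of the energy), P being the
   projection on low frequencies; being linear in u_x, the correction is absorbed by |u_x|^2 / 2.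
   Polynomials q and g reduce integration by parts and Taylor expansion to finite algebra on
   trigonometric polynomials. Since q approximates r^sigma only uniformly on [0, K^2], the bounds
   uniform in N may involve values of q and g but no derivative; g(r) is half the average of q over
   [0, r], hence bounded by the supremum of |q|. The explicit scheme replaces an existence theorem
   for the truncated equation. The constants of its consistency error depend on N and q, which is
   harmless as the time step is chosen after them. Treating the linear part exactly makes Duhamel's
   formula an identity at the discrete level, with a Riemann sum as integral. The limit of the
   nonlinear term needs only weak convergence of u_x, in which it is linear. *)
Require Import Defs.
From mathcomp Require Import all_boot all_order all_algebra.
From mathcomp Require Import all_classical all_reals all_analysis.
From mathcomp.real_closed Require Import polyrcf.
From mathcomp Require Import finmap measurable_realfun ring lra zify.

Set Implicit Arguments.
Unset Strict Implicit.
Unset Printing Implicit Defensive.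

Import Order.TTheory GRing.Theory Num.Theory numFieldNormedType.Exports.

Local Open Scope classical_set_scope.
Local Open Scope ring_scope.
Local Open Scope complex_scope.

Local Notation normc := ComplexField.Normc.normc.
Local Notation normc0 := ComplexField.Normc.normc0.
Local Notation normc1 := ComplexField.Normc.normc1.
Local Notation eq0_normc := ComplexField.Normc.eq0_normc.
Local Notation normcM := ComplexField.Normc.normcM.
Local Notation cRe := complex.Re.
Local Notation cIm := complex.Im.
Local Notation tmeas := torus_measurable.
Local Notation "z ^*" := (conjc z) : ring_scope.
Local Notation "''i'" := (0 +i* 1) : ring_scope.

(** * Complex numbers and symmetric sums *)

Section ComplexNumbers.
Context {R : realType}.
Implicit Types (z w : R[i]) (x y : R).

Lemma normc_sqr z : normc z ^+ 2 = cRe z ^+ 2 + cIm z ^+ 2.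
Proof. by case: z => a b /=; rewrite sqr_sqrtr// addr_ge0 ?sqr_ge0. Qed.

Lemma normc_ge0 z : 0 <= normc z.
Proof. by case: z => a b; exact: sqrtr_ge0. Qed.

Lemma normc_real x : normc x%:C = `|x|.
Proof. by rewrite /= expr0n addr0 sqrtr_sqr. Qed.

Lemma normc_conj z : normc z^* = normc z.
Proof. by case: z => a b /=; rewrite sqrrN. Qed.

Lemma normcB z w : normc (z - w) = normc (w - z).
Proof. by rewrite -[LHS]normcN opprB. Qed.

Lemma ler_normcB z w : normc (z - w) <= normc z + normc w.
Proof. by rewrite (le_trans (le_normcD _ _))// normcN. Qed.

Lemma ler_dist_normc z w : `|normc z - normc w| <= normc (z - w).
Proof.
have h a b : normc a - normc b <= normc (a - b) :> R.
  by rewrite lerBlDr -{1}(subrK b a) le_normcD.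
by rewrite ler_norml h andbT lerNl opprB normcB h.
Qed.

Lemma ler_Re z : `|cRe z| <= normc z.
Proof.
rewrite -[leLHS]ger0_norm// -ler_sqr ?nnegrE ?normc_ge0 ?normr_ge0//.
by rewrite normr_id real_normK ?num_real// normc_sqr lerDl sqr_ge0.
Qed.

Lemma ler_Im z : `|cIm z| <= normc z.
Proof.
rewrite -[leLHS]ger0_norm// -ler_sqr ?nnegrE ?normc_ge0 ?normr_ge0//.
by rewrite normr_id real_normK ?num_real// normc_sqr lerDr sqr_ge0.
Qed.

Lemma ler_ReIm z : normc z <= `|cRe z| + `|cIm z|.
Proof.
rewrite -ler_sqr ?nnegrE ?normc_ge0 ?addr_ge0//.
rewrite normc_sqr sqrrD !real_normK ?num_real// addrAC lerDl.
by rewrite mulrn_wge0// mulr_ge0.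
Qed.

Lemma mulcJ z : z * z^* = (normc z ^+ 2)%:C.
Proof.
rewrite normc_sqr; case: z => a b; apply/eqP; rewrite eq_complex /=.
by apply/andP; split; apply/eqP; ring.
Qed.

Lemma normc_sum (I : Type) (r : seq I) (P : pred I) (F : I -> R[i]) :
  normc (\sum_(i <- r | P i) F i) <= \sum_(i <- r | P i) normc (F i).
Proof.
elim/big_rec2: _ => [|i y z _ h]; first by rewrite normc0.
by rewrite (le_trans (le_normcD _ _))// lerD2l.
Qed.

Lemma cReD z w : cRe (z + w) = cRe z + cRe w.
Proof. by case: z; case: w. Qed.

Lemma cImD z w : cIm (z + w) = cIm z + cIm w.
Proof. by case: z; case: w. Qed.

Lemma cReN z : cRe (- z) = - cRe z. Proof. by case: z. Qed.

Lemma cImN z : cIm (- z) = - cIm z. Proof. by case: z. Qed.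

Lemma cReM z w : cRe (z * w) = cRe z * cRe w - cIm z * cIm w.
Proof. by case: z; case: w. Qed.

Lemma cImM z w : cIm (z * w) = cRe z * cIm w + cIm z * cRe w.
Proof. by case: z; case: w. Qed.

Lemma cReZ x z : cRe (x%:C * z) = x * cRe z.
Proof. by rewrite cReM /= mul0r subr0. Qed.

Lemma cImZ x z : cIm (x%:C * z) = x * cIm z.
Proof. by rewrite cImM /= mul0r addr0. Qed.

Lemma cRe_conj z : cRe z^* = cRe z. Proof. by case: z. Qed.

Lemma cIm_conj z : cIm z^* = - cIm z. Proof. by case: z. Qed.

Lemma cRe_sum (I : Type) (r : seq I) (P : pred I) (F : I -> R[i]) :
  cRe (\sum_(i <- r | P i) F i) = \sum_(i <- r | P i) cRe (F i).
Proof. by apply: (big_morph _ cReD). Qed.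

Lemma cIm_sum (I : Type) (r : seq I) (P : pred I) (F : I -> R[i]) :
  cIm (\sum_(i <- r | P i) F i) = \sum_(i <- r | P i) cIm (F i).
Proof. by apply: (big_morph _ cImD). Qed.

Lemma conjcD z w : (z + w)^* = z^* + w^*. Proof. exact: rmorphD. Qed.

Lemma conjcN z : (- z)^* = - z^*. Proof. exact: rmorphN. Qed.

Lemma conjcM z w : (z * w)^* = z^* * w^*. Proof. exact: rmorphM. Qed.

Lemma complexP z w : cRe z = cRe w -> cIm z = cIm w -> z = w.
Proof. by case: z => a b; case: w => c d /= -> ->. Qed.

Lemma normc_expi x : normc (expi x) = 1.
Proof. by rewrite /= cos2Dsin2 sqrtr1. Qed.

Lemma expiD x y : expi (x + y) = expi x * expi y.
Proof. by apply: complexP; rewrite /= ?cosD ?sinD// addrC. Qed.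

Lemma expi0 : expi (0 : R) = 1.
Proof. by apply: complexP; rewrite /= ?cos0 ?sin0. Qed.

Lemma expiN x : expi (- x) = (expi x)^*.
Proof. by rewrite /expi cosN sinN. Qed.

Lemma expiNK x z : expi x * (expi (- x) * z) = z.
Proof. by rewrite mulrA -expiD subrr expi0 mul1r. Qed.

Lemma expiKN x z : expi (- x) * (expi x * z) = z.
Proof. by rewrite mulrA -expiD addNr expi0 mul1r. Qed.

End ComplexNumbers.

(** Adding the two new frequencies in front makes the window |k| <= n a tail of the next one, so
    that partial Fourier sums are treated by induction on n. *)
Fixpoint zs (n : nat) : seq int :=
  if n is m.+1 then n%:Z :: - n%:Z :: zs m else [:: 0].

Section SymmetricSums.

Lemma zsS n : zs n.+1 = n.+1%:Z :: - n.+1%:Z :: zs n.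
Proof. by []. Qed.

Lemma mem_zs n (k : int) : (k \in zs n) = (`|k| <= n)%N.
Proof.
elim: n => [|n IH]; first by rewrite mem_seq1; lia.
rewrite /= !inE IH; lia.
Qed.

Lemma uniq_zs n : uniq (zs n).
Proof. by elim: n => //= n ->; rewrite !inE !mem_zs andbT; lia. Qed.

Lemma size_zs n : size (zs n) = n.*2.+1.
Proof. by elim: n => //= n ->. Qed.

Lemma big_zsS (V : nmodType) n (F : int -> V) :
  \sum_(k <- zs n.+1) F k = F n.+1%:Z + F (- n.+1%:Z) + \sum_(k <- zs n) F k.
Proof. by rewrite /= !big_cons addrA. Qed.

Lemma big_zs0 (V : nmodType) (F : int -> V) : \sum_(k <- zs 0) F k = F 0.
Proof. by rewrite big_seq1. Qed.

Lemma big_zs_cond (V : nmodType) m n (F : int -> V) : (m <= n)%N ->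
  \sum_(k <- zs n | (`|k| <= m)%N) F k = \sum_(k <- zs m) F k.
Proof.
move=> mn; rewrite -big_filter; apply: perm_big; apply: uniq_perm.
- by rewrite filter_uniq// uniq_zs.
- exact: uniq_zs.
- by move=> k; rewrite mem_filter !mem_zs; lia.
Qed.

Lemma big_zs_split (V : nmodType) m n (F : int -> V) : (m <= n)%N ->
  \sum_(k <- zs n) F k =
  \sum_(k <- zs m) F k + \sum_(k <- zs n | (m < `|k|)%N) F k.
Proof.
move=> mn; rewrite (bigID (fun k : int => (`|k| <= m)%N)) /= big_zs_cond//.
by congr (_ + _); apply: eq_bigl => k; rewrite ltnNge.
Qed.

Lemma ler_zs_sum (R : numDomainType) m n (F : int -> R) : (m <= n)%N ->
  (forall k, 0 <= F k) -> \sum_(k <- zs m) F k <= \sum_(k <- zs n) F k.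
Proof.
by move=> mn F0; rewrite (big_zs_split _ mn) lerDl sumr_ge0.
Qed.

Lemma big_zs_pick (V : nmodType) n (F : int -> V) j :
  \sum_(k <- zs n) (if k == j then F k else 0) =
  if (`|j| <= n)%N then F j else 0.
Proof.
rewrite -big_mkcond /= -mem_zs; case: ifPn => jn.
  rewrite (big_rem j) //= eqxx big_seq_cond big1 ?addr0// => k.
  by rewrite mem_rem_uniq ?uniq_zs// inE => /andP[/andP[/negbTE->]].
rewrite big_seq_cond big1// => k /andP[kn /eqP kj].
by move: jn; rewrite -kj kn.
Qed.

Lemma inv_sqr_tail (R : realType) (J n : nat) : (0 < J)%N ->
  \sum_(k <- zs n | (J < `|k|)%N) (k%:~R ^+ 2)^-1 <= 2 / J%:R :> R.
Proof.
move=> J0; have [nJ|Jn] := leqP n J.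
  rewrite big_seq_cond big1 ?divr_ge0// => k; rewrite mem_zs; lia.
(* The stronger bound telescopes: 1 / (n + 1)^2 <= 1 / n - 1 / (n + 1), once for each sign of k. *)
suff: \sum_(k <- zs n | (J < `|k|)%N) (k%:~R ^+ 2)^-1 <=
      2 / J%:R - 2 / n%:R :> R.
  by move/le_trans; apply; rewrite lerBlDr lerDl divr_ge0.
elim: n Jn => // n IH; rewrite ltnS leq_eqVlt => /orP[/eqP<-|Jn].
  rewrite zsS !big_cons abszN absz_nat ltnSn.
  rewrite big_seq_cond big1 => [|k]; last by rewrite mem_zs; lia.
  rewrite addr0 !mulrNz sqrrN -!pmulrn.
  have j0 : 0 < J%:R :> R by rewrite ltr0n.
  rewrite -(natr1 J).
  have -> : 2 / J%:R - 2 / (J%:R + 1) = 2 / (J%:R * (J%:R + 1)) :> R by field; lra.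
  have : ((J%:R + 1) ^+ 2)^-1 <= (J%:R * (J%:R + 1))^-1 :> R.
    by rewrite lef_pV2 ?posrE; nra.
  lra.
rewrite zsS !big_cons abszN absz_nat (leq_trans Jn)//.
rewrite !mulrNz sqrrN -!pmulrn addrA; move: (IH Jn).
set s := \sum_(_ <- _ | _) _ => IHs.
have n0 : 0 < n%:R :> R by rewrite ltr0n (leq_ltn_trans _ Jn).
rewrite -(natr1 n).
have : ((n%:R + 1) ^+ 2)^-1 <= (n%:R * (n%:R + 1))^-1 :> R.
  by rewrite lef_pV2 ?posrE; nra.
have : 2 / n%:R - 2 / (n%:R + 1) = 2 / (n%:R * (n%:R + 1)) :> R by field; lra.
lra.
Qed.

End SymmetricSums.

(** * Integration on the torus *)

Section TorusIntegration.
Context {R : realType}.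
Local Notation mu := (@lebesgue_measure R).
Implicit Types (f g : R -> R[i]) (h : R -> R) (c : R[i]).

Definition tint h : Prop := mu.-integrable torus (EFin \o h).

Definition rmean h : R := (2 * pi)^-1 * \int[mu]_(x in torus) h x.

Definition cint f : Prop := tint (fun x => cRe (f x)) /\ tint (fun x => cIm (f x)).

Definition mean f : R[i] := (2 * pi)^-1%:C * cintegral torus f.

Lemma pi2_gt0 : 0 < 2 * pi :> R.
Proof. by rewrite mulr_gt0// pi_gt0. Qed.

Lemma measurable_torus : measurable (torus : set R).
Proof. exact: measurable_itv. Qed.

Local Hint Resolve measurable_torus : core.

Lemma mu_torus : mu torus = (2 * pi)%:E.
Proof.
rewrite /torus lebesgue_measure_itv/= lte_fin pi2_gt0.
by rewrite -EFinB subr0.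
Qed.

Lemma Re_mean f : cRe (mean f) = rmean (fun x => cRe (f x)).
Proof. by rewrite /mean cReZ. Qed.

Lemma Im_mean f : cIm (mean f) = rmean (fun x => cIm (f x)).
Proof. by rewrite /mean cImZ. Qed.

Lemma fourierE f k : fourier f k = mean (fun x => expi (- (k%:~R * x)) * f x).
Proof. by []. Qed.

Lemma rmean0 : rmean (cst 0) = 0.
Proof. by rewrite /rmean Rintegral_cst// mul0r mulr0. Qed.

Lemma rmean_cst r : rmean (fun=> r) = r.
Proof.
rewrite /rmean Rintegral_cst// -[X in _ * (_ * X)]/(fine (mu torus)) mu_torus.
rewrite /= mulrCA mulVf ?mulr1//.
by rewrite gt_eqF ?pi2_gt0.
Qed.

Lemma eq_rmean h1 h2 : (forall x, torus x -> h1 x = h2 x) -> rmean h1 = rmean h2.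
Proof.
by move=> e; rewrite /rmean; congr (_ * _); apply: eq_Rintegral => x /set_mem/e.
Qed.

Lemma eq_mean f g : (forall x, torus x -> f x = g x) -> mean f = mean g.
Proof.
move=> e; apply: complexP; rewrite !(Re_mean, Im_mean);
by apply: eq_rmean => x /e ->.
Qed.

Lemma rmeanD h1 h2 : tint h1 -> tint h2 ->
  rmean (fun x => h1 x + h2 x) = rmean h1 + rmean h2.
Proof. by move=> i1 i2; rewrite /rmean RintegralD// mulrDr. Qed.

Lemma rmeanB h1 h2 : tint h1 -> tint h2 ->
  rmean (fun x => h1 x - h2 x) = rmean h1 - rmean h2.
Proof. by move=> i1 i2; rewrite /rmean RintegralB// mulrBr. Qed.

Lemma rmeanZ r h : tint h -> rmean (fun x => r * h x) = r * rmean h.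
Proof. by move=> ih; rewrite /rmean RintegralZl// mulrCA. Qed.

Lemma rmean_ge0 h : (forall x, torus x -> 0 <= h x) -> 0 <= rmean h.
Proof.
by move=> h0; rewrite mulr_ge0 ?invr_ge0 ?(ltW pi2_gt0)// Rintegral_ge0.
Qed.

Lemma ler_rmean h1 h2 : tint h1 -> tint h2 ->
  (forall x, torus x -> h1 x <= h2 x) -> rmean h1 <= rmean h2.
Proof.
move=> i1 i2 le; rewrite /rmean ler_pM2l ?invr_gt0 ?pi2_gt0//.
exact: le_Rintegral.
Qed.

Lemma tintD h1 h2 : tint h1 -> tint h2 -> tint (fun x => h1 x + h2 x).
Proof. by move=> i1 i2; exact: (integrableD _ i1 i2). Qed.

Lemma tintB h1 h2 : tint h1 -> tint h2 -> tint (fun x => h1 x - h2 x).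
Proof. by move=> i1 i2; exact: (integrableB _ i1 i2). Qed.

Lemma tintZ r h : tint h -> tint (fun x => r * h x).
Proof. by move=> ih; exact: (integrableZl _ _ ih). Qed.

Lemma tint_le h1 h2 : measurable_fun torus h1 ->
  (forall x, torus x -> `|h1 x| <= h2 x) -> tint h2 -> tint h1.
Proof.
move=> m1 le; apply: le_integrable => //; first exact/measurable_EFinP.
by move=> x Tx /=; rewrite lee_fin (le_trans (le x Tx))// ler_norm.
Qed.

Lemma tint_cst r : tint (fun=> r).
Proof.
have fin : (mu torus < +oo)%E by rewrite mu_torus ltry.
apply: measurable_bounded_integrable => //.
by exists `|r|; split => [|B /ltW rB x _]; rewrite ?num_real.
Qed.

Lemma tint_bdd h B : measurable_fun torus h ->
  (forall x, torus x -> `|h x| <= B) -> tint h.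
Proof. by move=> mh hB; apply: tint_le hB _ => //; exact: tint_cst. Qed.

Lemma tint_meas h : tint h -> measurable_fun torus h.
Proof. by move=> /measurable_int/measurable_EFinP. Qed.

Lemma cintD f g : cint f -> cint g -> cint (fun x => f x + g x).
Proof.
move=> [fr fi] [gr gi]; split; under eq_fun do rewrite ?cReD ?cImD;
exact: tintD.
Qed.

Lemma cintZ c f : cint f -> cint (fun x => c * f x).
Proof.
move=> [fr fi]; split; under eq_fun do rewrite ?cReM ?cImM.
- by apply: tintB; exact: tintZ.
- by apply: tintD; exact: tintZ.
Qed.

Lemma cintN f : cint f -> cint (fun x => - f x).
Proof.
by move=> /(cintZ (-1)); congr cint; apply/funext => x; rewrite mulN1r.
Qed.

Lemma cintB f g : cint f -> cint g -> cint (fun x => f x - g x).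
Proof. by move=> cf /cintN cg; exact: cintD. Qed.

Lemma cint0 : cint (fun=> 0).
Proof. by split; exact: tint_cst. Qed.

Lemma cint_sum (I : Type) (r : seq I) (P : pred I) (F : I -> R -> R[i]) :
  (forall i, cint (F i)) -> cint (fun x => \sum_(i <- r | P i) F i x).
Proof.
move=> iF; elim: r => [|i r IH].
  by under eq_fun do rewrite big_nil; exact: cint0.
under eq_fun do rewrite big_cons.
by case: (P i) => //; exact: cintD.
Qed.

Lemma meanD f g : cint f -> cint g -> mean (fun x => f x + g x) = mean f + mean g.
Proof.
move=> [fr fi] [gr gi]; apply: complexP; rewrite ?cReD ?cImD !(Re_mean, Im_mean).
- by rewrite -rmeanD//; apply: eq_rmean => x _; rewrite cReD.
- by rewrite -rmeanD//; apply: eq_rmean => x _; rewrite cImD.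
Qed.

Lemma meanZ c f : cint f -> mean (fun x => c * f x) = c * mean f.
Proof.
move=> [fr fi]; apply: complexP.
- rewrite [LHS]Re_mean [RHS]cReM Re_mean Im_mean -!rmeanZ// -rmeanB.
  + by apply: eq_rmean => x _; rewrite cReM.
  + exact: tintZ.
  + exact: tintZ.
- rewrite [LHS]Im_mean [RHS]cImM Re_mean Im_mean -!rmeanZ// -rmeanD.
  + by apply: eq_rmean => x _; rewrite cImM.
  + exact: tintZ.
  + exact: tintZ.
Qed.

Lemma meanN f : cint f -> mean (fun x => - f x) = - mean f.
Proof.
by move=> cf; rewrite -mulN1r -meanZ//; apply: eq_mean => x _; rewrite mulN1r.
Qed.

Lemma meanB f g : cint f -> cint g -> mean (fun x => f x - g x) = mean f - mean g.
Proof. by move=> cf cg; rewrite meanD ?meanN//; exact: cintN. Qed.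

Lemma mean_cst c : mean (fun=> c) = c.
Proof. by apply: complexP; rewrite !(Re_mean, Im_mean) rmean_cst. Qed.

Lemma mean_sum (I : Type) (r : seq I) (P : pred I) (F : I -> R -> R[i]) :
  (forall i, cint (F i)) ->
  mean (fun x => \sum_(i <- r | P i) F i x) = \sum_(i <- r | P i) mean (F i).
Proof.
move=> iF; elim: r => [|i r IH].
  by rewrite big_nil -[RHS]mean_cst; apply: eq_mean => x _; rewrite big_nil.
rewrite big_cons -IH; case: ifP => Pi.
  rewrite -meanD//; last exact: cint_sum.
  by apply: eq_mean => x _; rewrite big_cons Pi.
by apply: eq_mean => x _; rewrite big_cons Pi.
Qed.

Lemma cint_conj f : cint f -> cint (fun x => (f x)^*).
Proof.
move=> [fr fi]; split; under eq_fun do rewrite ?cRe_conj ?cIm_conj; first by [].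
by under eq_fun do rewrite -mulN1r; exact: tintZ.
Qed.

Lemma mean_conj f : cint f -> mean (fun x => (f x)^*) = (mean f)^*.
Proof.
move=> [fr fi]; apply: complexP; rewrite ?cRe_conj ?cIm_conj ?(Re_mean, Im_mean).
  by apply: eq_rmean => x _; rewrite cRe_conj.
by rewrite -mulN1r -rmeanZ//; apply: eq_rmean => x _; rewrite cIm_conj mulN1r.
Qed.

Lemma tmeasD f g : tmeas f -> tmeas g -> tmeas (fun x => f x + g x).
Proof.
move=> [fr fi] [gr gi]; split; under eq_fun do rewrite ?cReD ?cImD;
exact: measurable_funD.
Qed.

Lemma tmeasM f g : tmeas f -> tmeas g -> tmeas (fun x => f x * g x).
Proof.
move=> [fr fi] [gr gi]; split; under eq_fun do rewrite ?cReM ?cImM.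
- by apply: measurable_funB; exact: measurable_funM.
- by apply: measurable_funD; exact: measurable_funM.
Qed.

Lemma tmeas_real h : measurable_fun torus h -> tmeas (fun x => (h x)%:C).
Proof. by move=> mh; split. Qed.

Lemma tmeas_cst c : tmeas (fun=> c).
Proof. by split; exact: measurable_cst. Qed.

Lemma tmeasZ c f : tmeas f -> tmeas (fun x => c * f x).
Proof. by move=> ?; apply: tmeasM => //; exact: tmeas_cst. Qed.

Lemma tmeasN f : tmeas f -> tmeas (fun x => - f x).
Proof.
by move=> /(tmeasZ (-1)); congr tmeas; apply/funext => x; rewrite mulN1r.
Qed.

Lemma tmeasB f g : tmeas f -> tmeas g -> tmeas (fun x => f x - g x).
Proof. by move=> mf /tmeasN mg; exact: tmeasD. Qed.

Lemma tmeas_conj f : tmeas f -> tmeas (fun x => (f x)^*).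
Proof.
move=> [fr fi]; split; under eq_fun do rewrite ?cRe_conj ?cIm_conj; first by [].
exact: measurableT_comp.
Qed.

Lemma tmeas_expi (r : R) : tmeas (fun x => expi (r * x)).
Proof.
split; apply: measurable_funTS => /=; apply: measurableT_comp => //;
  apply: continuous_measurable_fun.
- exact: continuous_cos.
- exact: continuous_sin.
Qed.

Lemma measurable_normc2 f : tmeas f ->
  measurable_fun torus (fun x => normc (f x) ^+ 2).
Proof.
move=> [fr fi]; under eq_fun do rewrite normc_sqr.
by apply: measurable_funD; exact: measurable_funX.
Qed.

Lemma measurable_normc f : tmeas f -> measurable_fun torus (fun x => normc (f x)).
Proof.
move=> mf; rewrite (_ : (fun x => _) = fun x => Num.sqrt (normc (f x) ^+ 2)).
  apply: (@measurableT_comp _ _ _ _ _ _ (@Num.sqrt R)).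
    by apply: continuous_measurable_fun; exact: sqrt_continuous.
  exact: measurable_normc2.
by apply/funext => x; rewrite sqrtr_sqr ger0_norm// normc_ge0.
Qed.

Lemma cint_meas f : cint f -> tmeas f.
Proof. by move=> [fr fi]; split; exact: tint_meas. Qed.

Lemma cint_normc f : cint f -> tint (fun x => normc (f x)).
Proof.
move=> cf; have [fr fi] := cf.
apply: (@tint_le _ (fun x => `|cRe (f x)| + `|cIm (f x)|)).
- by apply: measurable_normc; exact: cint_meas.
- by move=> x _; rewrite ger0_norm ?normc_ge0// ler_ReIm.
- by apply: tintD; exact: integrable_norm.
Qed.

Lemma cint_le f h : tmeas f -> (forall x, torus x -> normc (f x) <= h x) ->
  tint h -> cint f.
Proof.
move=> [fr fi] fh ih; split; apply: tint_le ih => // x Tx.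
- by rewrite (le_trans (ler_Re _))// fh.
- by rewrite (le_trans (ler_Im _))// fh.
Qed.

Lemma cint_bdd f B : tmeas f -> (forall x, torus x -> normc (f x) <= B) -> cint f.
Proof. by move=> mf fB; apply: cint_le fB _ => //; exact: tint_cst. Qed.

Lemma cintMbdd f g B : tmeas g -> (forall x, torus x -> normc (g x) <= B) ->
  cint f -> cint (fun x => g x * f x).
Proof.
move=> mg gB cf.
apply: (@cint_le _ (fun x => B * normc (f x))).
- by apply: tmeasM => //; exact: cint_meas.
- by move=> x Tx; rewrite normcM ler_wpM2r ?normc_ge0 ?gB.
- by apply: tintZ; exact: cint_normc.
Qed.

(* Multiplying [f] by a unimodular constant makes its mean nonnegative. *)
Lemma normc_mean f : cint f -> normc (mean f) <= rmean (fun x => normc (f x)).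
Proof.
move=> cf; set z := mean f.
have [z0|z0] := eqVneq (normc z) 0.
  by rewrite z0 rmean_ge0// => x _; exact: normc_ge0.
pose c := (normc z)^-1%:C * z^*.
have cz : c * z = (normc z)%:C.
  rewrite /c -mulrA (mulrC _ z) mulcJ -rmorphM; congr (_%:C).
  by rewrite expr2 mulKf.
have c1 : normc c = 1.
  rewrite /c normcM normc_conj normc_real.
  by rewrite ger0_norm ?invr_ge0 ?normc_ge0// mulVf.
have -> : normc z = rmean (fun x => cRe (c * f x)).
  by rewrite -Re_mean meanZ// cz.
apply: ler_rmean.
- by have [] := cintZ c cf.
- exact: cint_normc.
- move=> x _; rewrite (le_trans (ler_norm _))// (le_trans (ler_Re _))//.
  by rewrite normcM c1 mul1r.
Qed.

Lemma normc_mean_bdd f B : tmeas f -> (forall x, torus x -> normc (f x) <= B) ->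
  normc (mean f) <= B.
Proof.
move=> mf fB; have cf := cint_bdd mf fB.
rewrite (le_trans (normc_mean cf))// -[leRHS]rmean_cst.
by apply: ler_rmean => //; [exact: cint_normc|exact: tint_cst].
Qed.

Definition L2 f : Prop := tmeas f /\ tint (fun x => normc (f x) ^+ 2).

(** Normalised by the length of the torus, so that Parseval holds with constant 1; [L2norm] is not,
    whence the factors [2 * pi] in comparisons of the two. *)
Definition msq f : R := rmean (fun x => normc (f x) ^+ 2).

Lemma msq_ge0 f : 0 <= msq f.
Proof. by apply: rmean_ge0 => x _; exact: sqr_ge0. Qed.

Lemma L2_normP f : (L2norm f < +oo)%E <-> L2 f.
Proof.
rewrite /L2norm; case: ifPn => [/asboolP mf|/asboolP nmf]; last first.
  by split => // -[].
have m2 : measurable_fun torus (EFin \o (fun x => normc (f x) ^+ 2)).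
  by apply/measurable_EFinP; exact: measurable_normc2.
have e : (\int[mu]_(x in torus) `|(normc (f x) ^+ 2)%:E| =
          \int[mu]_(x in torus) (normc (f x) ^+ 2)%:E)%E.
  by apply: eq_integral => x _; rewrite gee0_abs// lee_fin sqr_ge0.
split=> [lt|[_ /integrableP[_]]].
  split=> //; apply/integrableP; split => //.
  under eq_integral do rewrite /=.
  rewrite e; apply: lty_poweRy lt; by rewrite invr_eq0.
under eq_integral do rewrite /=.
by rewrite e => lt; exact: poweR_lty.
Qed.

Lemma L2norm_msq f : L2 f -> L2norm f = (Num.sqrt (2 * pi * msq f))%:E.
Proof.
move=> [mf f2]; rewrite /L2norm; case: asboolP => // _.
have /fineK <- : (\int[mu]_(x in torus) (normc (f x) ^+ 2)%:E)%E \is a fin_num.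
  by apply: (@integrable_fin_num _ _ _ mu torus _ _ f2); exact: measurable_itv.
rewrite poweR_EFin; congr (_%:E).
rewrite powR12_sqrt; last first.
  by apply: fine_ge0; apply: integral_ge0 => x _; rewrite lee_fin sqr_ge0.
congr Num.sqrt; rewrite /msq /rmean mulVKf// gt_eqF//; exact: pi2_gt0.
Qed.

Lemma L2Z c f : L2 f -> L2 (fun x => c * f x).
Proof.
move=> [mf f2]; split; first exact: tmeasZ.
by under eq_fun do rewrite normcM exprMn; exact: tintZ.
Qed.

Lemma normcD2 (z w : R[i]) :
  normc (z + w) ^+ 2 <= 2 * normc z ^+ 2 + 2 * normc w ^+ 2.
Proof.
have : normc (z + w) ^+ 2 <= (normc z + normc w) ^+ 2.
  by rewrite ler_sqr ?nnegrE ?addr_ge0 ?normc_ge0 ?le_normcD.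
by have := sqr_ge0 (normc z - normc w); lra.
Qed.

Lemma L2D f g : L2 f -> L2 g -> L2 (fun x => f x + g x).
Proof.
move=> [mf f2] [mg g2]; have m := tmeasD mf mg; split => //.
apply: (@tint_le _ (fun x => 2 * normc (f x) ^+ 2 + 2 * normc (g x) ^+ 2)).
- exact: measurable_normc2.
- by move=> x _; rewrite ger0_norm ?sqr_ge0// normcD2.
- by apply: tintD; exact: tintZ.
Qed.

Lemma L2N f : L2 f -> L2 (fun x => - f x).
Proof.
by move=> /(L2Z (-1)); congr L2; apply/funext => x; rewrite mulN1r.
Qed.

Lemma L2B f g : L2 f -> L2 g -> L2 (fun x => f x - g x).
Proof. by move=> mf /L2N mg; exact: L2D. Qed.

Lemma L2_bdd f B : tmeas f -> (forall x, torus x -> normc (f x) <= B) -> L2 f.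
Proof.
move=> mf fB; split=> //; apply: (@tint_bdd _ (B ^+ 2)).
  exact: measurable_normc2.
move=> x Tx; rewrite ger0_norm ?sqr_ge0// ler_sqr ?nnegrE ?normc_ge0 ?fB//.
exact: le_trans (normc_ge0 (f x)) (fB _ Tx).
Qed.

Lemma L2Mbdd f g B : tmeas g -> (forall x, torus x -> normc (g x) <= B) ->
  L2 f -> L2 (fun x => g x * f x).
Proof.
move=> mg gB [mf f2]; have m := tmeasM mg mf; split => //.
apply: (@tint_le _ (fun x => B ^+ 2 * normc (f x) ^+ 2)).
- exact: measurable_normc2.
- move=> x Tx; rewrite ger0_norm ?sqr_ge0// normcM exprMn.
  rewrite ler_wpM2r ?sqr_ge0// ler_sqr ?nnegrE ?normc_ge0 ?gB//.
  exact: le_trans (normc_ge0 (g x)) (gB _ Tx).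
- exact: tintZ.
Qed.

Lemma L2_sum (I : Type) (r : seq I) (P : pred I) (F : I -> R -> R[i]) :
  (forall i, L2 (F i)) -> L2 (fun x => \sum_(i <- r | P i) F i x).
Proof.
move=> iF; elim: r => [|i r IH].
  under eq_fun do rewrite big_nil; apply: (@L2_bdd _ 0); first exact: tmeas_cst.
  by move=> x _; rewrite normc0.
under eq_fun do rewrite big_cons.
by case: (P i) => //; exact: L2D.
Qed.

Lemma cint_L2M f g : L2 f -> L2 g -> cint (fun x => f x * g x).
Proof.
move=> [mf f2] [mg g2].
apply: (@cint_le _ (fun x => normc (f x) ^+ 2 + normc (g x) ^+ 2)).
- exact: tmeasM.
- move=> x _; rewrite normcM.
  move: (normc_ge0 (f x)) (normc_ge0 (g x)); nra.
- exact: tintD.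
Qed.

Lemma L2_cint f : L2 f -> cint f.
Proof.
move=> f2.
have o : L2 (fun=> 1).
  apply: (@L2_bdd _ 1); first exact: tmeas_cst.
  by move=> x _; rewrite normc1.
have := cint_L2M o f2; congr cint; by apply/funext => x; rewrite mul1r.
Qed.

(* Cauchy-Schwarz, by choosing l in |fg| <= (l |f|^2 + |g|^2 / l) / 2. *)
Lemma normc_mean_CS f g : L2 f -> L2 g ->
  rmean (fun x => normc (f x) * normc (g x)) <=
  Num.sqrt (msq f) * Num.sqrt (msq g).
Proof.
move=> Lf Lg; have [mf f2] := Lf; have [mg g2] := Lg.
set m := rmean _.
have ip : tint (fun x => normc (f x) * normc (g x)).
  have := cint_normc (cint_L2M Lf Lg); congr tint; apply/funext => x.
  by rewrite normcM.
have key l : 0 < l -> 2 * m <= l * msq f + l^-1 * msq g.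
  move=> l0; rewrite -!rmeanZ// -rmeanD; [|exact: tintZ..].
  apply: ler_rmean; [exact: tintZ|by apply: tintD; exact: tintZ|].
  move=> x _; set a := normc (f x); set b := normc (g x).
  have := sqr_ge0 (l * a - b).
  have -> : l * a ^+ 2 + l^-1 * b ^+ 2 = 2 * (a * b) + l^-1 * (l * a - b) ^+ 2.
    by field; rewrite gt_eqF.
  by move=> h; rewrite lerDl mulr_ge0 ?invr_ge0 ?(ltW l0).
set a := Num.sqrt (msq f); set b := Num.sqrt (msq g).
have a0 : 0 <= a by exact: sqrtr_ge0.
have b0 : 0 <= b by exact: sqrtr_ge0.
have am : msq f = a ^+ 2 by rewrite sqr_sqrtr ?msq_ge0.
have bm : msq g = b ^+ 2 by rewrite sqr_sqrtr ?msq_ge0.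
apply/ler_addgt0Pr => e e0.
pose d := e / (a + b + 1).
have ab1 : 0 < a + b + 1 by lra.
have d0 : 0 < d by rewrite divr_gt0.
(* The optimal l is b / a. Adding d to both keeps it defined and positive when a norm vanishes, at a
   cost of d (a + b) <= e. *)
have := key ((b + d) / (a + d)) ltac:(by rewrite divr_gt0 ?ltr_wpDl).
rewrite am bm invf_div => h.
have ad0 : 0 <= a * d by rewrite mulr_ge0// ltW.
have bd0 : 0 <= b * d by rewrite mulr_ge0// ltW.
have h1 : (b + d) / (a + d) * a ^+ 2 <= (b + d) * a.
  rewrite mulrAC ler_pdivrMr ?ltr_wpDl// -mulrA ler_wpM2l ?addr_ge0 ?(ltW d0)//.
  by rewrite expr2 mulrDr lerDl.
have h2 : (a + d) / (b + d) * b ^+ 2 <= (a + d) * b.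
  rewrite mulrAC ler_pdivrMr ?ltr_wpDl// -mulrA ler_wpM2l ?addr_ge0 ?(ltW d0)//.
  by rewrite expr2 mulrDr lerDl.
have : d * (a + b) <= e.
  by rewrite /d mulrAC ler_pdivrMr// ler_wpM2l ?ltW//; lra.
nra.
Qed.

Lemma normc_meanM f g : L2 f -> L2 g ->
  normc (mean (fun x => f x * g x)) <= Num.sqrt (msq f) * Num.sqrt (msq g).
Proof.
move=> Lf Lg; apply: le_trans (normc_mean_CS Lf Lg).
apply: le_trans (normc_mean (cint_L2M Lf Lg)) _.
by under [X in rmean X <= _]eq_fun do rewrite normcM.
Qed.

End TorusIntegration.

(** * Fourier series *)

Section FourierCoefficients.
Context {R : realType}.
Local Notation mu := (@lebesgue_measure R).
Implicit Types (f g : R -> R[i]) (c : R[i]) (a b : int -> R[i]) (j k : int).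

Definition ek k : R -> R[i] := fun x => expi (k%:~R * x).

Lemma expi_2pi k : expi (k%:~R * (2 * pi)) = 1 :> R[i].
Proof.
have H n : expi (n%:R * (2 * pi)) = 1 :> R[i].
  elim: n => [|n IH]; first by rewrite mul0r expi0.
  rewrite -natr1 mulrDl expiD IH mul1r mul1r mulr_natl.
  by apply: complexP; rewrite /= ?cos2pi ?sin2pi.
case: (intP k) => [|n|n]; rewrite ?mul0r ?expi0//; first exact: (H n.+1).
by rewrite mulrNz mulNr expiN (H n.+1) conjc1.
Qed.

Lemma rmean_derive (F F' : R -> R) : (forall x : R, is_derive x (1 : R) F (F' x)) ->
  continuous F' -> F (2 * pi) = F 0 -> rmean F' = 0.
Proof.
move=> dF cF' FF; rewrite /rmean.
have cF : continuous F.
  move=> x; have Dx : derivable F x 1 by exact: ex_derive.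
  by apply: differentiable_continuous; exact/derivable1_diffP.
have ii : mu.-integrable `[0, 2 * pi] (EFin \o F').
  apply: continuous_compact_integrable; first exact: segment_compact.
  exact: continuous_subspaceT.
have io : mu.-integrable `[0, 2 * pi[ (EFin \o F').
  by apply: integrableS ii => //; exact: subset_itv_co_cc.
rewrite Rintegral_itv_bndo_bndc// /Rintegral.
rewrite (@continuous_FTC2 _ F' F)//.
- by rewrite -EFinB/= FF subrr mulr0.
- exact: pi2_gt0.
- exact: continuous_subspaceT.
- split=> [x _||]; first exact: ex_derive.
  + by apply: cvg_at_right_filter; exact: cF.
  + by apply: cvg_at_left_filter; exact: cF.
- by move=> x _; rewrite derive1E derive_val.
Qed.

Lemma mean_ek k : mean (ek k) = (k == 0)%:R.
Proof.
have [->|k0] := eqVneq k 0.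
  rewrite -[RHS]mean_cst; apply: eq_mean => x _.
  by rewrite /ek mul0r expi0.
have kR : k%:~R != 0 :> R by rewrite intr_eq0.
have dk (x : R) : is_derive x (1 : R) (fun x : R => k%:~R * x) (k%:~R : R).
  by apply: is_derive_eq; rewrite /GRing.scale/= mulr1 ?mulr0 ?addr0 ?add0r.
have E : expi (k%:~R * (2 * pi)) = expi (k%:~R * 0) :> R[i].
  by rewrite expi_2pi mulr0 expi0.
have ck : continuous (fun x : R => k%:~R * x).
  exact: mulrl_continuous.
apply: complexP; rewrite ?(Re_mean, Im_mean)/=.
- apply: (@rmean_derive (fun x => (k%:~R)^-1 * sin (k%:~R * x))).
  + move=> x; apply: is_derive_eq.
    by rewrite /GRing.scale/= mulrCA mulVf// mulr1.
  + by move=> x; apply: continuous_comp; [exact: ck|exact: continuous_cos].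
  + by move/(congr1 (@complex.Im R)): E => /= ->.
- apply: (@rmean_derive (fun x => - (k%:~R)^-1 * cos (k%:~R * x))).
  + move=> x; apply: is_derive_eq.
    by rewrite /GRing.scale/= !mulNr mulrN opprK mulrCA mulVf// mulr1.
  + by move=> x; apply: continuous_comp; [exact: ck|exact: continuous_sin].
  + by move/(congr1 (@complex.Re R)): E => /= ->.
Qed.

Lemma tmeas_ek k : tmeas (ek k).
Proof. exact: tmeas_expi. Qed.

Lemma normc_ek k x : normc (ek k x) = 1.
Proof. exact: normc_expi. Qed.

Lemma ekD j k x : ek (j + k) x = ek j x * ek k x.
Proof. by rewrite /ek intrD mulrDl expiD. Qed.

Lemma ekN k x : ek (- k) x = (ek k x)^*.
Proof. by rewrite /ek mulrNz mulNr expiN. Qed.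

Lemma ek0 x : ek 0 x = 1.
Proof. by rewrite /ek mul0r expi0. Qed.

Lemma fourier_ekN f k : fourier f k = mean (fun x => ek (- k) x * f x).
Proof. by rewrite fourierE; apply: eq_mean => x _; rewrite ekN /ek expiN. Qed.

Lemma cint_ekM f k : cint f -> cint (fun x => ek k x * f x).
Proof.
apply: (@cintMbdd _ _ _ 1); first exact: tmeas_ek.
by move=> x _; rewrite normc_ek.
Qed.

Lemma L2_ekM f k : L2 f -> L2 (fun x => ek k x * f x).
Proof.
apply: (@L2Mbdd _ _ _ 1); first exact: tmeas_ek.
by move=> x _; rewrite normc_ek.
Qed.

Lemma L2_ek k : L2 (ek k).
Proof.
apply: (@L2_bdd _ _ 1); first exact: tmeas_ek.
by move=> x _; rewrite normc_ek.
Qed.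

Lemma eq_fourier f g k : (forall x, torus x -> f x = g x) -> fourier f k = fourier g k.
Proof. by move=> e; rewrite !fourierE; apply: eq_mean => x /e ->. Qed.

Lemma fourierD f g k : cint f -> cint g ->
  fourier (fun x => f x + g x) k = fourier f k + fourier g k.
Proof.
move=> cf cg; rewrite !fourier_ekN -meanD; [|exact: cint_ekM..].
by apply: eq_mean => x _; rewrite mulrDr.
Qed.

Lemma fourierZ c f k : cint f -> fourier (fun x => c * f x) k = c * fourier f k.
Proof.
move=> cf; rewrite !fourier_ekN -meanZ; last exact: cint_ekM.
by apply: eq_mean => x _; rewrite mulrCA.
Qed.

Lemma fourierN f k : cint f -> fourier (fun x => - f x) k = - fourier f k.
Proof.
by move=> cf; rewrite -mulN1r -fourierZ//; apply: eq_fourier => x _; rewrite mulN1r.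
Qed.

Lemma fourierB f g k : cint f -> cint g ->
  fourier (fun x => f x - g x) k = fourier f k - fourier g k.
Proof. by move=> cf cg; rewrite fourierD ?fourierN//; exact: cintN. Qed.

Lemma fourier_sum (I : Type) (r : seq I) (P : pred I) (F : I -> R -> R[i]) k :
  (forall i, cint (F i)) -> fourier (fun x => \sum_(i <- r | P i) F i x) k =
    \sum_(i <- r | P i) fourier (F i) k.
Proof.
move=> iF; rewrite fourier_ekN.
transitivity (mean (fun x => \sum_(i <- r | P i) ek (- k) x * F i x)).
  by apply: eq_mean => x _; rewrite mulr_sumr.
rewrite mean_sum; last by move=> i; exact: cint_ekM.
by apply: eq_bigr => i _; rewrite fourier_ekN.
Qed.

Lemma fourier_ek j k : fourier (ek j) k = (k == j)%:R.
Proof.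
rewrite fourier_ekN -[RHS]/((k == j)%:R) -subr_eq0 -oppr_eq0 opprB -mean_ek.
by apply: eq_mean => x _; rewrite -ekD addrC.
Qed.

Definition trig n a : R -> R[i] := fun x => \sum_(k <- zs n) a k * ek k x.

Lemma L2_trig n a : L2 (trig n a).
Proof. by apply: L2_sum => k; apply: L2Z; exact: L2_ek. Qed.

Lemma fourier_trig n a k : fourier (trig n a) k = if (`|k| <= n)%N then a k else 0.
Proof.
rewrite fourier_sum; last by move=> i; apply: cintZ; exact: L2_cint (L2_ek _).
rewrite -(big_zs_pick _ a); apply: eq_bigr => i _.
rewrite fourierZ; last exact: L2_cint (L2_ek _).
by rewrite fourier_ek eq_sym; case: eqVneq => _; rewrite ?mulr1 ?mulr0.
Qed.

Lemma mean_trigM n a f : cint f ->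
  mean (fun x => (trig n a x)^* * f x) = \sum_(k <- zs n) (a k)^* * fourier f k.
Proof.
move=> cf.
transitivity (mean (fun x => \sum_(k <- zs n) (a k)^* * (ek (- k) x * f x))).
  apply: eq_mean => x _; rewrite /trig rmorph_sum mulr_suml.
  by apply: eq_bigr => k _; rewrite ekN rmorphM mulrA.
rewrite mean_sum; last by move=> k; apply: cintZ; exact: cint_ekM.
apply: eq_bigr => k _; rewrite meanZ; last exact: cint_ekM.
by rewrite fourier_ekN.
Qed.

Lemma msq_mean f : L2 f -> mean (fun x => (f x)^* * f x) = (msq f)%:C.
Proof.
move=> _; apply: complexP; rewrite ?(Re_mean, Im_mean).
- by apply: eq_rmean => x _; rewrite mulrC mulcJ.
- by rewrite -[RHS]rmean0; apply: eq_rmean => x _; rewrite mulrC mulcJ.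
Qed.

Lemma L2_conj f : L2 f -> L2 (fun x => (f x)^*).
Proof.
move=> [mf f2]; split; first exact: tmeas_conj.
by under eq_fun do rewrite normc_conj.
Qed.

Lemma msq_trig n a : msq (trig n a) = \sum_(k <- zs n) normc (a k) ^+ 2.
Proof.
apply: (@complexI R); rewrite -msq_mean; last exact: L2_trig.
rewrite mean_trigM; last exact: L2_cint (L2_trig _ _).
rewrite rmorph_sum; apply: eq_big_seq => k; rewrite mem_zs fourier_trig => ->.
by rewrite mulrC mulcJ.
Qed.

(** Pythagoras for the partial sum p: the pairings of f with p, of p with f and of p with itself all
    equal the sum of the squared coefficients. *)
Lemma msqB_trig n f :
  L2 f -> msq (fun x => f x - trig n (fourier f) x) =
          msq f - \sum_(k <- zs n) normc (fourier f k) ^+ 2.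
Proof.
move=> Lf; set p := trig n _; have Lp : L2 p by exact: L2_trig.
set S := \sum_(k <- zs n) _; apply: (@complexI R).
rewrite -msq_mean; last exact: L2B.
have pf : mean (fun x => (p x)^* * f x) = S%:C.
  rewrite mean_trigM; last exact: L2_cint.
  by rewrite rmorph_sum; apply: eq_bigr => k _; rewrite mulrC mulcJ.
have fp : mean (fun x => (f x)^* * p x) = S%:C.
  rewrite -[RHS]conjc_real -pf -mean_conj.
    by apply: eq_mean => x _; rewrite rmorphM /= conjcK mulrC.
  by apply: cint_L2M => //; exact: L2_conj.
have pp : mean (fun x => (p x)^* * p x) = S%:C.
  by rewrite msq_mean// /p msq_trig.
transitivity (mean (fun x => ((f x)^* * f x - (f x)^* * p x) -
                             ((p x)^* * f x - (p x)^* * p x))).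
  by apply: eq_mean => x _; rewrite rmorphB /=; ring.
have ci g1 g2 : L2 g1 -> L2 g2 -> cint (fun x => (g1 x)^* * g2 x).
  by move=> L1 L22; apply: cint_L2M => //; exact: L2_conj.
rewrite meanB; [|by apply: cintB; exact: ci..].
rewrite !meanB; [|exact: ci..].
by rewrite fp pf pp subrr subr0 msq_mean// rmorphB.
Qed.

Lemma bessel n f : L2 f -> \sum_(k <- zs n) normc (fourier f k) ^+ 2 <= msq f.
Proof. by move=> Lf; rewrite -subr_ge0 -msqB_trig// msq_ge0. Qed.

Lemma normc_fourier_msq f k : L2 f -> normc (fourier f k) ^+ 2 <= msq f.
Proof.
move=> Lf; apply: le_trans (bessel `|k| Lf).
rewrite (big_rem k) ?mem_zs//= lerDl; apply: sumr_ge0 => j _; exact: sqr_ge0.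
Qed.

End FourierCoefficients.

(** * Weierstrass approximation by Bernstein polynomials *)

Section Bernstein.
Context {R : realType}.
Implicit Types (phi psi : nat -> R) (x c : R).

(* The Bernstein polynomial \sum_i phi i 'C(n, i) X^i (1 - X)^(n - i), through
   the Pascal recursion. *)
Fixpoint bernstein n phi : {poly R} :=
  if n is m.+1 then
    (1 - 'X) * bernstein m phi + 'X * bernstein m (fun i => phi i.+1)
  else (phi 0%N)%:P.

Lemma bernsteinS n phi x : (bernstein n.+1 phi).[x] =
  (1 - x) * (bernstein n phi).[x] + x * (bernstein n (fun i => phi i.+1)).[x].
Proof. by rewrite /= !hornerE. Qed.

Lemma bernstein_le n phi psi x : 0 <= x <= 1 ->
  (forall i, (i <= n)%N -> phi i <= psi i) ->
  (bernstein n phi).[x] <= (bernstein n psi).[x].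
Proof.
move=> /andP[x0 x1]; elim: n phi psi => [|n IH] phi psi le.
  by rewrite /= !hornerE le.
rewrite !bernsteinS lerD// ler_wpM2l ?subr_ge0//; apply: IH => i ni; apply: le => //.
exact: leqW.
Qed.

(** Second moment of the binomial law about c: the variance n x (1 - x) plus the squared bias. The
    induction needs c arbitrary, as shifting the index shifts c. *)
Lemma bernstein_quadratic n (a b c : R) x :
  (bernstein n (fun i => a + b * (i%:R - c) ^+ 2)).[x] =
  a + b * (n%:R * x * (1 - x) + (n%:R * x - c) ^+ 2).
Proof.
elim: n a b c => [|n IH] a b c; first by rewrite /= !hornerE; ring.
rewrite bernsteinS IH.
have -> : (fun i => a + b * (i.+1%:R - c) ^+ 2) =
          (fun i => a + b * (i%:R - (c - 1)) ^+ 2).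
  by apply/funext => i; rewrite -natr1; ring.
by rewrite IH -natr1; ring.
Qed.

(** Continuity is assumed in the form d + C (x - y)^2 because f is then squeezed between two
    quadratics, on which the Bernstein operator is explicit; its monotonicity finishes without
    splitting the sum into near and far nodes. *)
Lemma weierstrass_unit (f : R -> R) (e : R) : 0 < e ->
  (forall d, 0 < d -> exists C : R, forall x y, 0 <= x <= 1 -> 0 <= y <= 1 ->
     `|f x - f y| <= d + C * (x - y) ^+ 2) ->
  exists p : {poly R}, forall x, 0 <= x <= 1 -> `|p.[x] - f x| <= e.
Proof.
move=> e0 H; have [C0 HC0] := H (e / 2) ltac:(by rewrite divr_gt0).
pose C := `|C0|.
have HC x y : 0 <= x <= 1 -> 0 <= y <= 1 ->
    `|f x - f y| <= e / 2 + C * (x - y) ^+ 2.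
  move=> hx hy; rewrite (le_trans (HC0 _ _ hx hy))// lerD2l ler_wpM2r ?sqr_ge0//.
  exact: ler_norm.
have C_ge0 : 0 <= C by exact: normr_ge0.
(* The variance term is C x (1 - x) / n <= C / n, to be kept below e / 2. *)
pose n := (Num.truncn (2 * C / e)).+1.
have nC : 2 * C / e < n%:R by exact: truncnS_gt.
have n0 : 0 < n%:R :> R by rewrite ltr0n.
exists (bernstein n (fun i => f (i%:R / n%:R))) => x hx.
have /andP[x0 x1] := hx.
have hi i : (i <= n)%N -> 0 <= (i%:R / n%:R : R) <= 1.
  by move=> ni; rewrite divr_ge0 ?ler0n//= ler_pdivrMr// mul1r ler_nat.
have fi i : (i <= n)%N -> `|f (i%:R / n%:R) - f x| <=
    e / 2 + C / n%:R ^+ 2 * (i%:R - n%:R * x) ^+ 2.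
  move=> ni; apply: le_trans (HC _ _ (hi _ ni) hx) _; rewrite lerD2l.
  by rewrite -mulrA ler_wpM2l// le_eqVlt; apply/orP/or_introl/eqP; field; lra.
have bound : C / n%:R ^+ 2 * (n%:R * x * (1 - x) + (n%:R * x - n%:R * x) ^+ 2) <= e / 2.
  rewrite subrr expr0n addr0.
  have -> : C / n%:R ^+ 2 * (n%:R * x * (1 - x)) = C / n%:R * (x * (1 - x)) by field; lra.
  have : C / n%:R <= e / 2.
    by move: nC; rewrite ltr_pdivrMr// ler_pdivrMr// => h; lra.
  have : x * (1 - x) <= 1 by nra.
  have : 0 <= x * (1 - x) by nra.
  have : 0 <= C / n%:R by rewrite divr_ge0 ?ler0n.
  nra.
set q := (bernstein _ _).[x].
have up : q <= f x + e / 2 + C / n%:R ^+ 2 *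
    (n%:R * x * (1 - x) + (n%:R * x - n%:R * x) ^+ 2).
  rewrite -bernstein_quadratic; apply: bernstein_le => // i ni.
  by move: (fi i ni); rewrite ler_norml => /andP[_]; lra.
have lo : f x - e / 2 + (- (C / n%:R ^+ 2)) *
    (n%:R * x * (1 - x) + (n%:R * x - n%:R * x) ^+ 2) <= q.
  rewrite -bernstein_quadratic; apply: bernstein_le => // i ni.
  by move: (fi i ni); rewrite ler_norml => /andP[+ _]; lra.
rewrite mulNr in lo; rewrite ler_norml; apply/andP; split; lra.
Qed.

(** Completing the square in L z <= d + L^2 z^2 / (4 d) gives the quadratic modulus that
    [weierstrass_unit] expects. *)
Lemma lipschitz_modulus (f : R -> R) (L d x y : R) : 0 < d ->
  `|f x - f y| <= L * `|x - y| -> `|f x - f y| <= d + L ^+ 2 / (4 * d) * (x - y) ^+ 2.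
Proof.
move=> d0 h; apply: le_trans h _; rewrite -[(x - y) ^+ 2]real_normK ?num_real//.
set z := `|_|; have -> : d + L ^+ 2 / (4 * d) * z ^+ 2 =
  L * z + (d - L * z / 2) ^+ 2 / d by field; lra.
by rewrite lerDl divr_ge0 ?sqr_ge0// ltW.
Qed.

Lemma weierstrass_lipschitz (f : R -> R) (a b L e : R) : a < b -> 0 < e ->
  (forall x y, a <= x <= b -> a <= y <= b -> `|f x - f y| <= L * `|x - y|) ->
  exists p : {poly R}, forall x, a <= x <= b -> `|p.[x] - f x| <= e.
Proof.
move=> ab e0 H.
pose s (x : R) := a + (b - a) * x.
have [d d0|p hp] := @weierstrass_unit (f \o s) _ e0.
  exists ((L * (b - a)) ^+ 2 / (4 * d)) => x y hx hy.
  apply: lipschitz_modulus => //=.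
  have -> : L * (b - a) * `|x - y| = L * `|s x - s y|.
    rewrite -mulrA; congr (_ * _); rewrite -[X in X * _]ger0_norm ?subr_ge0 ?ltW//.
    by rewrite -normrM; congr `|_|; rewrite /s; ring.
  apply: H; rewrite /s; nra.
exists (p \Po ((b - a)^-1 *: ('X - a%:P))) => x hx.
have {1}-> : x = s ((b - a)^-1 * (x - a)) by rewrite /s; field; lra.
rewrite horner_comp !hornerE.
have -> : s ((b - a)^-1 * (x - a)) - a = (b - a) * ((b - a)^-1 * (x - a)).
  by rewrite /s; ring.
rewrite mulKf; last by lra.
have -> : f x = (f \o s) ((b - a)^-1 * (x - a)) by rewrite /= /s; congr f; field; lra.
have /andP[xa xb] := hx; apply: hp; rewrite mulrC; apply/andP; split.
  by apply: divr_ge0; lra.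
by rewrite ler_pdivrMr; lra.
Qed.

End Bernstein.

(** * Almost-everywhere reasoning and dominated convergence *)

Section DominatedConvergence.
Context {R : realType}.
Local Notation mu := (@lebesgue_measure R).

Lemma aeS (P Q : R -> Prop) : (forall x, P x -> Q x) ->
  {ae mu, forall x, P x} -> {ae mu, forall x, Q x}.
Proof. by apply: filterS; exact: (ae_filter_ringOfSetsType mu). Qed.

Lemma aeS2 (P Q S : R -> Prop) : (forall x, P x -> Q x -> S x) ->
  {ae mu, forall x, P x} -> {ae mu, forall x, Q x} -> {ae mu, forall x, S x}.
Proof. by apply: filterS2; exact: (ae_filter_ringOfSetsType mu). Qed.

Lemma Rintegral_dominated_cvg (D : set R) (F : nat -> R -> R) (h g : R -> R) :
  measurable D -> (forall n, measurable_fun D (F n)) ->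
  (forall x, D x -> F n x @[n --> \oo] --> h x) ->
  mu.-integrable D (EFin \o g) -> (forall n x, D x -> `|F n x| <= g x) ->
  mu.-integrable D (EFin \o h) /\
  (\int[mu]_(x in D) F n x) @[n --> \oo] --> \int[mu]_(x in D) h x.
Proof.
move=> mD mF Fh ig Fg.
have mh : measurable_fun D h by exact: measurable_fun_cvg mF Fh.
have [|||||ih _ cv] := @dominated_convergence _ _ _ mu D mD
  (fun n => EFin \o F n) (EFin \o h) (EFin \o g).
- by move=> n; apply/measurable_EFinP; exact: mF.
- exact/measurable_EFinP.
- apply: aeW => x Dx; apply: cvg_EFin; last exact: Fh.
  by apply: nearW => n.
- exact: ig.
- by apply: aeW => x n Dx; rewrite /= lee_fin Fg.
split=> //; rewrite /Rintegral; apply: fine_cvg.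
by rewrite fineK//; exact: integrable_fin_num ih.
Qed.

End DominatedConvergence.

(* The indicator of ]0, b[ is that of {cos (x - b / 2) > cos (b / 2)}, hence the
   limit of Lipschitz functions of cos (x - b / 2), and these are uniform limits
   of polynomials in cos (x - b / 2), i.e. of trigonometric polynomials. *)
Section Completeness.
Context {R : realType}.
Local Notation mu := (@lebesgue_measure R).
Implicit Types (f : R -> R[i]) (h : R -> R) (x m : R) (k : int).

Lemma cos_expi x : (cos x)%:C = 2^-1%:C * (expi x + expi (- x)) :> R[i].
Proof.
by apply: complexP; rewrite ?cReZ ?cImZ /= ?cosN ?sinN ?subrr ?mulr0//; lra.
Qed.

Lemma ek_cos k m x : ek k x * (cos (x - m))%:C =
  2^-1%:C * (expi (- m) * ek (k + 1) x + expi m * ek (k - 1) x).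
Proof.
rewrite cos_expi opprB !expiD !ekD ekN /ek mul1r !expiN.
by ring.
Qed.

Lemma tmeas_cos_comp (phi : R -> R) m : measurable_fun setT phi ->
  tmeas (fun x => (phi (cos (x - m)))%:C).
Proof.
move=> mphi; apply: tmeas_real; apply: measurable_funTS.
apply: measurableT_comp => //; apply: measurableT_comp => //.
  by apply: continuous_measurable_fun; exact: continuous_cos.
by apply: measurable_funB => //; exact: measurable_cst.
Qed.

(** Multiplication by cos (x - m) shifts frequencies by one in both directions, so the induction
    carries the vanishing of every coefficient of p(cos) f and not of its mean alone. *)
Lemma mean_cos_poly f m (p : {poly R}) : cint f -> (forall k, fourier f k = 0) ->
  cint (fun x => (p.[cos (x - m)])%:C * f x) /\
  forall k, mean (fun x => ek k x * ((p.[cos (x - m)])%:C * f x)) = 0.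
Proof.
move=> cf f0; elim/poly_ind: p => [|p c [IHc IH]].
  split=> [|k].
    rewrite (_ : (fun x => _) = fun=> 0); first exact: cint0.
    by apply/funext => x; rewrite horner0 mul0r.
  by rewrite -[RHS]mean_cst; apply: eq_mean => x _; rewrite horner0 mul0r mulr0.
set g := fun x => _ in IHc; have E x : (p * 'X + c%:P).[cos (x - m)]%:C * f x =
    (cos (x - m))%:C * g x + c%:C * f x.
  by rewrite !hornerE /g rmorphD rmorphM /=; ring.
have cg : cint (fun x => (cos (x - m))%:C * g x).
  apply: (@cintMbdd _ _ _ 1) => //.
    by apply: (@tmeas_cos_comp id); exact: measurable_id.
  by move=> x _; rewrite normc_real cos_max.
split; first by under eq_fun do rewrite E; apply: cintD => //; exact: cintZ.
move=> k.
transitivity (mean (fun x => 2^-1%:C * (expi (- m) * (ek (k + 1) x * g x) +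
   expi m * (ek (k - 1) x * g x)) + c%:C * (ek (- - k) x * f x))).
  apply: eq_mean => x _; rewrite E mulrDr mulrA ek_cos opprK; ring.
have ck j : cint (fun x => ek j x * g x) by exact: cint_ekM.
rewrite meanD; last 2 first.
- by apply: cintZ; apply: cintD; exact: cintZ.
- by apply: cintZ; exact: cint_ekM.
rewrite !meanZ ?meanD ?meanZ -?fourier_ekN ?f0//; last 4 first.
- exact: cintZ.
- exact: cintZ.
- exact: cint_ekM.
- by apply: cintD; exact: cintZ.
have IH' j : mean (fun x => ek j x * g x) = 0 by exact: IH.
by rewrite !IH' !(mulr0, addr0).
Qed.

Lemma lipschitz_measurable (phi : R -> R) (L : R) :
  (forall x y, `|phi x - phi y| <= L * `|x - y|) -> measurable_fun setT phi.
Proof.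
move=> lip; apply: continuous_measurable_fun => x.
apply/cvgrPdist_le => e e0; near=> y.
apply: le_trans (lip x y) _.
apply: (@le_trans _ _ ((`|L| + 1) * `|x - y|)).
  by rewrite ler_wpM2r// (le_trans (ler_norm L))// lerDl.
rewrite -ler_pdivlMl ?ltr_wpDl//; near: y.
by apply: cvgr_dist_le => //; rewrite mulr_gt0// invr_gt0 ltr_wpDl.
Unshelve. all: by end_near. Qed.

Lemma mean_cos_lipschitz f m (phi : R -> R) (L : R) :
  cint f -> (forall k, fourier f k = 0) ->
  (forall x y, `|phi x - phi y| <= L * `|x - y|) ->
  mean (fun x => (phi (cos (x - m)))%:C * f x) = 0.
Proof.
move=> cf f0 lip; have mphi := lipschitz_measurable lip.
apply: eq0_normc; apply/eqP.
rewrite eq_le normc_ge0 andbT; apply/ler_addgt0Pr => e e0; rewrite add0r.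
set F := rmean (fun x => normc (f x)).
have F0 : 0 <= F by apply: rmean_ge0 => x _; exact: normc_ge0.
have d0 : 0 < e / (F + 1) by rewrite divr_gt0// ltr_wpDl.
have [|p hp] := @weierstrass_lipschitz R phi (-1) 1 L _ _ d0 (fun x y _ _ => lip x y).
  by lra.
have hcos x : -1 <= cos (x - m) <= 1 by rewrite cos_geN1 cos_le1.
have [cp p0] := mean_cos_poly m p cf f0.
have pe : mean (fun x => (p.[cos (x - m)])%:C * f x) = 0.
  by rewrite -(p0 0); apply: eq_mean => x _; rewrite ek0 mul1r.
pose q x := (phi (cos (x - m)) - p.[cos (x - m)])%:C.
have mq : tmeas q.
  rewrite /q; apply: (@tmeas_cos_comp (fun y => phi y - p.[y])).
  apply: measurable_funB => //; apply: continuous_measurable_fun.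
  exact: continuous_horner.
have qb x : torus x -> normc (q x) <= e / (F + 1).
  by move=> _; rewrite normc_real distrC hp.
have cq : cint (fun x => q x * f x) by exact: cintMbdd mq qb cf.
have -> : mean (fun x => (phi (cos (x - m)))%:C * f x) = mean (fun x => q x * f x).
  rewrite -[RHS]addr0 -pe -meanD//; apply: eq_mean => x _.
  by rewrite -mulrDl -rmorphD subrK.
apply: le_trans (normc_mean cq) _.
apply: (@le_trans _ _ (e / (F + 1) * F)); last first.
  by rewrite mulrAC ler_pdivrMr ?ltr_wpDl// ler_wpM2l ?(ltW e0)// lerDl.
rewrite /F -rmeanZ; last exact: cint_normc.
apply: ler_rmean; first exact: cint_normc.
  by apply: tintZ; exact: cint_normc.
move=> x Tx; rewrite normcM ler_wpM2r ?normc_ge0//.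
exact: qb.
Qed.

Definition ramp (c : R) (n : nat) (y : R) : R := Num.min 1 (Num.max 0 (n%:R * (y - c))).

Lemma ramp_lipschitz c n x y : `|ramp c n x - ramp c n y| <= n%:R * `|x - y|.
Proof.
rewrite -[X in _ <= X * _]ger0_norm ?ler0n// -normrM.
have -> : n%:R * (x - y) = n%:R * (x - c) - n%:R * (y - c) by ring.
rewrite /ramp; move: (n%:R * (x - c)) (n%:R * (y - c)) => a b.
have d1 (u v : R) : u - v <= `|u - v| /\ v - u <= `|u - v|.
  by split; [exact: ler_norm|rewrite distrC; exact: ler_norm].
have mx (u v : R) : `|Num.max 0 u - Num.max 0 v| <= `|u - v|.
  have [h1 h2] := d1 u v; have := normr_ge0 (u - v).
  by rewrite ler_norml; case: (lerP 0 u); case: (lerP 0 v); lra.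
have mn (u v : R) : `|Num.min 1 u - Num.min 1 v| <= `|u - v|.
  have [h1 h2] := d1 u v; have := normr_ge0 (u - v).
  by rewrite ler_norml; case: (lerP 1 u); case: (lerP 1 v); lra.
exact: le_trans (mn _ _) (mx _ _).
Qed.

Lemma ramp_bound c n y : 0 <= ramp c n y <= 1.
Proof. by rewrite /ramp ge_min lexx le_min ler01 le_max lexx. Qed.

Lemma ramp_cvg c y : ramp c n y @[n --> \oo] --> ((c < y)%R%:R : R).
Proof.
case: ltP => cy /=.
  apply: cvg_near_cst; near=> n; rewrite /ramp.
  have h : 1 <= n%:R * (y - c).
    rewrite -ler_pdivrMr ?subr_gt0//; near: n; exact: nbhs_infty_ger.
  by rewrite max_r ?min_l//; lra.
apply: cvg_near_cst; apply: nearW => n; rewrite /ramp max_l ?min_r//.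
by rewrite mulr_ge0_le0// subr_le0.
Unshelve. all: by end_near. Qed.

Lemma cos_arc (b x : R) : 0 < b < 2 * pi -> torus x ->
  (cos (b / 2) < cos (x - b / 2)) = (0 < x < b).
Proof.
move=> /andP[b0 b1]; rewrite /torus /= in_itv /= => /andP[x0 x1].
have pb : 0 <= b / 2 <= pi by rewrite divr_ge0 ?ltW//=; lra.
have mono (y z : R) : 0 <= y <= pi -> 0 <= z <= pi -> (cos y < cos z) = (z < y).
  by move=> hy hz; rewrite ltr_cos// in_itv.
have E : (0 < x < b) = (`|x - b / 2| < b / 2).
  by rewrite ltr_norml; apply/andP/andP => -[]; split; lra.
rewrite E -(cos_norm (x - _)); set y := `|_|.
have y0 : 0 <= y by exact: normr_ge0.
have [yp|yp] := leP y pi; first by rewrite mono ?y0.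
(* When y exceeds pi it is reflected to [2 * pi - y], where cos is monotone and which is still
   larger than [b / 2]: both sides are then false. *)
have yb : y < 2 * pi - b / 2.
  rewrite /y; case: (lerP 0 (x - b / 2)) => h; first by rewrite ger0_norm//; lra.
  by rewrite ltr0_norm//; lra.
have -> : cos y = cos (2 * pi - y) :> R.
  by rewrite -cosN -(cosD2pi (- y)) mulr_natl; congr cos; ring.
rewrite mono//; last by apply/andP; split; lra.
by apply/idP/idP; lra.
Qed.

Lemma integral_arc f (b : R) : cint f -> (forall k, fourier f k = 0) ->
  0 < b < 2 * pi ->
  rmean (fun x => (0 < x < b)%R%:R * cRe (f x)) = 0.
Proof.
move=> cf f0 hb.
have zero n : rmean (fun x => ramp (cos (b / 2)) n (cos (x - b / 2)) * cRe (f x)) = 0.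
  have := mean_cos_lipschitz (b / 2) cf f0
    (ramp_lipschitz (cos (b / 2)) n).
  move/(congr1 (@complex.Re R)); rewrite Re_mean /= => <-.
  by apply: eq_rmean => x _; rewrite cReZ.
have [fr fi] := cf.
pose F n x := ramp (cos (b / 2)) n (cos (x - b / 2)) * cRe (f x).
have [|||||_] := @Rintegral_dominated_cvg R torus F
   (fun x => (0 < x < b)%R%:R * cRe (f x)) (fun x => `|cRe (f x)|).
- exact: measurable_torus.
- move=> n; apply: measurable_funM; last exact: tint_meas.
  by have [] := @tmeas_cos_comp _ (b / 2)
    (lipschitz_measurable (ramp_lipschitz (cos (b / 2)) n)).
- move=> x Tx; apply: cvgM; last exact: cvg_cst.
  by rewrite -(cos_arc hb Tx); exact: ramp_cvg.
- exact: integrable_norm.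
- move=> n x _; rewrite normrM ler_piMl//.
  by have /andP[? ?] := ramp_bound (cos (b / 2)) n (cos (x - b / 2)); rewrite ger0_norm.
have F0 n : \int[mu]_(x in torus) F n x = 0.
  by move/eqP: (zero n); rewrite mulf_eq0 invr_eq0 gt_eqF ?pi2_gt0//= => /eqP.
under eq_fun do rewrite F0.
move=> /(cvg_lim (@Rhausdorff R)); rewrite lim_cst; last exact: Rhausdorff.
by rewrite /rmean => <-; rewrite mulr0.
Qed.

(** By [integral_arc] the primitive of Re f starting at 0 vanishes on ]0, 2 pi[, while by Lebesgue
    differentiation its derivative is Re f almost everywhere. *)
Lemma fourier_complete_Re f : cint f -> (forall k, fourier f k = 0) ->
  {ae mu, forall x, torus x -> cRe (f x) = 0}.
Proof.
move=> cf f0; have [fr _] := cf.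
pose h := (fun x => cRe (f x)) \_ torus.
have ih : mu.-integrable setT (EFin \o h).
  have [+ _] := @integrable_mkcond _ _ _ mu torus (EFin \o (fun x => cRe (f x)))
    (measurable_itv _).
  by move=> /(_ fr); rewrite /h restrict_EFin.
have int0 b : 0 < b < 2 * pi -> \int[mu]_(x in `]0, b]) h x = 0.
  move=> /[dup] hb /andP[b0 b1].
  have -> : \int[mu]_(x in `]0, b]) h x = \int[mu]_(x in `]0, b[) h x.
    rewrite Rintegral_itv_bndo_bndc//; apply: integrableS ih => //.
  move/eqP: (integral_arc cf f0 hb).
  rewrite /rmean mulf_eq0 invr_eq0 gt_eqF ?pi2_gt0//= => /eqP E.
  rewrite -[RHS]E Rintegral_mkcond [RHS]Rintegral_mkcond; apply: eq_Rintegral => x _.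
  rewrite /h !patchE; case: (boolP (x \in torus)) => [|nT].
    move=> /set_mem Tx; case: (boolP (x \in _)) => [/set_mem|].
      by rewrite /= in_itv/= => ->; rewrite mul1r.
    by rewrite notin_setE /= in_itv/= => /negP/negbTE ->; rewrite mul0r.
  by case: ifP.
have := @FTC1 R h (BRight 0) _ _.
have ih' y : mu.-integrable [set` Interval (BRight 0) (BRight y)] (EFin \o h).
  by apply: integrableS ih.
have lh : locally_integrable [set: R] h.
  apply: open_integrable_locally => //; exact: openT.
move=> /(_ ih' lh); set F := fun x => _ => H.
have z0 : {ae mu, forall x, x != 0}.
  exists [set 0]; split => //; first exact: lebesgue_measure_set1.
  by move=> x /= /negP; rewrite negbK => /eqP.
apply: aeS2 H z0 => x Fx x0 Tx.
have /andP[x0' x1] : 0 < x < 2 * pi.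
  by move: Tx; rewrite /torus /= in_itv/= => /andP[hx ->]; rewrite andbT lt_def hx andbT.
have hx : h x = cRe (f x) by rewrite /h patchE mem_set.
have [_] := Fx x0'; rewrite hx => <-.
rewrite derive1E (@near_eq_derive _ _ _ F (cst 0)) ?derive_cst//.
near=> y; apply: int0; apply/andP; split.
  by near: y; exact: lt_nbhsr.
by near: y; exact: lt_nbhsl.
Unshelve. all: by end_near. Qed.

Lemma fourier_complete f : cint f -> (forall k, fourier f k = 0) ->
  {ae mu, forall x, torus x -> f x = 0}.
Proof.
move=> cf f0.
have c2 : cint (fun x => - 'i * f x) by exact: cintZ.
have g0 k : fourier (fun x => - 'i * f x) k = 0.
  by rewrite fourierZ// f0 mulr0.
apply: aeS2 (fourier_complete_Re cf f0) (fourier_complete_Re c2 g0).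
move=> x h1 h2 Tx; apply: complexP; first by rewrite h1.
by move: (h2 Tx); rewrite cReM /= oppr0 mul0r sub0r mulN1r opprK.
Qed.

End Completeness.

(** * The Riesz-Fischer theorem *)

Section RieszFischer.
Context {R : realType}.
Local Notation mu := (@lebesgue_measure R).
Implicit Types (f g : R -> R[i]) (h : R -> R) (x : R) (a : int -> R[i]).

Lemma eq_rmean_ae h1 h2 : measurable_fun torus h1 -> measurable_fun torus h2 ->
  {ae mu, forall x, torus x -> h1 x = h2 x} -> rmean h1 = rmean h2.
Proof.
move=> m1 m2 e; rewrite /rmean /Rintegral; congr (_ * fine _).
apply: ae_eq_integral.
- exact: measurable_itv.
- exact/measurable_EFinP.
- exact/measurable_EFinP.
- by apply: aeS e => x h Tx; rewrite /= h.
Qed.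

Lemma rmean_integral h : tint h ->
  (\int[mu]_(x in torus) (h x)%:E = (2 * pi * rmean h)%:E)%E.
Proof.
move=> ih; rewrite /rmean mulVKf ?gt_eqF ?pi2_gt0// /Rintegral fineK//.
by apply: (@integrable_fin_num _ _ _ mu torus _ _ ih); exact: measurable_itv.
Qed.

Lemma trigB n a b x : trig n a x - trig n b x = trig n (fun k => a k - b k) x.
Proof. by rewrite /trig -sumrB; apply: eq_bigr => k _; rewrite mulrBl. Qed.

Lemma msq_trigB m n a : (m <= n)%N ->
  msq (fun x => trig n a x - trig m a x) =
  \sum_(k <- zs n) normc (a k) ^+ 2 - \sum_(k <- zs m) normc (a k) ^+ 2.
Proof.
move=> mn; pose b k := if (m < `|k|)%N then a k else 0.
have -> : (fun x => trig n a x - trig m a x) = trig n b.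
  apply/funext => x; rewrite /trig (big_zs_split _ mn) addrAC subrr add0r.
  by rewrite big_mkcond /=; apply: eq_bigr => k _; rewrite /b; case: ifP; rewrite ?mul0r.
rewrite msq_trig (big_zs_split (fun k => normc (a k) ^+ 2) mn) addrAC subrr add0r.
rewrite [RHS]big_mkcond; apply: eq_bigr => k _; rewrite /b.
by case: ifP => //; rewrite normc0 expr0n.
Qed.

Lemma sum_half n : \sum_(0 <= i < n) (2^-1 : R) ^+ i <= 2.
Proof.
suff -> : \sum_(0 <= i < n) (2^-1 : R) ^+ i = 2 - 2 * 2^-1 ^+ n.
  by rewrite gerBl mulr_ge0// exprn_ge0.
elim: n => [|n IH]; first by rewrite big_geq// expr0 mulr1 subrr.
by rewrite big_nat_recr//= IH exprS; lra.
Qed.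

Lemma monotone_bounded_tail (S : nat -> R) (B e : R) :
  {homo S : m n / (m <= n)%N >-> m <= n} -> (forall n, S n <= B) -> 0 < e ->
  exists N, forall m n, (N <= m)%N -> (m <= n)%N -> S n - S m <= e.
Proof.
move=> mono SB e0.
have cv : cvgn S.
  by apply: nondecreasing_is_cvgn => //; exists B => _ [n _ <-].
have Sle n : S n <= limn S by exact: nondecreasing_cvgn_le.
have : \forall n \near \oo, `|limn S - S n| <= e by exact: cvgr_dist_le.
case=> N _ HN; exists N => m n Nm mn.
by apply: le_trans (le_trans (ler_norm _) (HN m Nm)); exact: lerB.
Qed.

Lemma limn_einf_le (u : nat -> \bar R) (c : \bar R) :
  (forall n, (u n <= c)%E) -> (limn_einf u <= c)%E.
Proof.
move=> uc; rewrite limn_einf_lim; apply: lime_le; first exact: is_cvg_einfs.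
by apply: nearW => n; apply: le_trans (uc n); apply: ereal_inf_lbound; exists n => /=.
Qed.

Lemma cvg_telescope_abs (u : nat -> R) (d : nat -> R) (B : R) :
  (forall n, `|u n.+1 - u n| <= d n) -> (forall n, \sum_(0 <= i < n) d i <= B) ->
  cvgn u.
Proof.
move=> ud dB.
have d0 n : 0 <= d n by exact: le_trans (normr_ge0 _) (ud n).
have cd : cvgn (series d).
  apply: nondecreasing_is_cvgn.
    by apply: nondecreasing_series => n _ _; exact: d0.
  by exists B => _ [n _ <-]; exact: dB.
have : cvgn (series (telescope u)).
  apply: normed_cvg; apply: series_le_cvg cd => // n; exact: normr_ge0.
rewrite telescopeK => cu.
have -> : u = (fun n => [sequence u n - u 0%N]_n n + cst (u 0%N) n).
  by apply/funext => n /=; rewrite subrK.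
by apply: is_cvgD => //; exact: is_cvg_cst.
Qed.

(** Along indices phi i whose tails are below 4^-i, the increments have mean at most 2^-i by
    Cauchy-Schwarz, so their sum D is integrable and finite almost everywhere, where the partial
    sums converge. Fatou's lemma carries the tail bound to the limit, and that rate identifies the
    coefficients. *)
Lemma riesz_fischer a (B : R) :
  (forall n, \sum_(k <- zs n) normc (a k) ^+ 2 <= B) ->
  exists f, exists phi : nat -> nat,
  [/\ L2 f, forall k, fourier f k = a k,
      forall i, msq (fun x => f x - trig (phi i) a x) <= (4^-1) ^+ i
    & {ae mu, forall x, torus x ->
         normc (trig (phi i) a x - f x) @[i --> \oo] --> 0}].
Proof.
move=> aB; pose S n := \sum_(k <- zs n) normc (a k) ^+ 2.
have Smono : {homo S : m n / (m <= n)%N >-> m <= n}.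
  by move=> m n mn; apply: ler_zs_sum => // k; exact: sqr_ge0.
have /choice[psi hpsi] i := monotone_bounded_tail Smono aB
  (exprn_gt0 i (ltac:(by rewrite invr_gt0) : 0 < (4^-1 : R))).
(* Summation makes phi nondecreasing; phi i also dominates psi i and i. *)
pose phi i := (\sum_(0 <= j < i.+1) psi j + i)%N.
have phiS i : (phi i <= phi i.+1)%N by rewrite /phi leq_add// [leqRHS]big_nat_recr//= leq_addr.
have phi_mono : {homo phi : m n / (m <= n)%N >-> (m <= n)%N}.
  by apply: homo_leq => // m n p; exact: leq_trans.
have phi_psi i : (psi i <= phi i)%N by rewrite /phi big_nat_recr//= -addnA addnCA leq_addr.
have phi_id i : (i <= phi i)%N by rewrite /phi leq_addl.
pose p i := trig (phi i) a.
have Lp i : L2 (p i) by exact: L2_trig.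
have Lpp i j : L2 (fun x => p j x - p i x) by exact: L2B.
have ptail i j : (i <= j)%N -> msq (fun x => p j x - p i x) <= 4^-1 ^+ i.
  by move=> ij; rewrite msq_trigB ?phi_mono//; exact: hpsi (phi_psi i) (phi_mono _ _ ij).
pose d i x := normc (p i.+1 x - p i x).
have id_ i : tint (d i) by apply: cint_normc; exact: L2_cint.
have d_le i : rmean (d i) <= 2^-1 ^+ i.
  have L1 : L2 (fun=> 1 : R[i]).
    by apply: (@L2_bdd _ _ 1) => [|x _]; [exact: tmeas_cst|rewrite normc1].
  have := normc_mean_CS (Lpp i i.+1) L1.
  have -> : msq (fun=> 1 : R[i]) = 1.
    by rewrite /msq normc1 expr1n rmean_cst.
  rewrite sqrtr1 mulr1 normc1.
  under [X in rmean X <= _]eq_fun do rewrite mulr1.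
  move=> /le_trans; apply; rewrite -[leRHS]ger0_norm ?exprn_ge0// -sqrtr_sqr.
  rewrite ler_wsqrtr// -exprM mulnC exprM.
  apply: le_trans (ptail i i.+1 _) _ => //.
  by rewrite expr2 -invfM -natrM.
pose D x := (\sum_(i <oo) (d i x)%:E)%E.
have d0 i x : (0 <= (d i x)%:E)%E by rewrite lee_fin normc_ge0.
have md i : measurable_fun torus (EFin \o d i).
  by apply/measurable_EFinP; exact: tint_meas.
have D0 x : (0 <= D x)%E by apply: nneseries_ge0 => n _ _.
have mD : measurable_fun torus D.
  by apply: ge0_emeasurable_sum => [k x _ _|k _]; [exact: d0|exact: md].
have iD : mu.-integrable torus D.
  apply/integrableP; split => //.
  under eq_integral do rewrite gee0_abs//.
  rewrite integral_nneseries//; last exact: measurable_itv.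
  apply: (@le_lt_trans _ _ (2 * pi * 2)%:E); last exact: ltry.
  apply: lime_le; first by apply: is_cvg_nneseries => n _ _; exact: integral_ge0.
  apply: nearW => n.
  under eq_bigr do rewrite rmean_integral//.
  rewrite sumEFin lee_fin -mulr_sumr ler_wpM2l ?(ltW pi2_gt0)//.
  by apply: le_trans (sum_half n); exact: ler_sum.
have Dfin : {ae mu, forall x, torus x -> D x \is a fin_num}.
  by apply: integrable_ae iD; exact: measurable_itv.
have cvgp x : D x \is a fin_num ->
    cvgn (fun i => cRe (p i x)) /\ cvgn (fun i => cIm (p i x)).
  move=> fD.
  have bd n : \sum_(0 <= i < n) d i x <= fine (D x).
    rewrite -lee_fin fineK// -sumEFin.
    by apply: nneseries_lim_ge => k _ _.
  split; apply: cvg_telescope_abs bd => n.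
  - by rewrite -cReN -cReD; exact: ler_Re.
  - by rewrite -cImN -cImD; exact: ler_Im.
(* An upper limit is measurable whether or not the sequence converges; where D is finite it is the
   limit. *)
pose f x := fine (limn_esup (fun i => (cRe (p i x))%:E)) +i*
            fine (limn_esup (fun i => (cIm (p i x))%:E)).
have mf : tmeas f.
  split; apply: (@measurableT_comp _ _ _ _ _ _ fine) => //;
    apply: measurable_fun_limn_esup => n; apply/measurable_EFinP.
  - by have [[]] := Lp n.
  - by have [[]] := Lp n.
have limf (u : nat -> R) : cvgn u -> u @ \oo --> fine (limn_esup (EFin \o u)).
  move=> cu; have : (EFin \o u) @ \oo --> (limn u)%:E.
    by apply: cvg_EFin; [exact: nearW|exact: cu].
  by move=> /cvg_limn_einf_sup[_ ->].
have fcvg x : D x \is a fin_num -> normc (p i x - f x) @[i --> \oo] --> 0.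
  move=> /cvgp[cr ci]; apply/cvgr0Pnorm_le => e e0.
  have e2 : 0 < e / 2 by rewrite divr_gt0.
  have h1 : \forall i \near \oo, `|cRe (f x) - cRe (p i x)| <= e / 2.
    by apply: cvgr_dist_le => //; exact: limf.
  have h2 : \forall i \near \oo, `|cIm (f x) - cIm (p i x)| <= e / 2.
    by apply: cvgr_dist_le => //; exact: limf.
  near=> i; rewrite ger0_norm ?normc_ge0//.
  rewrite (le_trans (ler_ReIm _))// cReD cImD cReN cImN (splitr e) lerD//.
  - by rewrite distrC; near: i.
  - by rewrite distrC; near: i.
have fp i : L2 (fun x => f x - p i x) /\ msq (fun x => f x - p i x) <= 4^-1 ^+ i.
  have mfp : tmeas (fun x => f x - p i x) by apply: tmeasB => //; have [] := Lp i.
  pose F j x := (normc (p (i + j)%N x - p i x) ^+ 2)%:E.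
  have mF j : measurable_fun torus (F j).
    by apply/measurable_EFinP; apply: measurable_normc2; have [] := Lpp i (i + j)%N.
  have F0 j x : torus x -> (0 <= F j x)%E by rewrite lee_fin sqr_ge0.
  have e : ae_eq mu torus (fun x => (normc (f x - p i x) ^+ 2)%:E)
      (fun x => limn_einf (F ^~ x)).
    apply: aeS Dfin => x Dx Tx; apply/esym; have /fcvg c := Dx Tx.
    suff: F ^~ x @ \oo --> (normc (f x - p i x) ^+ 2)%:E.
      by move=> /cvg_limn_einf_sup[-> _].
    apply: cvg_EFin; first exact: nearW.
    rewrite (_ : fine \o _ = fun j => normc (p (i + j)%N x - p i x) ^+ 2)//.
    have c' : normc (p (i + j)%N x - p i x) @[j --> \oo] --> normc (f x - p i x).
      apply/cvgrPdist_le => eps eps0.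
      have : \forall j \near \oo, normc (p (i + j)%N x - f x) <= eps.
        move/cvgr0Pnorm_le: c => /(_ eps eps0)[N _ HN]; exists N => // j Nj.
        have := HN (i + j)%N; rewrite /= ger0_norm ?normc_ge0//; apply.
        by rewrite (leq_trans Nj)// leq_addl.
      apply: filterS => j hj; apply: le_trans (ler_dist_normc _ _) _.
      by rewrite opprB addrA subrK normcB.
    by rewrite expr2; under eq_fun do rewrite expr2; exact: cvgM.
  have le4 : (\int[mu]_(x in torus) (normc (f x - p i x) ^+ 2)%:E <=
      (2 * pi * 4^-1 ^+ i)%:E)%E.
    have -> : (\int[mu]_(x in torus) (normc (f x - p i x) ^+ 2)%:E =
        \int[mu]_(x in torus) limn_einf (F ^~ x))%E.
      apply: ae_eq_integral e; first exact: measurable_itv.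
        by apply/measurable_EFinP; exact: measurable_normc2.
      apply: measurableT_comp => //.
      apply: (@measurable_fun_limn_esup _ _ _ _ (fun n x => - F n x)%E) => j.
      exact: measurableT_comp.
    apply: le_trans (@fatou _ _ _ mu torus (measurable_itv _) F mF _) _.
      by move=> j x; exact: F0.
    apply: limn_einf_le => j; rewrite rmean_integral; last by have [] := Lpp i (i + j)%N.
    by rewrite lee_fin ler_wpM2l ?(ltW pi2_gt0)// ptail// leq_addr.
  have L : L2 (fun x => f x - p i x).
    split=> //; apply/integrableP; split.
      by apply/measurable_EFinP; exact: measurable_normc2.
    under eq_integral do rewrite /= ger0_norm ?sqr_ge0//.
    by apply: le_lt_trans le4 _; exact: ltry.
  split=> //; move: le4; rewrite rmean_integral; last by case: L.
  by rewrite lee_fin ler_pM2l ?pi2_gt0.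
have Lf : L2 f.
  have [L _] := fp 0%N; have := L2D L (Lp 0%N); congr L2.
  by apply/funext => x; rewrite subrK.
exists f, phi; split => //.
- move=> k; apply/eqP; rewrite -subr_eq0; apply/eqP.
  apply: eq0_normc; apply/eqP; rewrite -sqrf_eq0 eq_le sqr_ge0 andbT.
  suff cv : (4^-1 : R) ^+ i @[i --> \oo] --> 0.
    rewrite -(cvg_lim (@Rhausdorff R) cv); apply: limr_ge; first exact: cvgP cv.
    near=> i; have [L le4] := fp i.
    apply: le_trans le4; have := normc_fourier_msq k L.
    rewrite fourierB; [|exact: L2_cint..].
    rewrite fourier_trig (leq_trans _ (phi_id i))//.
    near: i; exact: nbhs_infty_ge.
  by apply: cvg_expr; rewrite ger0_norm// invf_lt1// ltr1n.
- by move=> i; have [] := fp i.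
- by apply: aeS Dfin => x Dx Tx; exact: fcvg (Dx Tx).
Unshelve. all: by end_near. Qed.

End RieszFischer.

(** * Parseval, Fourier multipliers and Sobolev norms *)

Section Parseval.
Context {R : realType}.
Local Notation mu := (@lebesgue_measure R).
Implicit Types (f g : R -> R[i]) (h : R -> R) (x : R) (a b : int -> R[i]) (k : int).

Lemma msq_ae f g : tmeas f -> tmeas g ->
  {ae mu, forall x, torus x -> f x = g x} -> msq f = msq g.
Proof.
move=> mf mg e; apply: eq_rmean_ae; [exact: measurable_normc2..|].
by apply: aeS e => x h Tx; rewrite h.
Qed.

Lemma fourier_inj f g : L2 f -> L2 g -> (forall k, fourier f k = fourier g k) ->
  {ae mu, forall x, torus x -> f x = g x}.
Proof.
move=> Lf Lg e.
have L : L2 (fun x => f x - g x) by exact: L2B.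
have [|] := @fourier_complete _ _ (L2_cint L).
  by move=> k; rewrite fourierB ?e ?subrr//; exact: L2_cint.
move=> N HN; exists N; move: HN => [? ? HN]; split => // x hx; apply: HN => h; apply: hx.
by move=> /h/eqP; rewrite subr_eq0 => /eqP.
Qed.

(** Riesz-Fischer rebuilds from the coefficients of f a function g that is an L^2 limit of partial
    sums; g = f almost everywhere by completeness, so the partial sums approximate f itself. *)
Lemma parseval_dense f (e : R) : L2 f -> 0 < e -> exists n,
  msq f <= \sum_(k <- zs n) normc (fourier f k) ^+ 2 + e.
Proof.
move=> Lf e0; have [g [phi [Lg gf gphi _]]] := riesz_fischer (fun n => bessel n Lf).
have fg := fourier_inj Lf Lg (fun k => esym (gf k)).
have : (4^-1 : R) ^+ i @[i --> \oo] --> 0.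
  by apply: cvg_expr; rewrite ger0_norm// invf_lt1// ltr1n.
move=> /cvgr0Pnorm_le => /(_ e e0)[i _ /(_ i (leqnn i))]; rewrite /= ger0_norm ?exprn_ge0// => ie.
exists (phi i); rewrite -lerBlDl; apply: le_trans ie.
apply: le_trans (gphi i); rewrite -msqB_trig//.
have Lt := L2_trig (phi i) (fourier f).
rewrite (@msq_ae _ (fun x => g x - trig (phi i) (fourier f) x))//.
- by case: (L2B Lf Lt).
- by case: (L2B Lg Lt).
- by apply: aeS fg => x h Tx; rewrite h.
Qed.

Lemma parseval_le f (B : R) : L2 f ->
  (forall n, \sum_(k <- zs n) normc (fourier f k) ^+ 2 <= B) -> msq f <= B.
Proof.
move=> Lf fB; apply/ler_addgt0Pr => e e0; have [n le] := parseval_dense Lf e0.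
by apply: le_trans le _; rewrite lerD2r.
Qed.

Lemma trig_dense f (e : R) : L2 f -> 0 < e ->
  exists n, msq (fun x => f x - trig n (fourier f) x) <= e.
Proof.
move=> Lf e0; have [n le] := parseval_dense Lf e0; exists n.
by rewrite msqB_trig// lerBlDl.
Qed.

(** The bound puts f in the domain of the multiplier, so that [xget] returns a genuine value and not
    its default. *)
Lemma fmultP (m : int -> R[i]) f (B : R) :
  (forall n, \sum_(k <- zs n) normc (m k * fourier f k) ^+ 2 <= B) ->
  L2 (fmult m f) /\ forall k, fourier (fmult m f) k = m k * fourier f k.
Proof.
move=> mB; have [g [_ [Lg gf _ _]]] := riesz_fischer mB.
have : exists g, [set g | (L2norm g < +oo)%E /\
    forall k, fourier g k = m k * fourier f k] g.
  by exists g; split; [exact/L2_normP|].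
by move=> /(xgetPex (fun=> 0)) [/L2_normP].
Qed.

Lemma L2norm_ge0 f : (0 <= L2norm f)%E.
Proof. by rewrite /L2norm; case: ifP => // _; exact: poweR_ge0. Qed.

Lemma L2norm_le f (B : R) : L2 f ->
  (forall n, \sum_(k <- zs n) normc (fourier f k) ^+ 2 <= B) ->
  (L2norm f <= (Num.sqrt (2 * pi * B))%:E)%E.
Proof.
move=> Lf fB; rewrite L2norm_msq// lee_fin ler_wsqrtr//.
by rewrite ler_wpM2l ?(ltW pi2_gt0)// parseval_le.
Qed.

Definition sobw (s : R) (k : int) : R := (1 + k%:~R ^+ 2) `^ s.

Lemma sobw_gt0 s k : 0 < sobw s k.
Proof. by rewrite powR_gt0// ltr_pwDl// sqr_ge0. Qed.

Lemma sobw1 k : sobw 1 k = 1 + k%:~R ^+ 2.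
Proof. by rewrite /sobw powRr1// addr_ge0// sqr_ge0. Qed.

Lemma sobw_le s k : s <= 1 -> sobw s k <= 1 + k%:~R ^+ 2.
Proof.
by move=> s1; rewrite -sobw1 ler_powR// lerDl sqr_ge0.
Qed.

Lemma esum_zs_le (F : int -> R) (B : R) : (forall k, 0 <= F k) ->
  (forall n, \sum_(k <- zs n) F k <= B) ->
  (\esum_(k in [set: int]) (F k)%:E <= B%:E)%E.
Proof.
move=> F0 FB; apply: ge_ereal_sup => _ [A [fA _] <-].
rewrite fsbig_finite//= sumEFin lee_fin.
have [n An] : exists n, {subset fset_set A <= zs n}.
  exists (\max_(k <- fset_set A) `|k|%N) => k kA; rewrite mem_zs.
  exact: leq_bigmax_seq.
apply: le_trans (FB n).
have -> : \sum_(k <- fset_set A) F k = \sum_(k <- zs n | k \in fset_set A) F k.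
  rewrite -[RHS]big_filter; apply: perm_big.
  apply: uniq_perm; [exact: fset_uniq|by rewrite filter_uniq ?uniq_zs|move=> k].
  by rewrite mem_filter; case: (boolP (k \in _)) => //= /An ->.
by rewrite [leRHS](bigID (mem (fset_set A))) /= lerDl sumr_ge0.
Qed.

Lemma esum_zs_ge (F : int -> R) n : (forall k, 0 <= F k) ->
  ((\sum_(k <- zs n) F k)%:E <= \esum_(k in [set: int]) (F k)%:E)%E.
Proof.
move=> F0; apply: ereal_sup_ubound; exists [set` zs n].
  by split => //; exact: finite_seq.
by rewrite -fsbig_seq ?uniq_zs// sumEFin.
Qed.

Lemma Hnorm_ge0 s f : (0 <= Hnorm s f)%E.
Proof. by rewrite /Hnorm; case: ifP => // _; exact: poweR_ge0. Qed.

Lemma Hnorm_le s f (B : R) : L2 f ->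
  (forall n, \sum_(k <- zs n) sobw s k * normc (fourier f k) ^+ 2 <= B) ->
  (Hnorm s f <= (Num.sqrt B)%:E)%E.
Proof.
move=> Lf fB; rewrite /Hnorm; case: asboolP => [_|]; last by move/L2_normP: Lf.
have F0 k : 0 <= sobw s k * normc (fourier f k) ^+ 2.
  by rewrite mulr_ge0 ?sqr_ge0// ltW// sobw_gt0.
have le := esum_zs_le F0 fB.
have B0 : 0 <= B by apply: le_trans (fB 0%N); exact: sumr_ge0.
rewrite -powR12_sqrt// -poweR_EFin.
have inI (y : \bar R) : (0 <= y)%E -> y \in `[0%E, +oo%E].
  by rewrite in_itv/= leey andbT.
apply: gt0_ler_poweR => //; apply: inI; last by rewrite lee_fin.
by apply: esum_ge0 => k _; rewrite lee_fin; exact: F0.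
Qed.

Lemma Hnorm_finP s f : (Hnorm s f < +oo)%E -> L2 f /\
  exists B, forall n, \sum_(k <- zs n) sobw s k * normc (fourier f k) ^+ 2 <= B.
Proof.
rewrite /Hnorm; case: asboolP => [/L2_normP Lf|//] lt; split=> //.
have F0 k : 0 <= sobw s k * normc (fourier f k) ^+ 2.
  by rewrite mulr_ge0 ?sqr_ge0// ltW// sobw_gt0.
have {lt} := lty_poweRy (ltac:(by rewrite invr_eq0) : 2^-1 != 0 :> R) lt.
set S := esum _ _ => Sfin.
have S0 : (0 <= S)%E by apply: esum_ge0 => k _; rewrite lee_fin; exact: F0.
exists (fine S) => n; rewrite -lee_fin fineK ?ge0_fin_numE//.
exact: (esum_zs_ge n F0).
Qed.

(** The inequality |a_k| <= (l k^2 |a_k|^2 + 1 / (l k^2)) / 2 is summed over |k| > J. As J depends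
    on M and e only, the tails are uniformly small on a ball of H^1, which is the source of all
    compactness in x. *)
Lemma h1_tail (M e : R) : 0 < e -> exists J : nat, forall a n,
  \sum_(k <- zs n) k%:~R ^+ 2 * normc (a k) ^+ 2 <= M ->
  \sum_(k <- zs n) normc (a k) <= \sum_(k <- zs J) normc (a k) + e.
Proof.
(* l makes the first half l M at most e; then J > 2 / (l e) does the same for the second, the tail
   of 1 / k^2 being at most 2 / J. *)
move=> e0; pose l := e / (`|M| + 1).
have l0 : 0 < l by rewrite divr_gt0// ltr_wpDl.
pose J := (Num.truncn (2 / (l * e))).+1.
have hJ : 2 / (l * e) < J%:R by exact: truncnS_gt.
have J0 : 0 < J%:R :> R by rewrite ltr0n.
exists J => a n aM.
have [nJ|Jn] := leqP n J.
  rewrite (@le_trans _ _ (\sum_(k <- zs J) normc (a k)))//; last by rewrite lerDl ltW.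
  by apply: ler_zs_sum => // k; exact: normc_ge0.
rewrite (big_zs_split _ (ltnW Jn)) lerD2l.
have am (k : int) : (J < `|k|)%N -> normc (a k) <=
    (l * (k%:~R ^+ 2 * normc (a k) ^+ 2) + l^-1 * (k%:~R ^+ 2)^-1) / 2.
  move=> Jk; have k0 : (k%:~R : R) != 0 by rewrite intr_eq0; lia.
  set q := k%:~R : R in k0 *; set y := normc (a k).
  have -> : (l * (q ^+ 2 * y ^+ 2) + l^-1 * (q ^+ 2)^-1) / 2 =
      `|y| + l^-1 * (l * `|q * y| - `|q|^-1) ^+ 2 / 2 :> R.
    have y0 : 0 <= y by exact: normc_ge0.
    rewrite -[q ^+ 2]real_normK ?num_real// normrM (ger0_norm y0).
    by field; rewrite normr_eq0 k0 gt_eqF.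
  by rewrite (le_trans (ler_norm _))// lerDl divr_ge0// mulr_ge0 ?sqr_ge0// invr_ge0 ltW.
apply: le_trans (ler_sum _ am) _.
rewrite -mulr_suml big_split /= -!mulr_sumr ler_pdivrMr//.
have h1 : \sum_(k <- zs n | (J < `|k|)%N) k%:~R ^+ 2 * normc (a k) ^+ 2 <= `|M|.
  apply: le_trans (le_trans aM (ler_norm M)).
  by rewrite [leRHS](big_zs_split _ (ltnW Jn)) lerDr sumr_ge0// => k _;
     rewrite mulr_ge0 ?sqr_ge0.
have h2 := @inv_sqr_tail R J n isT.
have h3 : l * `|M| <= e.
  by rewrite /l mulrAC ler_pdivrMr ?ltr_wpDl// ler_wpM2l ?(ltW e0)// lerDl.
have h4 : l^-1 * (2 / J%:R) <= e.
  move: hJ; rewrite ltr_pdivrMr ?mulr_gt0// => hJ.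
  rewrite mulrA ler_pdivrMr// ler_pdivrMl// ltW//; lra.
rewrite mulr2n mulrDr mulr1 lerD//.
- by apply: le_trans h3; rewrite ler_wpM2l// ltW.
- by apply: le_trans h4; rewrite ler_wpM2l ?invr_ge0// ltW.
Qed.

End Parseval.

Local Arguments ComplexField.Normc.normc : simpl never.
Local Arguments fourier : simpl never.

(** * Energy of trigonometric polynomials *)

Section TrigonometricPolynomials.
Context {R : realType}.
Implicit Types (f g : R -> R[i]) (c : R[i]) (a b : int -> R[i]) (j k : int).

Definition dmul k : R[i] := 0 +i* k%:~R.

Lemma dmulD j k : dmul (j + k) = dmul j + dmul k.
Proof. by apply: complexP; rewrite /= ?addr0// intrD. Qed.

Lemma dmul0 : dmul 0 = 0.
Proof. by []. Qed.

Lemma conj_dmul k : (dmul k)^* = dmul (- k).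
Proof. by apply: complexP; rewrite /= ?mulrNz. Qed.

Lemma normc_dmul k : normc (dmul k) = `|k%:~R|.
Proof. by rewrite /normc /= expr0n add0r sqrtr_sqr. Qed.

(* [tpd f f'] : f is a trigonometric polynomial and f' is its derivative. *)
Inductive tpd : (R -> R[i]) -> (R -> R[i]) -> Prop :=
| tpd_ek k c : tpd (fun x => c * ek k x) (fun x => dmul k * c * ek k x)
| tpd_add f f' g g' : tpd f f' -> tpd g g' ->
    tpd (fun x => f x + g x) (fun x => f' x + g' x).

Lemma tpd_ext f f' g g' : tpd f f' -> (forall x, f x = g x) ->
  (forall x, f' x = g' x) -> tpd g g'.
Proof. by move=> tf /funext <- /funext <-. Qed.

Lemma tpd_cst c : tpd (fun=> c) (fun=> 0).
Proof.
apply: (tpd_ext (tpd_ek 0 c)) => x; first by rewrite ek0 mulr1.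
by rewrite dmul0 !mul0r.
Qed.

Lemma tpd_mul f f' g g' : tpd f f' -> tpd g g' ->
  tpd (fun x => f x * g x) (fun x => f' x * g x + f x * g' x).
Proof.
move=> tf; elim: tf g g' => [k c|f1 f1' f2 f2' _ IH1 _ IH2] g g' tg.
  elim: tg => [j c'|g1 g1' g2 g2' _ IH1 _ IH2].
    apply: (tpd_ext (tpd_ek (k + j) (c * c'))) => x; rewrite ekD ?dmulD; ring.
  by apply: (tpd_ext (tpd_add IH1 IH2)) => x; ring.
by apply: (tpd_ext (tpd_add (IH1 _ _ tg) (IH2 _ _ tg))) => x; ring.
Qed.

Lemma tpd_scale c f f' : tpd f f' -> tpd (fun x => c * f x) (fun x => c * f' x).
Proof.
by move=> /(tpd_mul (tpd_cst c)) /tpd_ext; apply=> // x; rewrite mul0r add0r.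
Qed.

Lemma tpd_conj f f' : tpd f f' -> tpd (fun x => (f x)^*) (fun x => (f' x)^*).
Proof.
elim=> [k c|f1 f1' f2 f2' _ IH1 _ IH2].
  apply: (tpd_ext (tpd_ek (- k) c^*)) => x; rewrite ekN !rmorphM//.
  by rewrite -conj_dmul.
by apply: (tpd_ext (tpd_add IH1 IH2)) => x; rewrite rmorphD.
Qed.

Lemma tpd_horner (p : {poly R[i]}) f f' : tpd f f' ->
  tpd (fun x => p.[f x]) (fun x => p^`().[f x] * f' x).
Proof.
move=> tf; elim/poly_ind: p => [|p c IH].
  by apply: (tpd_ext (tpd_cst 0)) => x; rewrite ?deriv0 !hornerC ?mul0r.
apply: (tpd_ext (tpd_add (tpd_mul IH tf) (tpd_cst c))) => x.
  by rewrite !hornerE.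
by rewrite derivD derivM derivX derivC !hornerE; ring.
Qed.

Lemma tpd_trig n a : tpd (trig n a) (trig n (fun k => dmul k * a k)).
Proof.
have H (s : seq int) : tpd (fun x => \sum_(k <- s) a k * ek k x)
    (fun x => \sum_(k <- s) dmul k * a k * ek k x).
  elim: s => [|k s IH].
    by apply: (tpd_ext (tpd_cst 0)) => x; rewrite big_nil.
  by apply: (tpd_ext (tpd_add (tpd_ek k (a k)) IH)) => x; rewrite big_cons.
exact: H.
Qed.

Lemma tpd_bounded f f' : tpd f f' -> [/\ tmeas f, tmeas f',
   exists B, forall x, normc (f x) <= B & exists B, forall x, normc (f' x) <= B].
Proof.
elim=> [k c|f1 f1' f2 f2' _ [m1 m1' [B1 b1] [B1' b1']] _ [m2 m2' [B2 b2] [B2' b2']]].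
  have mk d : tmeas (fun x => d * ek k x) by apply: tmeasZ; exact: tmeas_ek.
  have bk d x : normc (d * ek k x) <= normc d by rewrite normcM normc_ek mulr1.
  by split; [exact: mk|exact: mk|exists (normc c)|exists (normc (dmul k * c))].
split; [exact: tmeasD|exact: tmeasD|exists (B1 + B2) => x|exists (B1' + B2') => x];
  by rewrite (le_trans (le_normcD _ _))// lerD.
Qed.

Lemma tpd_cint f f' : tpd f f' -> cint f /\ cint f'.
Proof.
move=> /tpd_bounded[mf mf' [B fB] [B' fB']].
by split; [apply: (cint_bdd mf) => x _; exact: fB|apply: (cint_bdd mf') => x _; exact: fB'].
Qed.

(** Only the constant mode has a nonzero mean, and differentiation kills it. Integration by parts
    below consists in adding such a derivative. *)
Lemma mean_tpd f f' : tpd f f' -> mean f' = 0.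
Proof.
elim=> [k c|f1 f1' f2 f2' t1 IH1 t2 IH2].
  rewrite meanZ; last exact: L2_cint (L2_ek k).
  by rewrite mean_ek; case: eqVneq => [->|_]; rewrite ?dmul0 ?mul0r ?mulr0.
have [_ c1] := tpd_cint t1; have [_ c2] := tpd_cint t2.
by rewrite meanD// IH1 IH2 addr0.
Qed.

End TrigonometricPolynomials.

(** * Bounds and second-order expansion of complex polynomials *)

Section PolynomialBounds.
Context {R : realType}.
Implicit Types (z w x d : R[i]) (A B C : R) (p : {poly R[i]}).

Lemma normcM_le z w A B : normc z <= A -> normc w <= B -> normc (z * w) <= A * B.
Proof. by move=> zA wB; rewrite normcM ler_pM ?normc_ge0. Qed.

Lemma normcD_le z w A B : normc z <= A -> normc w <= B -> normc (z + w) <= A + B.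
Proof. by move=> zA wB; rewrite (le_trans (le_normcD _ _))// lerD. Qed.

Lemma horner_bounded p B : exists2 C : R, 0 <= C &
  forall x, normc x <= B -> normc p.[x] <= C.
Proof.
elim/poly_ind: p => [|p c [C C0 IH]].
  by exists 0 => // x _; rewrite horner0 normc0.
exists (C * `|B| + normc c) => [|x xB].
  by rewrite addr_ge0 ?mulr_ge0 ?normc_ge0.
rewrite !hornerE; apply: normcD_le => //; apply: normcM_le; first exact: IH.
exact: le_trans xB (ler_norm B).
Qed.

Lemma horner_taylor2 p B : exists2 C : R, 0 <= C & forall x d,
  normc x <= B -> normc d <= B ->
  normc (p.[x + d] - p.[x] - d * p^`().[x]) <= C * normc d ^+ 2.
Proof.
elim/poly_ind: p => [|p c [C C0 IH]].
  exists 0 => // x d _ _.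
  by rewrite deriv0 !horner0 mulr0 !subr0 normc0 mul0r.
have [C' C'0 pB] := horner_bounded p^`() B.
exists (C * (2 * `|B|) + C') => [|x d xB dB].
  by rewrite addr_ge0// !mulr_ge0.
have -> : (p * 'X + c%:P).[x + d] - (p * 'X + c%:P).[x] - d * (p * 'X + c%:P)^`().[x] =
   (p.[x + d] - p.[x] - d * p^`().[x]) * (x + d) + p^`().[x] * (d * d).
  by rewrite derivD derivM derivX derivC ![in LHS]hornerE; ring.
rewrite [leRHS]mulrDl; apply: normcD_le.
  rewrite [leRHS]mulrAC; apply: normcM_le; first exact: IH.
  rewrite (le_trans (le_normcD _ _))// mulr2n mulrDl mul1r.
  by rewrite lerD// (le_trans _ (ler_norm B)).
by apply: normcM_le; [exact: pB|rewrite normcM expr2].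
Qed.

End PolynomialBounds.

(** * The energy density, its Taylor expansion and its gradient *)

Section Energy.
Context {R : realType}.
Implicit Types (u w v z : R[i]) (a b : int -> R[i]) (k : int) (g q : {poly R}).

(* Density of the conserved energy, with w = u_x; edens1 is its differential at
   (u, w) in the direction (v, z). *)
Definition edens (G : {poly R[i]}) u w : R[i] :=
  2^-1 * (w * w^*) - 'i * (G.[u * u^*] * (u^* * w)).

Definition edens1 (G : {poly R[i]}) u w v z : R[i] :=
  2^-1 * (z * w^* + w * z^*) -
  'i * (G^`().[u * u^*] * (u * v^* + u^* * v) * (u^* * w) +
        G.[u * u^*] * (v^* * w + u^* * z)).

Lemma normcN_le z (A : R) : normc z <= A -> normc (- z) <= A.
Proof. by rewrite normcN. Qed.

Lemma normcJ_le z (A : R) : normc z <= A -> normc z^* <= A.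
Proof. by rewrite normc_conj. Qed.

Lemma normc_i : normc ('i : R[i]) <= 1.
Proof. by rewrite /normc /= expr0n add0r expr1n sqrtr1. Qed.

Lemma normc_half : normc (2^-1 : R[i]) <= 1.
Proof.
have -> : 2^-1 = (2^-1)%:C :> R[i] by rewrite fmorphV rmorphMn.
by rewrite normc_real ger0_norm// invf_le1// ler1n.
Qed.

(** Also meant for goals whose right-hand side is an existential variable: following the shape of
    the expression, the rules build the constant themselves. *)
Ltac bound_normc :=
  repeat match goal with
  | H : is_true (normc ?x <= _) |- is_true (normc ?x <= _) => exact H
  | |- is_true (normc (_ + _) <= _) => eapply normcD_le
  | |- is_true (normc (- _) <= _) => eapply normcN_le
  | |- is_true (normc (_^*) <= _) => eapply normcJ_le
  | |- is_true (normc 'i <= _) => exact: normc_i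
  | |- is_true (normc 2^-1 <= _) => exact: normc_half
  | |- is_true (normc (_ * _) <= _) => eapply normcM_le
  end.

(** Since |u + h v|^2 = |u|^2 + h e, only G at the shifted argument needs a Taylor expansion, with
    remainder T; everything else is polynomial in h and its terms of order at least 2 are collected
    in S. *)
Lemma edens_taylor (G : {poly R[i]}) (B : R) : exists C : R,
  forall u w v z (h : R), normc u <= B -> normc w <= B -> normc v <= B ->
  normc z <= B -> 0 <= h <= 1 ->
  normc (edens G (u + h%:C * v) (w + h%:C * z) - edens G u w -
         h%:C * edens1 G u w v z) <= C * h ^+ 2.
Proof.
have [CG _ hG] := horner_bounded G (B * B).
have [CG' _ hG'] := horner_bounded G^`() (B * B).
have [CT CT0 hT] := horner_taylor2 G (B * B + B * B + 1 * (B * B)).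
have [C1 H1] : exists C1 : R, forall u w v z (H : R[i]), normc u <= B ->
    normc w <= B -> normc v <= B -> normc z <= B -> normc H <= 1 ->
    normc (2^-1 * (z * z^*) - 'i * (G.[u * u^*] * (v^* * z) +
       v * v^* * G^`().[u * u^*] * (u^* * w) +
       (u * v^* + u^* * v + H * (v * v^*)) * G^`().[u * u^*] *
         (u^* * z + v^* * w + H * (v^* * z)))) <= C1.
  eexists => u w v z H uB wB vB zB H1.
  have r : normc (u * u^*) <= B * B by bound_normc.
  move: (hG _ r) (hG' _ r) => hGr hG'r.
  bound_normc.
have [C2 H2] : exists C2 : R, forall u w v z (H : R[i]), normc u <= B ->
    normc w <= B -> normc v <= B -> normc z <= B -> normc H <= 1 ->
    normc ('i * ((u^* + H * v^*) * (w + H * z))) <= C2.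
  eexists; move=> u w v z H uB wB vB zB nH1; bound_normc.
(* The factor 1 bounds H; it is kept so that E has the shape that [bound_normc] produces for e. *)
pose E := B * B + B * B + 1 * (B * B).
exists (C1 + `|C2| * (CT * E ^+ 2)) => u w v z h uB wB vB zB /andP[h0 h1].
have Hh : normc h%:C = h by rewrite normc_real ger0_norm.
set H := h%:C; have nH : normc H <= 1 by rewrite Hh.
set e := u * v^* + u^* * v + H * (v * v^*).
have eE : normc e <= E by rewrite /e /E; bound_normc.
have B0 : 0 <= B by exact: le_trans (normc_ge0 u) uB.
have E0 : 0 <= E by exact: le_trans (normc_ge0 e) eE.
have rE : normc (u * u^*) <= E.
  have : normc (u * u^*) <= B * B by bound_normc.
  by move/le_trans; apply; rewrite /E mul1r -addrA lerDl addr_ge0 ?mulr_ge0.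
have dE : normc (H * e) <= h * E by rewrite normcM Hh ler_wpM2l.
have dE' : normc (H * e) <= E by apply: le_trans dE _; rewrite ler_piMl.
set T := G.[u * u^* + H * e] - G.[u * u^*] - H * e * G^`().[u * u^*].
have TE : normc T <= CT * (h * E) ^+ 2.
  apply: le_trans (hT _ _ rE dE') _; rewrite ler_wpM2l// ler_sqr ?nnegrE ?normc_ge0//.
  exact: mulr_ge0.
have cH : H^* = H by exact: conjc_real.
set S := 2^-1 * (z * z^*) - 'i * (G.[u * u^*] * (v^* * z) +
       v * v^* * G^`().[u * u^*] * (u^* * w) +
       e * G^`().[u * u^*] * (u^* * z + v^* * w + H * (v^* * z))).
set P := 'i * ((u^* + H * v^*) * (w + H * z)).
have -> : edens G (u + H * v) (w + H * z) - edens G u w - H * edens1 G u w v z =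
    H * H * S - P * T.
  have -> : edens G (u + H * v) (w + H * z) =
    2^-1 * ((w + H * z) * (w^* + H * z^*)) -
    'i * (G.[u * u^* + H * e] * ((u^* + H * v^*) * (w + H * z))).
    rewrite /edens !(conjcD, conjcM) !cH.
    congr (_ - 'i * (_.[_] * _)); rewrite /e; ring.
  rewrite /T /S /P /edens /edens1.
  move: (G.[u * u^* + H * e]) => GA; rewrite /e.
  move: (G.[u * u^*]) (G^`().[u * u^*]) u^* v^* w^* z^* => G0 G1 u' v' w' z'.
  ring.
rewrite [in leRHS]mulrDl; apply: normcD_le.
  rewrite !normcM Hh mulrC -expr2 ler_wpM2r ?sqr_ge0//; exact: H1.
apply: normcN_le; rewrite -[leRHS]mulrA; apply: normcM_le.
  by apply: le_trans (ler_norm _); exact: H2.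
by apply: le_trans TE _; rewrite exprMn (mulrC (h ^+ 2)) mulrA.
Qed.

Lemma horner_normc q z :
  (q.[normc z ^+ 2])%:C = (map_poly (real_complex R) q).[z * z^*].
Proof. by rewrite mulcJ horner_map. Qed.

Definition dseq a : int -> R[i] := fun k => dmul k * a k.

Definition nlin q n a : R -> R[i] :=
  fun x => (q.[normc (trig n a x) ^+ 2])%:C * trig n (dseq a) x.

Definition energy g n a : R := cRe (mean (fun x =>
  edens (map_poly (real_complex R) g) (trig n a x) (trig n (dseq a) x))).

(* A step of the exponential Euler scheme for u_t = i u_xx - q(|u|^2) u_x, with
   frequencies |k| <= n. *)
Definition lawson q n (h : R) a : int -> R[i] := fun k =>
  expi (- (k%:~R ^+ 2 * h)) * (a k - h%:C * fourier (nlin q n a) k).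

(* The L^2 gradient - u_xx - i q(|u|^2) u_x of the energy; along the flow
   u_t = - i egrad, which is orthogonal to it. *)
Definition egrad q n a : int -> R[i] := fun k =>
  (k%:~R ^+ 2)%:C * a k - 'i * fourier (nlin q n a) k.

Lemma tpd_nlin q n a : exists F, tpd (nlin q n a) F.
Proof.
have tu := tpd_trig n a; have tw := tpd_trig n (dseq a).
have := tpd_mul (tpd_horner (map_poly (real_complex R) q)
  (tpd_mul tu (tpd_conj tu))) tw.
set F := fun x => _ + _ => t; exists F; apply: (tpd_ext t) => // x.
by rewrite /nlin horner_normc.
Qed.

Lemma cint_nlin q n a : cint (nlin q n a).
Proof. by have [F /tpd_cint[]] := tpd_nlin q n a. Qed.

Lemma cint_trig n a : cint (trig n a).
Proof. exact: L2_cint (L2_trig n a). Qed.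

Lemma trig_scaleD n (c : R[i]) a b x :
  trig n (fun k => a k + c * b k) x = trig n a x + c * trig n b x.
Proof.
rewrite /trig mulr_sumr -big_split /=; apply: eq_bigr => k _; ring.
Qed.

(** Integration by parts moves the derivative off the direction v: pointwise, [edens1] is the real
    part of conj(v) X, with X = - u_xx - i q(|u|^2) u_x, plus a derivative of mean zero. The
    relation between q and g is what makes the terms in g and g' add up to q. Pairing with v sees
    only the frequencies |k| <= n, where the coefficients of X are [egrad]. *)
Lemma energy_gradient g q n a b : q = 2 *: (g + 'X * g^`()) ->
  cRe (mean (fun x => edens1 (map_poly (real_complex R) g)
     (trig n a x) (trig n (dseq a) x) (trig n b x) (trig n (dseq b) x))) =
  cRe (\sum_(k <- zs n) (b k)^* * egrad q n a k).
Proof.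
move=> qg; set G := map_poly _ g.
have tu := tpd_trig n a; have tw := tpd_trig n (dseq a); have tv := tpd_trig n b.
set u := trig n a in tu *; set w := trig n (dseq a) in tu tw *.
set v := trig n b in tv *; set z := trig n (dseq b) in tv *.
set y := trig n (dseq (dseq a)) in tw.
pose X x := - y x - 'i * nlin q n a x.
have cX : cint X.
  by apply: cintB; [apply: cintN; exact: cint_trig|apply: cintZ; exact: cint_nlin].
have XE k : (`|k| <= n)%N -> fourier X k = egrad q n a k.
  move=> kn; rewrite fourierB; last 2 first.
  - by apply: cintN; exact: cint_trig.
  - by apply: cintZ; exact: cint_nlin.
  rewrite fourierN ?fourierZ; [|exact: cint_nlin|exact: cint_trig].
  rewrite fourier_trig kn /egrad /dseq mulrA -mulNr; congr (_ * _ - _).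
  by apply: complexP; rewrite /=; ring.
(* The boundary term: (v conj(w) + w conj(v)) / 2 - i G(|u|^2) conj(u) v. *)
have tS := tpd_add
  (tpd_scale 2^-1 (tpd_add (tpd_mul tv (tpd_conj tw)) (tpd_mul tw (tpd_conj tv))))
  (tpd_scale (- 'i) (tpd_mul (tpd_horner G (tpd_mul tu (tpd_conj tu)))
                              (tpd_mul (tpd_conj tu) tv))).
set S' := (X in tpd _ X) in tS.
have cvX : cint (fun x => (v x)^* * X x).
  have [mv _ [B vB] _] := tpd_bounded (tpd_conj tv).
  exact: (cintMbdd mv (fun x _ => vB x) cX).
have pw x : edens1 G (u x) (w x) (v x) (z x) =
    2^-1 * ((v x)^* * X x + ((v x)^* * X x)^*) + S' x.
  rewrite /S' /X /nlin -/(u x) -/(w x) horner_normc -/G.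
  have Qr : ((map_poly (real_complex R) q).[u x * (u x)^*])^* =
            (map_poly (real_complex R) q).[u x * (u x)^*].
    by rewrite -horner_normc conjc_real.
  have QG : (map_poly (real_complex R) q).[u x * (u x)^*] =
      2 * (G.[u x * (u x)^*] + u x * (u x)^* * G^`().[u x * (u x)^*]).
    rewrite qg /G deriv_map map_polyZ [X in (_ *: X).[_]]rmorphD rmorphM /= map_polyX.
    by rewrite hornerZ hornerD hornerM hornerX rmorphMn.
  have ci : ('i : R[i])^* = - 'i by apply: complexP; rewrite /= ?oppr0.
  rewrite !(conjcD, conjcN, conjcM) Qr QG ci !conjcK /edens1.
  move: (G.[_]) (G^`().[_]) => G0 G1.
  rewrite -/(z x) -/(y x) -/(w x).
  by field.
transitivity (cRe (2^-1 * (mean (fun x => (v x)^* * X x) +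
    (mean (fun x => (v x)^* * X x))^*))).
  congr cRe; transitivity (mean (fun x => 2^-1 * ((v x)^* * X x + ((v x)^* * X x)^*) + S' x)).
    by apply: eq_mean => x _; exact: pw.
  have cc := cint_conj cvX.
  rewrite meanD; last 2 first.
  - by apply: cintZ; exact: cintD.
  - by have [] := tpd_cint tS.
  rewrite (mean_tpd tS) addr0 meanZ ?meanD ?mean_conj//; exact: cintD.
rewrite mean_trigM//.
have -> : \sum_(k <- zs n) (b k)^* * fourier X k = \sum_(k <- zs n) (b k)^* * egrad q n a k.
  by apply: eq_big_seq => k; rewrite mem_zs => /XE ->.
have -> : 2^-1 = (2^-1)%:C :> R[i] by rewrite fmorphV rmorphMn.
by rewrite cReZ cReD cRe_conj; lra.
Qed.

End Energy.

(** * Elementary bounds for exp(i t) near t = 0 *)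

Section ExponentialBounds.
Context {R : realType}.
Implicit Types (t x y : R).

Lemma ler_dist_derive (f df : R -> R) (M x y : R) :
  (forall c : R, is_derive c (1 : R) f (df c)) ->
  (forall c, x <= c <= y -> `|df c| <= M) -> x <= y ->
  `|f y - f x| <= M * (y - x).
Proof.
move=> fd dM xy.
have cf : continuous f.
  move=> c; have Dc : derivable f c 1 by exact: ex_derive.
  by apply: differentiable_continuous; exact/derivable1_diffP.
have [c cxy ->] := MVT_segment xy (fun c _ => fd c) (continuous_subspaceT cf).
rewrite normrM [X in _ * X]ger0_norm ?subr_ge0// ler_wpM2r ?subr_ge0//.
by apply: dM; move: cxy; rewrite in_itv.
Qed.

Lemma ler_sin t : `|sin t| <= `|t|.
Proof.
have H (s : R) : 0 <= s -> `|sin s| <= s.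
  move=> s0; have := @ler_dist_derive sin cos 1 0 s _ (fun c _ => cos_max c) s0.
  by rewrite sin0 !subr0 mul1r; apply => c; exact: is_derive_sin.
have [t0|t0] := lerP 0 t; first by rewrite (ger0_norm t0); exact: H.
by rewrite -normrN -sinN (ltr0_norm t0); apply: H; rewrite oppr_ge0 ltW.
Qed.

Lemma ler_oneBcos t : 0 <= 1 - cos t <= t ^+ 2 / 2.
Proof.
rewrite subr_ge0 cos_le1 /=.
have e : cos t = 1 - 2 * sin (t / 2) ^+ 2.
  have {1}-> : t = (t / 2) *+ 2 by rewrite mulr2n; lra.
  by rewrite cos_mulr2n cos2sin2 mulr2n; lra.
have : sin (t / 2) ^+ 2 <= (t / 2) ^+ 2.
  rewrite -[sin _ ^+ 2]real_normK ?num_real// -[(t / 2) ^+ 2]real_normK ?num_real//.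
  by rewrite ler_sqr ?nnegrE// ler_sin.
rewrite e; nra.
Qed.

Lemma normc_expiB1 t : normc (expi t - 1) <= `|t|.
Proof.
rewrite -ler_sqr ?nnegrE ?normc_ge0//.
rewrite normc_sqr cReD cImD /= real_normK ?num_real// oppr0 addr0.
by have /andP[_] := ler_oneBcos t; have := cos2Dsin2 t; nra.
Qed.

Lemma normc_expiB1i t : normc (expi t - 1 - 'i * t%:C) <= 2 * t ^+ 2.
Proof.
apply: le_trans (ler_ReIm _) _.
rewrite !cReD !cImD !cReN !cImN cReM cImM /= !(mul0r, mulr0, mul1r, subr0, oppr0, addr0, add0r, subrr).
have h1 : `|cos t - 1| <= t ^+ 2.
  have /andP[c0 c1] := ler_oneBcos t; have := sqr_ge0 t.
  by rewrite ler_norml => h; apply/andP; split; lra.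
have h2 : `|sin t - t| <= t ^+ 2.
  have H (s : R) : 0 <= s -> `|sin s - s| <= s ^+ 2.
    move=> s0.
    have := @ler_dist_derive (fun x => sin x - x) (fun x => cos x - 1) s 0 s _ _ s0.
    rewrite sin0 !subr0 -expr2; apply.
    move=> c /andP[c0 cs]; apply: le_trans cs.
    have := normc_expiB1 c; rewrite (ger0_norm c0); apply: le_trans.
    by have := ler_Re (expi c - 1); rewrite cReD.
  have [t0|t0] := lerP 0 t; first exact: H.
  have := H (- t); rewrite oppr_ge0 => /(_ (ltW t0)).
  by rewrite sinN opprK sqrrN addrC distrC.
by rewrite mulr2n mulrDl mul1r lerD.
Qed.

End ExponentialBounds.

(** * Variation of the energy over one step of the scheme *)

Section EnergyStep.
Context {R : realType}.
Implicit Types (a b : int -> R[i]) (k : int) (g q : {poly R}) (f : R -> R[i]).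

Definition tp f : Prop := exists f', tpd f f'.

Lemma tpD f1 f2 : tp f1 -> tp f2 -> tp (fun x => f1 x + f2 x).
Proof. by move=> [? ?] [? ?]; eexists; apply: tpd_add; eassumption. Qed.

Lemma tpM f1 f2 : tp f1 -> tp f2 -> tp (fun x => f1 x * f2 x).
Proof. by move=> [? ?] [? ?]; eexists; apply: tpd_mul; eassumption. Qed.

Lemma tp_cst c : tp (fun=> c).
Proof. by eexists; exact: tpd_cst. Qed.

Lemma tpN f : tp f -> tp (fun x => - f x).
Proof.
by move=> /(tpM (tp_cst (-1))); congr tp; apply/funext => x; rewrite mulN1r.
Qed.

Lemma tpJ f : tp f -> tp (fun x => (f x)^*).
Proof. by move=> [? ?]; eexists; apply: tpd_conj; eassumption. Qed.

Lemma tp_horner p f : tp f -> tp (fun x => p.[f x]).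
Proof. by move=> [? ?]; eexists; apply: tpd_horner; eassumption. Qed.

Lemma tp_trig n a : tp (trig n a).
Proof. by eexists; exact: tpd_trig. Qed.

Lemma tp_cint f : tp f -> cint f.
Proof. by move=> [f' /tpd_cint[]]. Qed.

Ltac tp_tac := repeat first [ exact: tp_trig | exact: tp_cst | apply: tpD
  | apply: tpN | apply: tpJ | apply: tpM | apply: tp_horner ].

Lemma normc_trig n a (A : R) x : (forall k, (`|k| <= n)%N -> normc (a k) <= A) ->
  normc (trig n a x) <= n.*2.+1%:R * A.
Proof.
move=> aA; apply: le_trans (normc_sum _ _ _) _.
apply: (@le_trans _ _ (\sum_(k <- zs n) A)).
  rewrite big_seq [leRHS]big_seq; apply: ler_sum => k; rewrite mem_zs => /aA.
  by rewrite normcM normc_ek mulr1.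
by rewrite big_const_seq count_predT size_zs iter_addr_0 mulr_natl.
Qed.

Lemma normc_dseq n a (A : R) k : (`|k| <= n)%N -> normc (a k) <= A ->
  normc (dseq a k) <= n%:R * A.
Proof.
move=> kn aA; rewrite /dseq; apply: normcM_le => //; rewrite normc_dmul.
by rewrite -intr_norm -abszE -pmulrn ler_nat.
Qed.

Lemma normc_fourier_bdd f k (B : R) : tmeas f -> (forall x, normc (f x) <= B) ->
  normc (fourier f k) <= B.
Proof.
move=> mf fB; rewrite fourier_ekN; apply: normc_mean_bdd => [|x _].
  by apply: tmeasM => //; exact: tmeas_ek.
by rewrite normcM normc_ek mul1r.
Qed.

Lemma nlin_bounded q n (A : R) : 0 <= A -> exists2 P : R, 0 <= P &
  forall a, (forall k, (`|k| <= n)%N -> normc (a k) <= A) ->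
  forall k, normc (fourier (nlin q n a) k) <= P.
Proof.
move=> A0; set U := n.*2.+1%:R * A; set W := n.*2.+1%:R * (n%:R * A).
have [C C0 HC] := horner_bounded (map_poly (real_complex R) q) (U * U).
exists (C * W) => [|a aA k]; first by rewrite !mulr_ge0.
apply: normc_fourier_bdd => [|x]; first exact: cint_meas (cint_nlin q n a).
rewrite /nlin horner_normc; apply: normcM_le.
  by apply: HC; apply: normcM_le; rewrite ?normc_conj; exact: normc_trig.
by apply: normc_trig => j jn; apply: normc_dseq => //; exact: aA.
Qed.

(** The step is a + h b with b = - i [egrad] + O(h). As - i [egrad] is orthogonal to the gradient,
    the first-order variation of the energy is already O(h^2), like the Taylor remainder. The
    constant may depend on n, so k^2 is simply bounded by n^2. *)
Lemma energy_step g q n (A : R) : 0 <= A -> q = 2 *: (g + 'X * g^`()) ->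
  exists2 C : R, 0 <= C & forall a (h : R), 0 < h <= 1 ->
    (forall k, (`|k| <= n)%N -> normc (a k) <= A) ->
    energy g n (lawson q n h a) <= energy g n a + C * h ^+ 2 /\
    forall k, (`|k| <= n)%N -> normc (lawson q n h a k - a k) <= C * h.
Proof.
move=> A0 qg; have [P P0 HP] := nlin_bounded q n A0.
set G := map_poly (real_complex R) g; set L := n.*2.+1%:R : R.
have L0 : 0 <= L by exact: ler0n.
(* D bounds the coefficients of both [egrad] and b, and B bounds u, u_x, v and v_x pointwise. *)
pose D := n%:R ^+ 2 * A + P.
have D0 : 0 <= D by rewrite addr_ge0 ?mulr_ge0 ?exprn_ge0.
pose B := L * A + L * (n%:R * A) + L * D + L * (n%:R * D).
have [C HC] := edens_taylor G B.
(* Number of frequencies, times the bound of |b + i egrad| / h, times the bound of |egrad|. *)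
pose C' := L * ((2 * n%:R ^+ 4 * A + n%:R ^+ 2 * P) * D).
have C'0 : 0 <= C' by rewrite !(mulr_ge0, addr_ge0, exprn_ge0).
exists (`|C| + C' + D) => [|a h /andP[h0 h1] aA]; first by apply: addr_ge0 => //; exact: addr_ge0.
have h0' := ltW h0.
have hC0 : h%:C != 0 :> R[i] by rewrite eq_complex /= gt_eqF.
pose b k := (h%:C)^-1 * (lawson q n h a k - a k).
have lb k : lawson q n h a k = a k + h%:C * b k.
  by rewrite /b mulVKf// addrC subrK.
set F := fourier (nlin q n a).
have FP k : normc (F k) <= P by exact: HP.
have kn2 k : (`|k| <= n)%N -> (k%:~R : R) ^+ 2 <= n%:R ^+ 2.
  move=> kn; rewrite -[k%:~R ^+ 2]real_normK ?num_real// ler_sqr ?nnegrE//.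
  by rewrite -intr_norm -abszE -pmulrn ler_nat.
have hV : normc (h%:C)^-1 = h^-1 :> R.
  by rewrite ComplexField.Normc.normcV normc_real ger0_norm.
have eD k : (`|k| <= n)%N -> normc (egrad q n a k) <= D.
  move=> kn; apply: normcD_le; last first.
    rewrite normcN -[P]mul1r; apply: normcM_le (FP k); exact: normc_i.
  apply: normcM_le; last exact: aA.
  by rewrite normc_real ger0_norm ?sqr_ge0 ?kn2.
have lbD k : (`|k| <= n)%N -> normc (lawson q n h a k - a k) <= D * h.
  move=> kn.
  have -> : lawson q n h a k - a k = (expi (- (k%:~R ^+ 2 * h)) - 1) * a k -
      h%:C * (expi (- (k%:~R ^+ 2 * h)) * F k) by rewrite /lawson -/F; ring.
  rewrite /D [leRHS]mulrDl; apply: normcD_le.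
    rewrite [leRHS]mulrAC; apply: normcM_le; last exact: aA.
    apply: le_trans (normc_expiB1 _) _.
    rewrite normrN ger0_norm; last by apply: mulr_ge0 => //; exact: sqr_ge0.
    by rewrite ler_wpM2r// kn2.
  rewrite normcN [leRHS]mulrC; apply: normcM_le; first by rewrite normc_real ger0_norm.
  by rewrite normcM normc_expi mul1r.
have bD k : (`|k| <= n)%N -> normc (b k) <= D.
  by move=> kn; rewrite /b normcM hV ler_pdivrMl// mulrC lbD.
have rD k : (`|k| <= n)%N -> normc (b k + 'i * egrad q n a k) <=
    h * (2 * n%:R ^+ 4 * A + n%:R ^+ 2 * P).
  move=> kn; set t := k%:~R ^+ 2 * h.
  have t0 : 0 <= t by apply: mulr_ge0 => //; exact: sqr_ge0.
  have tn : t <= n%:R ^+ 2 * h by rewrite ler_wpM2r// kn2.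
  have -> : b k + 'i * egrad q n a k =
      (h%:C)^-1 * ((expi (- t) - 1 - 'i * (- t)%:C) * a k) - (expi (- t) - 1) * F k.
    have i2 : 'i * 'i = -1 :> R[i] by rewrite -expr2 sqr_i.
    have tE : (- t)%:C = - ((k%:~R ^+ 2)%:C * h%:C) :> R[i].
      by rewrite /t rmorphN rmorphM.
    rewrite /b /egrad /lawson -/F tE -/t.
    have -> : 'i * ((k%:~R ^+ 2)%:C * a k - 'i * F k) =
       'i * (k%:~R ^+ 2)%:C * a k - ('i * 'i) * F k by ring.
    by rewrite i2; field.
  rewrite [leRHS]mulrDr; apply: normcD_le.
    rewrite normcM hV ler_pdivrMl//.
    have -> : h * (h * (2 * n%:R ^+ 4 * A)) = (2 * (n%:R ^+ 2 * h) ^+ 2) * A by ring.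
    apply: normcM_le; last exact: aA.
    apply: le_trans (normc_expiB1i _) _; rewrite sqrrN ler_wpM2l// ler_sqr ?nnegrE//.
    by rewrite mulr_ge0// exprn_ge0.
  rewrite normcN [leRHS]mulrA; apply: normcM_le => //.
  by apply: le_trans (normc_expiB1 _) _; rewrite normrN ger0_norm// mulrC.
split; last first.
  move=> k kn; apply: le_trans (lbD k kn) _.
  by rewrite ler_wpM2r// lerDr addr_ge0.
set u := trig n a; set w := trig n (dseq a).
set v := trig n b; set z := trig n (dseq b).
have u'E x : trig n (lawson q n h a) x = u x + h%:C * v x.
  by rewrite -trig_scaleD /trig; apply: eq_bigr => k _; rewrite lb.
have w'E x : trig n (dseq (lawson q n h a)) x = w x + h%:C * z x.
  by rewrite -trig_scaleD /trig; apply: eq_bigr => k _; rewrite /dseq lb; ring.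
pose e0 x := edens G (u x) (w x).
pose e' x := edens G (u x + h%:C * v x) (w x + h%:C * z x).
pose e1 x := edens1 G (u x) (w x) (v x) (z x).
have c0 : cint e0 by apply: tp_cint; rewrite /e0 /edens; tp_tac.
have c' : cint e' by apply: tp_cint; rewrite /e' /edens; tp_tac.
have c1 : cint e1 by apply: tp_cint; rewrite /e1 /edens1; tp_tac.
have EE : energy g n (lawson q n h a) = cRe (mean e').
  by rewrite /energy; congr cRe; apply: eq_mean => x _; rewrite u'E w'E.
pose rem x := e' x - e0 x - h%:C * e1 x.
have crem : cint rem by apply: cintB; [exact: cintB|exact: cintZ].
have remE : mean e' = mean e0 + h%:C * mean e1 + mean rem.
  have -> : mean rem = mean e' - mean e0 - h%:C * mean e1.
    rewrite -meanZ// -(meanB c' c0).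
    by apply: meanB; [exact: cintB|exact: cintZ].
  by ring.
have xB x : [/\ normc (u x) <= B, normc (w x) <= B, normc (v x) <= B & normc (z x) <= B].
  have uB := normc_trig x aA.
  have wB := normc_trig x (fun k kn => normc_dseq kn (aA k kn)).
  have vB := normc_trig x bD.
  have zB := normc_trig x (fun k kn => normc_dseq kn (bD k kn)).
  have ? : 0 <= L * A by rewrite !mulr_ge0.
  have ? : 0 <= L * (n%:R * A) by rewrite !mulr_ge0.
  have ? : 0 <= L * D by rewrite !mulr_ge0.
  have ? : 0 <= L * (n%:R * D) by rewrite !mulr_ge0.
  by split; [move: uB|move: wB|move: vB|move: zB] => /le_trans; apply; rewrite /B; lra.
have remB : normc (mean rem) <= `|C| * h ^+ 2.
  apply: normc_mean_bdd => [|x _]; first exact: cint_meas.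
  have [uB wB vB zB] := xB x.
  apply: le_trans (HC _ _ _ _ h uB wB vB zB _) _; first by rewrite h0' h1.
  by rewrite ler_wpM2r ?sqr_ge0// ler_norm.
have e1B : cRe (mean e1) <= h * C'.
  rewrite /e1 (energy_gradient n a b qg).
  (* Adding i [egrad] to b leaves the real part unchanged and the factor is now O(h). *)
  have -> : cRe (\sum_(k <- zs n) (b k)^* * egrad q n a k) =
     cRe (\sum_(k <- zs n) (b k + 'i * egrad q n a k)^* * egrad q n a k).
    rewrite !cRe_sum; apply: eq_bigr => k _.
    by case: (b k) (egrad q n a k) => [x1 x2] [y1 y2] /=; ring.
  apply: le_trans (le_trans (ler_norm _) (ler_Re _)) _.
  apply: le_trans (normc_sum _ _ _) _.
  apply: (@le_trans _ _ (\sum_(k <- zs n) (h * (2 * n%:R ^+ 4 * A + n%:R ^+ 2 * P) * D))).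
    rewrite big_seq [leRHS]big_seq; apply: ler_sum => k; rewrite mem_zs => kn.
    by apply: normcM_le; [rewrite normc_conj; exact: rD|exact: eD].
  rewrite big_const_seq count_predT size_zs iter_addr_0 -[leLHS]mulr_natl /C' -/L.
  by rewrite le_eqVlt; apply/orP; left; apply/eqP; ring.
have E0 : energy g n a = cRe (mean e0) by [].
rewrite EE E0 remE !cReD [cRe (h%:C * _)]cReZ -addrA lerD2l.
apply: (@le_trans _ _ (C' * h ^+ 2 + `|C| * h ^+ 2)).
  apply: lerD; last exact: le_trans (le_trans (ler_norm _) (ler_Re _)) remB.
  have -> : C' * h ^+ 2 = h * (h * C') by ring.
  by rewrite ler_wpM2l.
by rewrite -mulrDl ler_wpM2r ?sqr_ge0//; lra.
Qed.

End EnergyStep.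

(** * Galerkin approximation *)

Section PowerNonlinearity.
Context {R : realType}.
Implicit Types (r s t x y B : R) (p g q : {poly R}).

Lemma bernoulli_ge t n : 0 <= t <= 1 -> 1 - n%:R * (1 - t) <= t ^+ n.
Proof.
move=> /andP[t0 t1]; elim: n => [|n IH]; first by rewrite mul0r subr0 expr0.
have n0 : 0 <= n%:R :> R by exact: ler0n.
rewrite exprS -natr1; apply: le_trans _ (ler_wpM2l t0 IH).
by have := mulr_ge0 n0 (sqr_ge0 (1 - t)); lra.
Qed.

(** With t = x / y <= 1 and an integer n >= s, Bernoulli gives t^s >= t^n >= 1 - n (1 - t), so that
    y^s - x^s <= n y^(s - 1) (y - x). This avoids differentiating a real power near 0. *)
Lemma powR_lipschitz s B : 1 <= s -> exists L : R, forall x y,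
  0 <= x <= B -> 0 <= y <= B -> `|x `^ s - y `^ s| <= L * `|x - y|.
Proof.
move=> s1; have s0 : 0 < s by exact: lt_le_trans ltr01 s1.
pose n := (Num.truncn s).+1.
have sn : s <= n%:R by rewrite ltW// truncnS_gt.
exists (n%:R * B `^ (s - 1)).
have H x y : 0 <= x <= y -> y <= B -> y `^ s - x `^ s <= n%:R * B `^ (s - 1) * (y - x).
  move=> /andP[x0 xy] yB; have y0 := le_trans x0 xy.
  have [y00|yn0] := eqVneq y 0.
    have x00 : x = 0 by lra.
    by rewrite x00 y00 !subrr mulr0.
  have yp : 0 < y by rewrite lt_def yn0.
  have ys : y `^ s = y `^ (s - 1) * y.
    by rewrite -{3}(powRr1 y0) -powRD ?subrK// yn0 implybT.
  pose t := x / y.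
  have t01 : 0 <= t <= 1 by rewrite divr_ge0//= ler_pdivrMr// mul1r.
  have xt : x = y * t by rewrite /t mulrC divfK.
  have ts : 1 - n%:R * (1 - t) <= t `^ s.
    apply: le_trans (bernoulli_ge n t01) _; have /andP[t0 t1] := t01.
    rewrite -powR_mulrn//; have [->|tn0] := eqVneq t 0.
      by rewrite !powR0 ?gt_eqF// lt_def ?pnatr_eq0.
    by apply: ger_powR => //; rewrite t1 andbT lt_def tn0.
  rewrite {1}xt powRM//; last by case/andP: t01.
  have -> : y `^ s - y `^ s * t `^ s = y `^ s * (1 - t `^ s) by ring.
  apply: (@le_trans _ _ (y `^ s * (n%:R * (1 - t)))).
    by rewrite ler_wpM2l ?powR_ge0//; lra.
  rewrite ys.
  have -> : y `^ (s - 1) * y * (n%:R * (1 - t)) = n%:R * y `^ (s - 1) * (y - x).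
    by rewrite [in RHS]xt; ring.
  rewrite ler_wpM2r ?subr_ge0// ler_wpM2l ?ler0n//.
  by apply: ge0_ler_powR => //; rewrite ?subr_ge0 ?nnegrE//; exact: le_trans yB.
have mono x y : 0 <= x -> x <= y -> x `^ s <= y `^ s.
  move=> x0 xy; apply: ge0_ler_powR => //; rewrite ?ltW ?nnegrE//.
  exact: le_trans xy.
move=> x y /andP[x0 xB] /andP[y0 yB]; case/orP: (le_total x y) => xy.
  rewrite distrC ger0_norm ?subr_ge0 ?mono// distrC ger0_norm ?subr_ge0//.
  by apply: H => //; rewrite x0.
rewrite ger0_norm ?subr_ge0 ?mono// ger0_norm ?subr_ge0//.
by apply: H => //; rewrite y0.
Qed.

(** On coefficients the equation reads q_i = 2 (i + 1) g_i. *)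
Lemma potential_exists q : exists g, q = 2 *: (g + 'X * g^`()).
Proof.
exists (\poly_(i < size q) (q`_i / (2 * i.+1%:R))).
apply/polyP => i; rewrite coefZ coefD coefXM coef_deriv coef_poly.
case: ltnP => iq; last first.
  rewrite nth_default//; case: i iq => [|i] iq /=; first by rewrite addr0 mulr0.
  by rewrite coef_poly ltnNge iq /= mul0rn addr0 mulr0.
have i0 : i.+1%:R != 0 :> R by rewrite pnatr_eq0.
case: i iq i0 => [|i] iq i0 /=; first by rewrite addr0; field.
rewrite coef_poly iq -mulr_natr -natr1; rewrite -natr1 in i0; field.
by [].
Qed.

(** (X g)' = q / 2, so g(r) = q(c) / 2 for some c in ]0, r[ by the mean value theorem. The bound
    ignores the degree of q, hence is uniform in N. *)
Lemma potential_bound g q (B Q : R) : q = 2 *: (g + 'X * g^`()) ->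
  (forall r, 0 <= r <= B -> `|q.[r]| <= Q) -> forall r, 0 <= r <= B -> `|g.[r]| <= Q.
Proof.
move=> qg qQ r /andP[r0 rB].
have Q0 : 0 <= Q by exact: le_trans (normr_ge0 _) (qQ r (introT andP (conj r0 rB))).
have dg (x : R) : ('X * g)^`().[x] = q.[x] / 2.
  by rewrite qg derivM derivX !hornerE; field.
have [r00|rn0] := eqVneq r 0.
  have := qQ r; rewrite r0 rB => /(_ isT); rewrite qg r00 !hornerE normrM.
  by rewrite ger0_norm//; have := normr_ge0 g.[0]; lra.
have rp : 0 < r by rewrite lt_def rn0.
have [c] := poly_mvt ('X * g) rp.
rewrite in_itv/= => /andP[c0 cr]; rewrite dg !hornerE ?mul0r !subr0 => E.
have gc : g.[r] = q.[c] / 2 by apply: (mulfI rn0); rewrite E mulrC.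
have : `|q.[c]| <= Q by apply: qQ; rewrite (ltW c0) (le_trans (ltW cr) rB).
by rewrite gc normrM (@ger0_norm _ 2^-1)//; have := normr_ge0 q.[c]; lra.
Qed.

End PowerNonlinearity.

(** * Coercivity of the energy while u stays bounded *)

Section EnergyCoercivity.
Context {R : realType}.
Implicit Types (a : int -> R[i]) (k : int) (g q : {poly R}).

Lemma rmean_normc_le (f : R -> R[i]) : L2 f -> rmean (fun x => normc (f x)) <= Num.sqrt (msq f).
Proof.
move=> Lf; have L1 : L2 (fun=> 1 : R[i]).
  by apply: (@L2_bdd _ _ 1) => [|x _]; [exact: tmeas_cst|rewrite normc1].
have := normc_mean_CS Lf L1.
have -> : msq (fun=> 1 : R[i]) = 1.
  by rewrite /msq normc1 expr1n rmean_cst.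
rewrite sqrtr1 mulr1 normc1.
by under [X in rmean X <= _]eq_fun do rewrite mulr1.
Qed.

Lemma normc_meanM_bdd (f h : R -> R[i]) (B : R) : L2 f -> tmeas h ->
  (forall x, torus x -> normc (h x) <= B) ->
  normc (mean (fun x => h x * f x)) <= B * Num.sqrt (msq f).
Proof.
move=> Lf mh hB; have cf := L2_cint Lf.
have chf := cintMbdd mh hB cf.
have B0 : 0 <= B.
  have T0 : torus (0 : R) by rewrite /torus /= in_itv/= lexx pi2_gt0.
  exact: le_trans (normc_ge0 _) (hB 0 T0).
apply: le_trans (normc_mean chf) _.
apply: le_trans _ (ler_wpM2l B0 (rmean_normc_le Lf)).
rewrite -rmeanZ; last exact: cint_normc.
apply: ler_rmean; [exact: cint_normc|by apply: tintZ; exact: cint_normc|].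
by move=> x Tx; rewrite normcM ler_wpM2r ?normc_ge0 ?hB.
Qed.

Definition kinetic n a : R := \sum_(k <- zs n) k%:~R ^+ 2 * normc (a k) ^+ 2.

Lemma kinetic_ge0 n a : 0 <= kinetic n a.
Proof. by apply: sumr_ge0 => k _; rewrite mulr_ge0 ?sqr_ge0. Qed.

Lemma msq_dseq n a : msq (trig n (dseq a)) = kinetic n a.
Proof.
rewrite msq_trig; apply: eq_bigr => k _; rewrite /dseq normcM exprMn normc_dmul.
by rewrite real_normK ?num_real.
Qed.

(** The difference is the imaginary part of the mean of g(|u|^2) conj(u) u_x, linear in u_x; the
    square root on the right is what lets the kinetic part absorb it. *)
Lemma energy_coercive g n a (K Q : R) : 0 <= Q ->
  (forall r, 0 <= r <= K ^+ 2 -> `|g.[r]| <= Q) ->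
  (forall x, normc (trig n a x) <= K) ->
  `|energy g n a - kinetic n a / 2| <= Q * K * Num.sqrt (kinetic n a).
Proof.
move=> Q0 gQ uK; set G := map_poly (real_complex R) g.
set u := trig n a; set w := trig n (dseq a).
have Lw : L2 w by exact: L2_trig.
have mu : tmeas u by have [] := L2_trig n a.
pose H x := G.[u x * (u x)^*] * (u x)^*.
have tH : tp H by apply: tpM; [apply: tp_horner; apply: tpM|];
   try apply: tpJ; exact: tp_trig.
have mH : tmeas H by exact: cint_meas (tp_cint tH).
have HB x : torus x -> normc (H x) <= Q * K.
  move=> _; apply: normcM_le; last by rewrite normc_conj.
  rewrite -horner_normc normc_real; apply: gQ.
  rewrite sqr_ge0 /= ler_sqr ?nnegrE ?normc_ge0//.
  exact: le_trans (normc_ge0 _) (uK x).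
have cHw : cint (fun x => H x * w x) by exact: cintMbdd mH HB (L2_cint Lw).
have cww : cint (fun x => (w x)^* * w x).
  by apply: cint_L2M => //; exact: L2_conj.
have -> : energy g n a = cRe (2^-1%:C * mean (fun x => (w x)^* * w x) - 'i * mean (fun x => H x * w x)).
  rewrite /energy; congr cRe; rewrite -!meanZ// -meanB; [|exact: cintZ..].
  apply: eq_mean => x _; rewrite /edens /H -/G -/u -/w.
  have -> : 2^-1 = (2^-1)%:C :> R[i] by rewrite fmorphV rmorphMn.
  by ring.
rewrite msq_mean// msq_dseq.
set m := mean (fun x => H x * w x).
have -> : cRe (2^-1%:C * (kinetic n a)%:C - 'i * m) - kinetic n a / 2 = cIm m.
  by case: m => x y /=; ring.
by apply: le_trans (ler_Im _) _; rewrite -msq_dseq; exact: normc_meanM_bdd.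
Qed.

Lemma fourier_nlin_le q n a (K Q : R) k :
  (forall r, 0 <= r <= K ^+ 2 -> `|q.[r]| <= Q) ->
  (forall x, normc (trig n a x) <= K) ->
  normc (fourier (nlin q n a) k) <= Q * Num.sqrt (kinetic n a).
Proof.
move=> qQ uK; rewrite fourier_ekN -msq_dseq.
have -> : (fun x => ek (- k) x * nlin q n a x) =
    (fun x => (ek (- k) x * (q.[normc (trig n a x) ^+ 2])%:C) * trig n (dseq a) x).
  by apply/funext => x; rewrite /nlin mulrA.
apply: normc_meanM_bdd; first exact: L2_trig.
  apply: tmeasM; first exact: tmeas_ek.
  have : tp (fun x => (q.[normc (trig n a x) ^+ 2])%:C).
    under eq_fun do rewrite horner_normc.
    by apply: tp_horner; apply: tpM; try apply: tpJ; exact: tp_trig.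
  by move=> /tp_cint/cint_meas.
move=> x _; rewrite normcM normc_ek mul1r normc_real; apply: qQ.
rewrite sqr_ge0 /= ler_sqr ?nnegrE ?normc_ge0//.
exact: le_trans (normc_ge0 _) (uK x).
Qed.

End EnergyCoercivity.

(** * The scheme and its bounds uniform in the truncation *)

Section Galerkin.
Context {R : realType}.
Implicit Types (a b alpha : int -> R[i]) (k : int) (g q : {poly R}).

Lemma eq_trig n a b : (forall k, (`|k| <= n)%N -> a k = b k) -> trig n a = trig n b.
Proof.
move=> ab; apply/funext => x; apply: eq_big_seq => k.
by rewrite mem_zs => /ab ->.
Qed.

Lemma eq_trig_dseq n a b : (forall k, (`|k| <= n)%N -> a k = b k) ->
  trig n (dseq a) = trig n (dseq b).
Proof. by move=> ab; apply: eq_trig => k /ab; rewrite /dseq => ->. Qed.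

Lemma sum_zs_trunc n m (F : int -> R) : (forall k, 0 <= F k) ->
  (forall k, (m < `|k|)%N -> F k = 0) -> \sum_(k <- zs n) F k <= \sum_(k <- zs m) F k.
Proof.
move=> F0 Fm; have [nm|/ltnW mn] := leqP n m; first exact: ler_zs_sum.
by rewrite (big_zs_split _ mn) [X in _ + X]big1 ?addr0.
Qed.

Lemma lawson_increment q n (h : R) a k : 0 <= h ->
  normc (lawson q n h a k - a k) <=
  h * (k%:~R ^+ 2 * normc (a k) + normc (fourier (nlin q n a) k)).
Proof.
move=> h0; set F := fourier (nlin q n a) k.
have -> : lawson q n h a k - a k = (expi (- (k%:~R ^+ 2 * h)) - 1) * a k -
    h%:C * (expi (- (k%:~R ^+ 2 * h)) * F) by rewrite /lawson -/F; ring.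
rewrite mulrDr; apply: normcD_le.
  rewrite [leRHS]mulrA; apply: normcM_le => //.
  apply: le_trans (normc_expiB1 _) _; rewrite normrN ger0_norm 1?mulrC//.
  by apply: mulr_ge0 => //; exact: sqr_ge0.
rewrite normcN; apply: normcM_le; first by rewrite normc_real ger0_norm.
by rewrite normcM normc_expi mul1r.
Qed.

Lemma telescope_bound (a : nat -> int -> R[i]) k (c : R) i j : (i <= j)%N ->
  (forall l, (i <= l < j)%N -> normc (a l.+1 k - a l k) <= c) ->
  normc (a j k - a i k) <= (j - i)%:R * c.
Proof.
elim: j => [|j IH]; first by rewrite leqn0 => /eqP -> _; rewrite subrr subnn mul0r normc0.
rewrite leq_eqVlt => /orP[/eqP -> _|ij H].
  by rewrite subrr subnn mul0r normc0.
have -> : a j.+1 k - a i k = (a j.+1 k - a j k) + (a j k - a i k) by ring.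
rewrite subSn// -natr1 mulrDl mul1r [leRHS]addrC; apply: normcD_le.
  by apply: H; rewrite leqnn andbT.
by apply: IH => // l /andP[il lj]; apply: H; rewrite il ltnW.
Qed.

(** What the passage to the limit uses. The polynomial, the number of steps and the iterates depend
    on N, the bounds T, K, M and Q do not; 1 / (N + 1) controls both the time step and the error on
    r^sigma. *)
Record galerkin_approx (alpha : int -> R[i]) (sigma T K M Q : R) (N : nat) := Approx {
  apx_q : {poly R};
  apx_m : nat;
  apx_a : nat -> int -> R[i];
  apx_m_gt0 : (0 < apx_m)%N;
  apx_h : T / apx_m%:R <= N.+1%:R^-1;
  apx_close : forall r, 0 <= r <= K ^+ 2 -> `|apx_q.[r] - r `^ sigma| <= N.+1%:R^-1;
  apx_init : forall k, apx_a 0 k = if (`|k| <= N)%N then alpha k else 0;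
  apx_step : forall j k, apx_a j.+1 k =
    if (`|k| <= N)%N then lawson apx_q N (T / apx_m%:R) (apx_a j) k else 0;
  apx_h1 : forall j n, (j <= apx_m)%N ->
    \sum_(k <- zs n) (1 + k%:~R ^+ 2) * normc (apx_a j k) ^+ 2 <= M;
  apx_sup : forall j x, (j <= apx_m)%N -> normc (trig N (apx_a j) x) <= K;
  apx_nl : forall j k, (j <= apx_m)%N ->
    normc (fourier (nlin apx_q N (apx_a j)) k) <= Q * Num.sqrt M;
  apx_lip : forall i j k, (i <= j)%N -> (j <= apx_m)%N ->
    normc (apx_a j k - apx_a i k) <=
    (j - i)%:R * (T / apx_m%:R * ((k%:~R ^+ 2 + Q) * Num.sqrt M)) }.

Lemma sum_h1E n a : \sum_(k <- zs n) (1 + k%:~R ^+ 2) * normc (a k) ^+ 2 =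
  msq (trig n a) + kinetic n a.
Proof.
rewrite msq_trig -big_split /=; apply: eq_bigr => k _.
by rewrite mulrDl mul1r.
Qed.

Lemma galerkin alpha (sigma H0 : R) : 1 <= sigma ->
  (forall n, \sum_(k <- zs n) (1 + k%:~R ^+ 2) * normc (alpha k) ^+ 2 <= H0) ->
  exists T K M Q : R, [/\ 0 < T, 0 <= K, 0 <= M, 0 <= Q &
    forall N, exists _ : galerkin_approx alpha sigma T K M Q N, True].
Proof.
move=> s1 aH.
have kinH n : kinetic n alpha <= H0.
  by apply: le_trans (aH n); rewrite sum_h1E lerDr msq_ge0.
have H00 : 0 <= H0 by exact: le_trans (kinetic_ge0 0 alpha) (kinH 0%N).
have [J1 hJ1] := h1_tail H0 (@ltr01 R).
pose A0 := \sum_(k <- zs J1) normc (alpha k) + 1.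
have A00 : 0 <= A0 by rewrite addr_ge0// sumr_ge0// => k _; exact: normc_ge0.
have aA0 n : \sum_(k <- zs n) normc (alpha k) <= A0 by exact: hJ1 (kinH n).
(* A0 bounds the initial datum; the remaining 1 is shared equally between the drift up to the
   current step and the next step. *)
pose K := A0 + 1; have K1 : 1 <= K by rewrite lerDr.
have K0 : 0 <= K by lra.
have K20 : 0 < K ^+ 2 by rewrite exprn_gt0//; lra.
(* Bounds every q on [0, K^2], since q is within 1 / (N + 1) <= 1 of r^sigma there. *)
pose Q := (K ^+ 2) `^ sigma + 1.
have Q0 : 0 <= Q by rewrite addr_ge0// powR_ge0.
(* E0 bounds the initial energy and 1 the error accumulated by the scheme. With y^2 the kinetic
   part, y^2 / 2 - Q K y <= E0 + 1 and Q K y <= y^2 / 4 + (Q K)^2 give y^2 <= Y. *)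
pose E0 := H0 / 2 + Q * K * Num.sqrt H0.
pose Y := 4 * (E0 + 1 + (Q * K) ^+ 2).
have Y0 : 0 <= Y.
  by rewrite mulr_ge0// !addr_ge0 ?divr_ge0 ?mulr_ge0 ?sqrtr_ge0// exprn_ge0// mulr_ge0.
pose M := K ^+ 2 + Y; have M0 : 0 <= M by rewrite addr_ge0// ltW.
pose S := Num.sqrt M; have S0 : 0 <= S by exact: sqrtr_ge0.
(* The frequencies above J contribute at most 1/4 to u(t) - u(0), and those below
   at most T * Lam. *)
have [J hJ] := @h1_tail R (4 * M) 4^-1 ltac:(by rewrite invr_gt0).
pose Lam := \sum_(k <- zs J) (k%:~R ^+ 2 + Q) * S.
have wQ k : 0 <= (k%:~R ^+ 2 + Q) * S.
  by apply: mulr_ge0 => //; apply: addr_ge0 => //; exact: sqr_ge0.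
have w1 a k : 0 <= (1 + k%:~R ^+ 2) * normc (a k) ^+ 2 :> R.
  by apply: mulr_ge0; [apply: addr_ge0 => //|]; exact: sqr_ge0.
have Lam0 : 0 <= Lam by apply: sumr_ge0 => k _.
pose T := (4 * (Lam + 1))^-1.
have T0 : 0 < T by rewrite invr_gt0 mulr_gt0// ltr_wpDl.
have TLam : T * Lam <= 4^-1.
  by rewrite /T invfM -mulrA ler_piMr ?invr_ge0// mulrC ler_pdivrMr ?ltr_wpDl// mul1r lerDl.
exists T, K, M, Q; split => // N.
have [L powL] := powR_lipschitz (K ^+ 2) s1.
have [|q qclose] := @weierstrass_lipschitz R (fun r => r `^ sigma) 0 (K ^+ 2) L
   N.+1%:R^-1 K20 _ powL; first by rewrite invr_gt0.
have qQ r : 0 <= r <= K ^+ 2 -> `|q.[r]| <= Q.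
  move=> hr; have := qclose r hr; have /andP[r0 rK] := hr.
  have : r `^ sigma <= (K ^+ 2) `^ sigma.
    by apply: ge0_ler_powR; rewrite ?nnegrE ?(ltW K20)//; lra.
  have : N.+1%:R^-1 <= 1 :> R by rewrite invf_le1// ler1n.
  have := powR_ge0 r sigma; rewrite /Q.
  move: (q.[r]) (r `^ sigma) ((K ^+ 2) `^ sigma) (N.+1%:R^-1) => A1 A2 A3 A4.
  by rewrite !ler_norml => *; lra.
have [g qg] := potential_exists q.
have gQ := potential_bound qg qQ.
have [C C0 hC] := energy_step N S0 qg.
(* The choice of m below gives h Z <= 1. Its three terms yield h <= 1 / (N + 1), an accumulated
   energy error m C h^2 = h T C <= 1, and a change of u over one step of at most (2 N + 1) C h <= 1
   / 2. *)
pose Z := N.+1%:R + T * C + 2 * (N.*2.+1%:R * C).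
have Z1 : 1 <= Z.
  have n0 : 0 <= N%:R :> R by exact: ler0n.
  rewrite /Z -natr1; have : 0 <= T * C by rewrite mulr_ge0// ltW.
  have : 0 <= N.*2.+1%:R * C by rewrite mulr_ge0.
  lra.
pose m := (Num.truncn (T * Z)).+1.
have mZ : T * Z < m%:R by exact: truncnS_gt.
have m0 : 0 < m%:R :> R by rewrite ltr0n.
pose h := T / m%:R; have h0 : 0 < h by rewrite divr_gt0.
have hZ : h * Z <= 1 by rewrite /h mulrAC ler_pdivrMr// mul1r ltW.
have mh : m%:R * h = T by rewrite /h mulrCA divff ?mulr1// gt_eqF.
have hparts : [/\ h * N.+1%:R <= 1, h * (T * C) <= 1, h * (N.*2.+1%:R * C) <= 2^-1 & h <= 1].
  have p1 : 0 <= h * N%:R by rewrite mulr_ge0 ?ler0n// ltW.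
  have p2 : 0 <= h * (T * C) by rewrite !mulr_ge0// ltW.
  have p3 : 0 <= h * (N.*2.+1%:R * C) by rewrite !mulr_ge0// ltW.
  move: hZ; rewrite /Z -(natr1 N) !mulrDr mulr1.
  have -> : h * (2 * (N.*2.+1%:R * C)) = 2 * (h * (N.*2.+1%:R * C)) by ring.
  by split; lra.
have [hN hTC hNC h1] := hparts.
pose step a := fun k => if (`|k| <= N)%N then lawson q N h a k else 0.
pose a0 := fun k => if (`|k| <= N)%N then alpha k else 0.
pose a j := iter j step a0.
have atr j k : (N < `|k|)%N -> a j k = 0.
  by rewrite ltnNge => /negbTE Nk; case: j => [|j]; rewrite /a /= ?/a0 ?/step Nk.
have aS j : a j.+1 = step (a j) by [].
have aSk j k : (`|k| <= N)%N -> a j.+1 k = lawson q N h (a j) k.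
  by move=> kN; rewrite aS /step kN.
(* P i gives the H^1 bound at step i; the H^1 bounds up to step i give P i.+1. *)
pose P i := (forall x, normc (trig N (a i) x) <= K) /\
   energy g N (a i) <= E0 + i%:R * (C * h ^+ 2).
have Pkin i : (i <= m)%N -> P i -> kinetic N (a i) <= Y.
  move=> im [supK En].
  have e1 : i%:R * (C * h ^+ 2) <= 1.
    apply: le_trans hTC; have -> : h * (T * C) = m%:R * (C * h ^+ 2).
      by rewrite -mh; ring.
    apply: ler_wpM2r; last by rewrite ler_nat.
    by apply: mulr_ge0 => //; apply: exprn_ge0; exact: ltW.
  have := energy_coercive Q0 gQ supK; rewrite ler_norml => /andP[lo _].
  set y := Num.sqrt (kinetic N (a i)) in lo.
  have yy : kinetic N (a i) = y ^+ 2 by rewrite sqr_sqrtr// kinetic_ge0.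
  have := sqr_ge0 (y / 2 - Q * K); rewrite yy in lo *; rewrite /Y; lra.
have Ph1 i : (i <= m)%N -> P i -> forall n,
    \sum_(k <- zs n) (1 + k%:~R ^+ 2) * normc (a i k) ^+ 2 <= M.
  move=> im Pi n; apply: (@le_trans _ _ (\sum_(k <- zs N) (1 + k%:~R ^+ 2) * normc (a i k) ^+ 2)).
    apply: sum_zs_trunc => k //.
    by move=> /atr ->; rewrite normc0 expr0n mulr0.
  rewrite sum_h1E /M lerD ?Pkin//; have [supK _] := Pi.
  rewrite /msq -[leRHS]rmean_cst; apply: ler_rmean.
  - by have [] := L2_trig N (a i).
  - exact: tint_cst.
  - by move=> x _; rewrite ler_sqr ?nnegrE ?normc_ge0.
have PS i : (i <= m)%N -> P i -> forall k, normc (a i k) <= S.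
  move=> im Pi k; rewrite -[leLHS]ger0_norm ?normc_ge0// -sqrtr_sqr ler_wsqrtr//.
  apply: le_trans (Ph1 i im Pi `|k|%N).
  rewrite (big_rem k) ?mem_zs//=; apply: (@le_trans _ _ ((1 + k%:~R ^+ 2) * normc (a i k) ^+ 2)).
    by rewrite mulrDl mul1r lerDl; apply: mulr_ge0; exact: sqr_ge0.
  by rewrite lerDl sumr_ge0.
have Pnl i : (i <= m)%N -> P i -> forall k, normc (fourier (nlin q N (a i)) k) <= Q * S.
  move=> im Pi k; have [supK _] := Pi.
  apply: le_trans (fourier_nlin_le k qQ supK) _; rewrite ler_wpM2l// ler_wsqrtr//.
  by apply: le_trans (Pkin i im Pi) _; rewrite lerDr ltW.
have Pinc i : (i <= m)%N -> P i -> forall k,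
    normc (a i.+1 k - a i k) <= h * ((k%:~R ^+ 2 + Q) * S).
  move=> im Pi k; have [kN|Nk] := leqP `|k|%N N; last first.
    rewrite !atr// subrr normc0.
    by apply: mulr_ge0 => //; exact: ltW.
  rewrite aSk//; apply: le_trans (lawson_increment _ _ _ _ (ltW h0)) _.
  rewrite ler_wpM2l ?(ltW h0)// mulrDl lerD//; last exact: Pnl.
  by rewrite ler_wpM2l ?sqr_ge0//; exact: PS.
have allP j : (j <= m)%N -> P j.
  elim/ltn_ind: j => -[|j] IH jm.
    split=> [x|].
      apply: le_trans (normc_sum _ _ _) _; apply: (@le_trans _ _ A0); last by rewrite lerDl.
      apply: le_trans (aA0 N); rewrite big_seq [leRHS]big_seq; apply: ler_sum => k.
      by rewrite mem_zs normcM normc_ek mulr1 /a /= /a0 => ->.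
    have -> : energy g N (a 0%N) = energy g N alpha.
      by rewrite /energy (@eq_trig N (a 0%N) alpha) ?(@eq_trig_dseq N (a 0%N) alpha)//;
         move=> k kN; rewrite /a /= /a0 kN.
    have supA x : normc (trig N alpha x) <= K.
      apply: le_trans (normc_sum _ _ _) _; apply: (@le_trans _ _ A0); last by rewrite lerDl.
      by apply: le_trans (aA0 N); apply: ler_sum => k _; rewrite normcM normc_ek mulr1.
    have := energy_coercive Q0 gQ supA; rewrite ler_norml => /andP[_].
    rewrite mul0r addr0 /E0 => up.
    have : Q * K * Num.sqrt (kinetic N alpha) <= Q * K * Num.sqrt H0.
      by rewrite ler_wpM2l ?mulr_ge0// ler_wsqrtr.
    by have := kinH N; lra.
  have jm' : (j <= m)%N by exact: ltnW.
  have IHj i : (i <= j)%N -> P i.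
    by move=> ij; apply: IH => //; exact: leq_trans jm'.
  have Pj := IHj j (leqnn j); have [supj Ej] := Pj.
  have hh : 0 < h <= 1 by rewrite h0.
  have [Estep dstep] := hC (a j) h hh (fun k _ => PS j jm' Pj k).
  split; last first.
    have -> : energy g N (a j.+1) = energy g N (lawson q N h (a j)).
      by rewrite /energy (@eq_trig N (a j.+1) (lawson q N h (a j)))
         ?(@eq_trig_dseq N (a j.+1) (lawson q N h (a j)))//; move=> k; exact: aSk.
    apply: le_trans Estep _; rewrite -natr1 mulrDl mul1r addrA lerD2r//.
  move=> x.
  (* No H^1 bound is available yet at step j + 1, so the last step is estimated crudely, with a
     constant depending on N; the uniform bounds then control the drift up to step j. *)
  have d1 : normc (trig N (a j.+1) x - trig N (a j) x) <= 2^-1.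
    rewrite trigB; apply: le_trans hNC.
    have -> : h * (N.*2.+1%:R * C) = N.*2.+1%:R * (C * h) by ring.
    by apply: normc_trig => k kN; rewrite aSk//; exact: dstep.
  have d0 : normc (trig N (a j) x - trig N (a 0%N) x) <= 2^-1.
    rewrite trigB; pose d k := a j k - a 0%N k.
    apply: (@le_trans _ _ (\sum_(k <- zs N) normc (d k))).
      by apply: le_trans (normc_sum _ _ _) _; apply: ler_sum => k _; rewrite normcM normc_ek mulr1.
    have dk2 k : normc (d k) ^+ 2 <= 2 * normc (a j k) ^+ 2 + 2 * normc (a 0%N k) ^+ 2.
      by apply: le_trans (normcD2 _ _) _; rewrite normcN.
    have P0 := IHj 0%N (leq0n _).
    have /hJ : \sum_(k <- zs N) k%:~R ^+ 2 * normc (d k) ^+ 2 <= 4 * M.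
      apply: (@le_trans _ _ (2 * kinetic N (a j) + 2 * kinetic N (a 0%N))).
        rewrite /kinetic !mulr_sumr -big_split /=; apply: ler_sum => k _.
        apply: le_trans (ler_wpM2l (sqr_ge0 _) (dk2 k)) _.
        by rewrite le_eqVlt; apply/orP; left; apply/eqP; ring.
      have := Pkin j jm' Pj; have := Pkin 0%N (leq0n _) P0.
      have : Y <= M by rewrite lerDr ltW.
      by lra.
    move=> /le_trans; apply.
    suff : \sum_(k <- zs J) normc (d k) <= 4^-1 by lra.
    apply: le_trans TLam; rewrite /Lam mulr_sumr; apply: ler_sum => k _.
    apply: le_trans (telescope_bound (leq0n j) (c := h * ((k%:~R ^+ 2 + Q) * S)) _) _.
      by move=> l /andP[_ lj]; apply: Pinc; [exact: leq_trans (ltnW lj) jm'|exact: IHj (ltnW lj)].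
    rewrite subn0 mulrA -mh ler_wpM2r ?ler_wpM2r ?(ltW h0) ?ler_nat//.
  have s0 : normc (trig N (a 0%N) x) <= A0.
    apply: le_trans (normc_sum _ _ _) _.
    apply: le_trans (aA0 N); rewrite big_seq [leRHS]big_seq; apply: ler_sum => k.
    by rewrite mem_zs normcM normc_ek mulr1 /a /= /a0 => ->.
  have -> : trig N (a j.+1) x = (trig N (a j.+1) x - trig N (a j) x) +
      ((trig N (a j) x - trig N (a 0%N) x) + trig N (a 0%N) x) by ring.
  have -> : K = 2^-1 + (2^-1 + A0) by rewrite /K; lra.
  by apply: normcD_le d1 (normcD_le d0 s0).
unshelve eexists.
  apply: (@Approx alpha sigma T K M Q N q m a) => //.
  - by rewrite -/h -[leRHS]mul1r ler_pdivlMr// ltr0n.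
  - by move=> j n jm; exact: Ph1 (allP j jm) n.
  - by move=> j x jm; have [+ _] := allP j jm; exact.
  - by move=> j k jm; exact: Pnl (allP j jm) k.
  - move=> i j k ij jm; apply: telescope_bound => // l /andP[il lj].
    have lm : (l <= m)%N by exact: leq_trans (ltnW lj) jm.
    by apply: Pinc => //; exact: allP.
by [].
Qed.

End Galerkin.

(** * Passage to the limit *)

Section Compactness.
Context {R : realType}.

Lemma ultra_bounded_cvg (U : set_system nat) (u : nat -> R) (B : R) :
  UltraFilter U -> (forall n, `|u n| <= B) ->
  exists l : R, forall e, 0 < e -> U [set n | `|u n - l| < e].
Proof.
move=> UU uB; have PU : ProperFilter U by exact: ultra_proper.
have cB : compact `[- B, B] by exact: segment_compact.
have FU : ProperFilter (u @ U) by exact: fmap_proper_filter.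
have UB : (u @ U) [set` `[- B, B]].
  by apply: (@filterE _ U) => n; rewrite /= in_itv/= -ler_norml.
have [l [_ cl]] := cB _ FU UB.
exists l => e e0; have [//|nU] := in_ultra_setVsetC [set n | `|u n - l| < e] UU.
have [|y [/= [n hn <-]]] := cl (u @` (~` [set n | `|u n - l| < e])) (ball l e) _ (nbhsx_ballx l e e0).
  by apply: (@filterS _ U) nU => n hn; exists n.
by rewrite /ball/= distrC => hb; exfalso; apply: hn.
Qed.

(* A free ultrafilter yields all the limits at once. *)
Lemma diagonal_subsequence (I : countType) (u : I -> nat -> R) (B : I -> R) :
  (forall i n, `|u i n| <= B i) ->
  exists (phi : nat -> nat) (l : I -> R), (forall n, (n <= phi n)%N) /\
    forall i, u i (phi n) @[n --> \oo] --> l i.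
Proof.
move=> uB; have [U [UU sU]] := @ultraFilterLemma _ (nbhs \oo : set_system nat) _.
have PU : ProperFilter U by exact: ultra_proper.
have /choice[l hl] i := ultra_bounded_cvg UU (uB i).
(* Only the indices of code below n are required to be close at stage n: finitely many conditions,
   met together by a set of the ultrafilter. *)
have /choice[phi hphi] : forall n : nat, exists m, (n <= m)%N /\
    forall i : I, (choice.pickle i < n)%N -> `|u i m - l i| < n.+1%:R^-1.
  move=> n.
  have Un : U [set m | (n <= m)%N] by apply: sU; exact: nbhs_infty_ge.
  have Ui : U [set m | forall i : I, (choice.pickle i < n)%N -> `|u i m - l i| < n.+1%:R^-1].
    have H (j : nat) : U [set m | forall i : I, choice.pickle i = j -> `|u i m - l i| < n.+1%:R^-1].
      have [[i0 i0j]|nex] := pselect (exists i : I, choice.pickle i = j); last first.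
        by apply: filterE => m i ij; exfalso; apply: nex; exists i.
      apply: filterS (hl i0 n.+1%:R^-1 _); last by rewrite invr_gt0.
      by move=> m hm i; rewrite -i0j => /(pcan_inj choice.pickleK) ->.
    have : \forall m \near U, forall j : 'I_n, forall i : I, choice.pickle i = j ->
        `|u i m - l i| < n.+1%:R^-1 by apply: filter_forall => j; exact: H.
    by apply: filterS => m hm i im; exact: (hm (Ordinal im) i erefl).
  by have [m [? ?]] := filter_ex (filterI Un Ui); exists m.
exists phi, l; split=> [n|i]; first by have [] := hphi n.
apply/cvgrPdist_le => e e0; near=> n.
rewrite distrC ltW//; apply: (@lt_trans _ _ n.+1%:R^-1).
  have [_ h] := hphi n; apply: h; near: n; exact: nbhs_infty_gt.
near: n; exact: (near_infty_natSinv_lt (PosNum e0)).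
Unshelve. all: by end_near. Qed.

(** Diagonal extraction at rational times, extended to all times by the Cauchy criterion. The
    functions are piecewise constant in time, hence equicontinuous only up to an error h n tending
    to 0. *)
Lemma equicontinuous_subsequence (I : countType) (T : R) (u : I -> R -> nat -> R)
    (B c : I -> R) (h : nat -> R) : 0 < T ->
  (forall i t n, `|u i t n| <= B i) -> (forall i, 0 <= c i) ->
  h @ \oo --> 0 ->
  (forall i s t n, 0 <= s <= T -> 0 <= t <= T ->
     `|u i t n - u i s n| <= (`|t - s| + h n) * c i) ->
  exists (phi : nat -> nat) (l : I -> R -> R), (forall n, (n <= phi n)%N) /\
    forall i t, 0 <= t <= T -> u i t (phi n) @[n --> \oo] --> l i t.
Proof.
move=> T0 uB c0 h0 uc.
have [phi [l [phin hl]]] := @diagonal_subsequence (I * rat)%type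
  (fun iq n => u iq.1 (ratr iq.2) n) (fun iq => B iq.1) (fun iq n => uB _ _ _).
have hphi : h (phi n) @[n --> \oo] --> 0.
  apply/cvgr0Pnorm_le => e e0; move/cvgr0Pnorm_le: h0 => /(_ e e0)[N _ HN].
  by exists N => // n Nn; apply: HN; exact: leq_trans (phin n).
have cv i t : 0 <= t <= T -> cvgn (fun n => u i t (phi n)).
  move=> tT; apply: cauchy_cvg; apply: cauchy_exP => e e0.
  have c1 : 0 < c i + 1 by rewrite ltr_wpDl.
  pose d := e / (3 * (c i + 1)); have d0 : 0 < d by rewrite divr_gt0// mulr_gt0.
  have dc : d * c i <= e / 3.
    rewrite /d invfM mulrA -mulrA; apply: ler_piMr; first by rewrite divr_ge0// ltW.
    by rewrite mulrC ler_pdivrMr// mul1r lerDl.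
  have [q] := @rat_in_itvoo R (Num.max 0 (t - d)) (Num.min T (t + d)) ltac:(
    by rewrite gt_max !lt_min T0 /=; apply/andP; split; [lra|apply/andP; split; lra]).
  rewrite in_itv/= gt_max lt_min => /andP[/andP[q0 qd] /andP[qT qd']].
  exists (l (i, q)); near=> n; rewrite /ball/=.
  have h1 : `|l (i, q) - u i (ratr q) (phi n)| < e / 3.
    near: n; apply: cvgr_dist_lt; [exact: (hl (i, q))|by rewrite divr_gt0].
  have h2 : h (phi n) <= d.
    by apply: le_trans (ler_norm _) _; near: n; move/cvgr0Pnorm_le: hphi; exact.
  have qT' : 0 <= (ratr q : R) <= T by rewrite (ltW q0) (ltW qT).
  have h3 : `|t - ratr q| <= d by rewrite ler_norml; apply/andP; split; lra.
  have h4 : `|u i t (phi n) - u i (ratr q) (phi n)| <= e / 3 + e / 3.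
    apply: le_trans (uc i _ _ _ qT' tT) _.
    apply: le_trans (ler_wpM2r (c0 i) (lerD h3 h2)) _.
    by rewrite mulrDl lerD.
  rewrite -(subrK (u i (ratr q) (phi n)) (l (i, q))) -addrA.
  apply: le_lt_trans (ler_normD _ _) _.
  by rewrite -[X in _ + X]normrN opprB; lra.
exists phi, (fun i t => limn (fun n => u i t (phi n))); split=> //.
Unshelve. all: by end_near. Qed.

End Compactness.

(** * Pointwise sums of absolutely convergent Fourier series *)

Section AbsolutelyConvergentSums.
Context {R : realType}.
Local Notation mu := (@lebesgue_measure R).
Implicit Types (a b : int -> R[i]) (x : R) (k : int).

Definition ell1 a : Prop := exists A, forall n, \sum_(k <- zs n) normc (a k) <= A.

(* Junk unless a is ell1; unlike a class in L^2, it is defined at every point. *)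
Definition hsum a : R -> R[i] := fun x =>
  limn (fun n => cRe (trig n a x)) +i* limn (fun n => cIm (trig n a x)).

Lemma normc_trig_sum n a x : normc (trig n a x) <= \sum_(k <- zs n) normc (a k).
Proof.
by apply: le_trans (normc_sum _ _ _) _; apply: ler_sum => k _; rewrite normcM normc_ek mulr1.
Qed.

Lemma is_cvg_trig a x : ell1 a ->
  cvgn (fun n => cRe (trig n a x)) /\ cvgn (fun n => cIm (trig n a x)).
Proof.
move=> [A aA]; pose d n := normc (a n.+1%:Z) + normc (a (- n.+1%:Z)).
have dA n : \sum_(0 <= i < n) d i <= A.
  apply: le_trans (aA n); suff: \sum_(0 <= i < n) d i + normc (a 0) = \sum_(k <- zs n) normc (a k).
    by move=> <-; rewrite lerDl normc_ge0.
  elim: n => [|n IH]; first by rewrite big_geq// add0r big_zs0.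
  by rewrite big_zsS -IH big_nat_recr//= /d; ring.
have dx n : normc (trig n.+1 a x - trig n a x) <= d n.
  rewrite /trig big_zsS addrK; apply: normcD_le; by rewrite normcM normc_ek mulr1.
split; apply: cvg_telescope_abs dA => n.
- by rewrite -cReN -cReD; exact: le_trans (ler_Re _) (dx n).
- by rewrite -cImN -cImD; exact: le_trans (ler_Im _) (dx n).
Qed.

Lemma hsum_cvg a x : ell1 a -> normc (trig n a x - hsum a x) @[n --> \oo] --> 0.
Proof.
move=> /(is_cvg_trig x)[cr ci]; apply/cvgr0Pnorm_le => e e0.
have e2 : 0 < e / 2 by rewrite divr_gt0.
have h1 : \forall n \near \oo, `|cRe (hsum a x) - cRe (trig n a x)| <= e / 2.
  by apply: cvgr_dist_le => //; exact: cr.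
have h2 : \forall n \near \oo, `|cIm (hsum a x) - cIm (trig n a x)| <= e / 2.
  by apply: cvgr_dist_le => //; exact: ci.
near=> n; rewrite ger0_norm ?normc_ge0//.
rewrite (le_trans (ler_ReIm _))// cReD cImD cReN cImN (splitr e) lerD//.
- by rewrite distrC; near: n.
- by rewrite distrC; near: n.
Unshelve. all: by end_near. Qed.

Lemma hsum_dist a b x (S : R) : ell1 a -> ell1 b ->
  (forall n, \sum_(k <- zs n) normc (a k - b k) <= S) ->
  normc (hsum a x - hsum b x) <= S.
Proof.
move=> la lb abS; apply/ler_addgt0Pr => e e0.
have e2 : 0 < e / 2 by rewrite divr_gt0.
have [n [h1 h2]] : exists n, normc (trig n a x - hsum a x) <= e / 2 /\
    normc (trig n b x - hsum b x) <= e / 2.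
  have /cvgr0Pnorm_le/(_ _ e2) ca := hsum_cvg x la.
  have /cvgr0Pnorm_le/(_ _ e2) cb := hsum_cvg x lb.
  have [n [h1 h2]] := filter_ex (filterI ca cb); exists n.
  by move: h1 h2; rewrite /= !ger0_norm ?normc_ge0.
have -> : hsum a x - hsum b x = trig n (fun k => a k - b k) x +
  (- (trig n a x - hsum a x) + (trig n b x - hsum b x)) by rewrite -trigB; ring.
have -> : S + e = S + (e / 2 + e / 2) by lra.
apply: normcD_le; first exact: le_trans (normc_trig_sum _ _ _) (abS n).
by apply: normcD_le; rewrite ?normcN.
Qed.

Definition trunc N a : int -> R[i] := fun k => if (`|k| <= N)%N then a k else 0.

Lemma trig_trunc N a n : (N <= n)%N -> trig n (trunc N a) = trig N a.
Proof.
move=> Nn; apply/funext => x; rewrite /trig (big_zs_split _ Nn) [X in _ + X]big1.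
  by rewrite addr0; apply: eq_big_seq => k; rewrite mem_zs /trunc => ->.
by move=> k Nk; rewrite /trunc leqNgt Nk mul0r.
Qed.

Lemma sum_trunc N a n : \sum_(k <- zs n) normc (trunc N a k) <= \sum_(k <- zs N) normc (a k).
Proof.
apply: (@le_trans _ _ (\sum_(k <- zs N) normc (trunc N a k))).
  apply: sum_zs_trunc => k; first exact: normc_ge0.
  by move=> Nk; rewrite /trunc leqNgt Nk normc0.
rewrite big_seq [leRHS]big_seq; apply: ler_sum => k.
by rewrite mem_zs /trunc => ->.
Qed.

Lemma ell1_trunc N a : ell1 (trunc N a).
Proof. by eexists => n; exact: sum_trunc. Qed.

Lemma hsum_trunc N a : hsum (trunc N a) = trig N a.
Proof.
apply/funext => x; apply: complexP => /=.
- apply: (cvg_lim (@Rhausdorff R)); apply: cvg_near_cst.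
  by near=> n; rewrite trig_trunc//; near: n; exact: nbhs_infty_ge.
- apply: (cvg_lim (@Rhausdorff R)); apply: cvg_near_cst.
  by near=> n; rewrite trig_trunc//; near: n; exact: nbhs_infty_ge.
Unshelve. all: by end_near. Qed.

Lemma tmeas_hsum a : ell1 a -> tmeas (hsum a).
Proof.
move=> la; split.
- apply: (@measurable_fun_cvg _ _ _ _ (fun n x => cRe (trig n a x))).
    by move=> n; have [[]] := L2_trig n a.
  by move=> x _; have [] := is_cvg_trig x la.
- apply: (@measurable_fun_cvg _ _ _ _ (fun n x => cIm (trig n a x))).
    by move=> n; have [[]] := L2_trig n a.
  by move=> x _; have [] := is_cvg_trig x la.
Qed.

Lemma normc_hsum a x (A : R) : (forall n, \sum_(k <- zs n) normc (a k) <= A) ->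
  normc (hsum a x) <= A.
Proof.
move=> aA; have la : ell1 a by exists A.
have z : hsum (trunc 0 (fun=> 0)) x = 0 :> R[i].
  by rewrite hsum_trunc /trig big_zs0 mul0r.
rewrite -[hsum a x]subr0 -z; apply: hsum_dist => //; first exact: ell1_trunc.
by move=> n; under eq_bigr do rewrite /trunc if_same subr0; exact: aA.
Qed.

Lemma L2_hsum a : ell1 a -> L2 (hsum a).
Proof.
move=> la; have [A aA] := la; apply: (@L2_bdd _ _ A); first exact: tmeas_hsum.
by move=> x _; exact: normc_hsum.
Qed.

Lemma fourier_hsum a k : ell1 a -> fourier (hsum a) k = a k.
Proof.
move=> la; apply/eqP; rewrite -subr_eq0; apply/eqP.
apply: eq0_normc; apply/eqP; rewrite eq_le normc_ge0 andbT.
apply/ler_addgt0Pr => e e0; rewrite add0r.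
have [A aA] := la.
have mono : {homo (fun n => \sum_(k <- zs n) normc (a k)) : m n / (m <= n)%N >-> m <= n}.
  by move=> m n mn; apply: ler_zs_sum => // j; exact: normc_ge0.
have [N0 HN] := monotone_bounded_tail mono aA e0.
pose N := maxn N0 `|k|%N.
have dist x : normc (hsum a x - trig N a x) <= e.
  rewrite -hsum_trunc; apply: hsum_dist => //; first exact: ell1_trunc.
  move=> n; have [nN|/ltnW Nn] := leqP n N.
    rewrite big_seq big1 ?ltW// => j; rewrite mem_zs => jn.
    by rewrite /trunc (leq_trans jn nN) subrr normc0.
  apply: le_trans (HN N n (leq_maxl _ _) Nn).
  rewrite (big_zs_split _ Nn) /= [X in X + _ <= _]big_seq big1; last first.
    by move=> j; rewrite mem_zs /trunc => ->; rewrite subrr normc0.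
  rewrite (big_zs_split _ Nn) /= add0r [leRHS]addrAC subrr add0r; apply: ler_sum => j Nj.
  by rewrite /trunc leqNgt Nj subr0.
have Lt := L2_trig N a; have Lh := L2_hsum la.
have := @normc_fourier_bdd _ (fun x => hsum a x - trig N a x) k e _ dist.
rewrite fourierB; [|exact: L2_cint..].
rewrite fourier_trig leq_maxr; apply.
by have [] := L2B Lh Lt.
Qed.

End AbsolutelyConvergentSums.

(** * Product of a uniform limit and a weak limit *)

Section WeakProducts.
Context {R : realType}.
Implicit Types (k : int).

Lemma cvg_sum_seq (I J : Type) (F : set_system I) {FF : Filter F} (r : seq J)
    (f : J -> I -> R) (l : J -> R) : (forall j, f j @ F --> l j) ->
  \sum_(j <- r) f j i @[i --> F] --> \sum_(j <- r) l j.
Proof.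
move=> fl; elim: r => [|j r IH].
  under eq_fun do rewrite big_nil; rewrite big_nil; exact: cvg_cst.
under eq_fun do rewrite big_cons; rewrite big_cons; exact: cvgD (fl j) IH.
Qed.

(** The difference splits into (phi_i - phi) w_i, small by uniform convergence, and phi (w_i - w).
    In the latter the test function is replaced by a trigonometric polynomial close in L^2, after
    which only finitely many coefficients of w_i - w occur. The filter is general because it is used
    both along a sequence and as s tends to t. *)
Lemma weak_product_cvg (I : Type) (F : set_system I) {FF : Filter F}
    (w phi : I -> R -> R[i]) (wl phil : R -> R[i]) (delta : I -> R) (B P : R) :
  (forall i, L2 (w i)) -> (forall i, msq (w i) <= B) -> L2 wl ->
  (forall k, normc (fourier (w i) k - fourier wl k) @[i --> F] --> 0) ->
  (forall i, tmeas (phi i)) -> tmeas phil ->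
  (forall x, torus x -> normc (phil x) <= P) ->
  (forall i x, torus x -> normc (phi i x - phil x) <= delta i) -> delta @ F --> 0 ->
  forall k, normc (fourier (fun x => phi i x * w i x) k -
                   fourier (fun x => phil x * wl x) k) @[i --> F] --> 0.
Proof.
move=> Lw wB Lwl wcv mphi mphil philP dphi delta0 k.
have phib i x : torus x -> normc (phi i x) <= P + delta i.
  move=> Tx; rewrite -(subrK (phil x) (phi i x)) addrC.
  by apply: normcD_le; [exact: philP|exact: dphi].
have Lphil : L2 phil by exact: L2_bdd mphil philP.
have Lpw i : L2 (fun x => phi i x * w i x) by exact: L2Mbdd (mphi i) (phib i) (Lw i).
have Lpwl : L2 (fun x => phil x * wl x) by exact: L2Mbdd mphil philP Lwl.
pose psi x := (ek (- k) x * phil x)^*.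
have Lpsi : L2 psi by apply: L2_conj; exact: L2_ekM.
have E i : fourier (fun x => phi i x * w i x) k - fourier (fun x => phil x * wl x) k =
    mean (fun x => (ek (- k) x * (phi i x - phil x)) * w i x) +
    mean (fun x => (psi x)^* * (w i x - wl x)).
  rewrite !fourier_ekN -meanB; last 2 first.
  - by apply: cint_ekM; exact: L2_cint.
  - by apply: cint_ekM; exact: L2_cint.
  rewrite -meanD; last 2 first.
  - have := @cintMbdd _ (w i) (fun x => ek (- k) x * (phi i x - phil x)) (delta i).
    apply; last exact: L2_cint.
      by apply: tmeasM; [exact: tmeas_ek|exact: tmeasB].
    by move=> x Tx; rewrite normcM normc_ek mul1r; exact: dphi.
  - apply: cint_L2M; [exact: L2_conj|exact: L2B].
  by apply: eq_mean => x _; rewrite /psi conjcK; ring.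
apply/cvgr0Pnorm_le => e e0.
have e3 : 0 < e / 3 by rewrite divr_gt0.
(* D bounds the L^2 norm of w_i - w, so the polynomial has to be within e / 3 / D of psi. *)
pose D := Num.sqrt (2 * `|B| + 2 * msq wl) + 1.
have D0 : 0 < D by rewrite ltr_wpDl ?sqrtr_ge0.
have [n hn] := trig_dense Lpsi (exprn_gt0 2 (divr_gt0 e3 D0)).
set p := trig n (fourier psi) in hn.
have Lp : L2 p by exact: L2_trig.
have E2 i : mean (fun x => (psi x)^* * (w i x - wl x)) =
    mean (fun x => (psi x - p x)^* * (w i x - wl x)) +
    \sum_(j <- zs n) (fourier psi j)^* * (fourier (w i) j - fourier wl j).
  have LB : L2 (fun x => w i x - wl x) by exact: L2B.
  rewrite -[X in _ + X](_ : mean (fun x => (p x)^* * (w i x - wl x)) = _); last first.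
    rewrite mean_trigM; last exact: L2_cint.
    by apply: eq_bigr => j _; rewrite fourierB//; exact: L2_cint.
  rewrite -meanD.
  - by apply: eq_mean => x _; rewrite conjcD conjcN; ring.
  - by apply: cint_L2M => //; apply: L2_conj; exact: L2B.
  - by apply: cint_L2M => //; exact: L2_conj.
have sqB : 0 <= Num.sqrt `|B| + 1 by rewrite addr_ge0.
have cv1 : \forall i \near F, delta i * (Num.sqrt `|B| + 1) <= e / 3.
  have sq1 : 0 < Num.sqrt `|B| + 1 by rewrite ltr_wpDl.
  have e4 : 0 < e / 3 / (Num.sqrt `|B| + 1) by exact: divr_gt0.
  move/cvgr0Pnorm_le: delta0 => /(_ _ e4); apply: filterS => i.
  by move=> /(le_trans (ler_norm _)); rewrite (ler_pdivlMr _ _ sq1).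
have cv2 : \forall i \near F, \sum_(j <- zs n)
    normc (fourier psi j) * normc (fourier (w i) j - fourier wl j) <= e / 3.
  have : \sum_(j <- zs n) normc (fourier psi j) *
      normc (fourier (w i) j - fourier wl j) @[i --> F] --> 0.
    rewrite -[X in _ --> X](_ : \sum_(j <- zs n) normc (fourier psi j) * 0 = 0).
      by apply: cvg_sum_seq => j; apply: cvgM; [exact: cvg_cst|exact: wcv].
    by rewrite big1// => j _; rewrite mulr0.
  move=> /cvgr0Pnorm_le/(_ _ e3); apply: filterS => i; exact: le_trans (ler_norm _).
apply: filterS2 cv1 cv2 => i h1 h2; rewrite ger0_norm ?normc_ge0// E E2.
have -> : e = e / 3 + (e / 3 + e / 3) by lra.
apply: normcD_le.
  apply: le_trans h1; have de : 0 <= delta i.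
    have T0 : torus (0 : R) by rewrite /torus /= in_itv/= lexx pi2_gt0.
    exact: le_trans (normc_ge0 _) (dphi i 0 T0).
  apply: (@le_trans _ _ (delta i * Num.sqrt (msq (w i)))).
    apply: normc_meanM_bdd => //.
      by apply: tmeasM; [exact: tmeas_ek|exact: tmeasB].
    by move=> x Tx; rewrite normcM normc_ek mul1r; exact: dphi.
  rewrite ler_wpM2l//; apply: (@le_trans _ _ (Num.sqrt `|B|)); last by rewrite lerDl.
  by rewrite ler_wsqrtr// (le_trans (wB i))// ler_norm.
apply: normcD_le; last first.
  apply: le_trans (normc_sum _ _ _) (le_trans _ h2).
  by apply: ler_sum => j _; rewrite normcM normc_conj.
apply: le_trans (normc_meanM _ _) _; [by apply: L2_conj; exact: L2B|exact: L2B|].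
apply: (@le_trans _ _ (e / 3 / D * D)); last by rewrite divfK// gt_eqF.
apply: ler_pM; rewrite ?sqrtr_ge0//.
  rewrite -[leRHS]ger0_norm ?(ltW (divr_gt0 e3 D0))// -sqrtr_sqr ler_wsqrtr//.
  apply: le_trans hn; rewrite /msq le_eqVlt; apply/orP; left; apply/eqP.
  by apply: eq_rmean => x _; rewrite normc_conj.
apply: (@le_trans _ _ (Num.sqrt (2 * `|B| + 2 * msq wl))); last by rewrite lerDl.
rewrite ler_wsqrtr//; apply: (@le_trans _ _ (2 * msq (w i) + 2 * msq wl)); last first.
  by rewrite lerD2r ler_pM2l// (le_trans (wB i))// ler_norm.
have [_ i1] := Lw i; have [_ i2] := Lwl.
rewrite /msq -!rmeanZ// -rmeanD; [|exact: tintZ..].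
apply: ler_rmean; [by have [] := L2B (Lw i) Lwl|by apply: tintD; exact: tintZ|].
by move=> x _; apply: le_trans (normcD2 _ _) _; rewrite normcN.
Qed.

End WeakProducts.

(** * Continuity of the nonlinearity on balls of H^1 *)

Section NonlinearLimits.
Context {R : realType}.
Local Notation mu := (@lebesgue_measure R).
Implicit Types (a b : int -> R[i]) (x M sigma : R) (k : int).

Definition h1le M a : Prop :=
  forall n, \sum_(k <- zs n) (1 + k%:~R ^+ 2) * normc (a k) ^+ 2 <= M.

Lemma h1le_kinetic M a n : h1le M a ->
  \sum_(k <- zs n) k%:~R ^+ 2 * normc (a k) ^+ 2 <= M.
Proof.
move=> aM; apply: le_trans (aM n); apply: ler_sum => k _.
by rewrite mulrDl mul1r lerDr sqr_ge0.
Qed.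

Lemma h1le_dseq M a n : h1le M a -> \sum_(k <- zs n) normc (dseq a k) ^+ 2 <= M.
Proof.
move=> aM; apply: le_trans (h1le_kinetic n aM); rewrite le_eqVlt; apply/orP; left; apply/eqP.
apply: eq_bigr => k _; rewrite /dseq normcM exprMn normc_dmul.
by rewrite real_normK ?num_real.
Qed.

Lemma h1le_ge0 M a : h1le M a -> 0 <= M.
Proof.
move=> /(_ 0%N); rewrite big_zs0 => /(le_trans _); apply.
by apply: mulr_ge0; [rewrite addr_ge0// sqr_ge0|exact: sqr_ge0].
Qed.

Lemma h1le_normc M a k : h1le M a -> normc (a k) <= Num.sqrt M.
Proof.
move=> aM; rewrite -[leLHS]ger0_norm ?normc_ge0// -sqrtr_sqr ler_wsqrtr//.
apply: le_trans (aM `|k|%N); apply: (@le_trans _ _ (\sum_(j <- zs `|k|%N | j == k) (1 + j%:~R ^+ 2) * normc (a j) ^+ 2)).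
  rewrite big_mkcond big_zs_pick leqnn mulrDl mul1r lerDl; apply: mulr_ge0; exact: sqr_ge0.
rewrite big_mkcond; apply: ler_sum => j _; case: ifP => // _.
by apply: mulr_ge0; [rewrite addr_ge0// sqr_ge0|exact: sqr_ge0].
Qed.

(** The Sobolev embedding of H^1 in bounded functions, at the level of coefficients and uniform on a
    ball. *)
Lemma h1le_sup M : exists2 S : R, 0 <= S &
  forall a, h1le M a -> forall n, \sum_(k <- zs n) normc (a k) <= S.
Proof.
have [J HJ] := h1_tail M ltr01; exists (J.*2.+1%:R * Num.sqrt M + 1).
  by rewrite addr_ge0// mulr_ge0.
move=> a aM n; apply: le_trans (HJ a n (h1le_kinetic n aM)) _; rewrite lerD2r.
apply: (@le_trans _ _ (\sum_(k <- zs J) Num.sqrt M)).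
  by apply: ler_sum => k _; exact: h1le_normc.
by rewrite big_const_seq count_predT size_zs iter_addr_0 mulr_natl.
Qed.

Lemma h1le_ell1 M a : h1le M a -> ell1 a.
Proof. by have [S _ HS] := h1le_sup M; move=> /HS aS; exists S. Qed.

Definition ell1_dist a b : R := limn (fun n => \sum_(k <- zs n) normc (a k - b k)).

(** On a ball of H^1 the l^1 tails are uniformly small by [h1_tail], so convergence of each
    coefficient implies convergence in l^1, hence uniformly in x. *)
Lemma ell1_dist_cvg (I : Type) (F : set_system I) {FF : Filter F}
    (a : I -> int -> R[i]) b M :
  (forall i, h1le M (a i)) -> h1le M b ->
  (forall k, normc (a i k - b k) @[i --> F] --> 0) ->
  (forall i x, normc (hsum (a i) x - hsum b x) <= ell1_dist (a i) b) /\
  ell1_dist (a i) b @[i --> F] --> 0.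
Proof.
move=> aM bM ab.
have mono i : {homo (fun n => \sum_(k <- zs n) normc (a i k - b k)) : m n / (m <= n)%N >-> m <= n}.
  by move=> m n mn; apply: ler_zs_sum => // j; exact: normc_ge0.
have [S S0 HS] := h1le_sup M.
have bd i n : \sum_(k <- zs n) normc (a i k - b k) <= S + S.
  apply: le_trans (lerD (HS _ (aM i) n) (HS _ bM n)); rewrite -big_split /=.
  by apply: ler_sum => k _; exact: ler_normcB.
have cv i : cvgn (fun n => \sum_(k <- zs n) normc (a i k - b k)).
  by apply: nondecreasing_is_cvgn; [exact: mono|exists (S + S) => _ [n _ <-]].
split=> [i x|].
  apply: hsum_dist; [exact: h1le_ell1 (aM i)|exact: h1le_ell1 bM|].
  by move=> n; apply: nondecreasing_cvgn_le; [exact: mono|exact: cv].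
apply/cvgr0Pnorm_le => e e0.
have e2 : 0 < e / 2 by rewrite divr_gt0.
have [J HJ] := h1_tail (2 * M + 2 * M) e2.
have tail i n : \sum_(k <- zs n) normc (a i k - b k) <=
    \sum_(k <- zs J) normc (a i k - b k) + e / 2.
  apply: (HJ (fun k => a i k - b k)).
  apply: (@le_trans _ _ (\sum_(k <- zs n) (2 * (k%:~R ^+ 2 * normc (a i k) ^+ 2) +
      2 * (k%:~R ^+ 2 * normc (b k) ^+ 2)))).
    apply: ler_sum => k _; rewrite [leRHS](_ : _ = k%:~R ^+ 2 *
      (2 * normc (a i k) ^+ 2 + 2 * normc (b k) ^+ 2)); last by ring.
    by rewrite ler_wpM2l ?sqr_ge0//; apply: le_trans (normcD2 _ _) _; rewrite normcN.
  by rewrite big_split /= -!mulr_sumr lerD// ler_pM2l// h1le_kinetic.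
have c0 : \sum_(k <- zs J) normc (a i k - b k) @[i --> F] --> 0.
  rewrite -[X in _ --> X](_ : \sum_(k <- zs J) 0 = 0); last by rewrite big1.
  by apply: (@cvg_sum_seq R _ _ F FF (zs J) (fun k i => normc (a i k - b k))).
move/cvgr0Pnorm_le: c0 => /(_ _ e2); apply: filterS => i.
move=> /(le_trans (ler_norm _)) hi.
have d0 : 0 <= ell1_dist (a i) b.
  by apply: limr_ge (cv i) _; apply: nearW => n; apply: sumr_ge0 => k _; exact: normc_ge0.
rewrite ger0_norm//; apply: limr_le (cv i) _; apply: nearW => n.
by apply: le_trans (tail i n) _; rewrite [leRHS]splitr lerD2r.
Qed.

Lemma dx_hsum M a : h1le M a ->
  [/\ L2 (dx (hsum a)), forall k, fourier (dx (hsum a)) k = dseq a k &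
      msq (dx (hsum a)) <= M].
Proof.
move=> aM; have la := h1le_ell1 aM.
have [|L E] := @fmultP R (fun k => 0 +i* k%:~R) (hsum a) M.
  by move=> n; under eq_bigr do rewrite fourier_hsum//; exact: h1le_dseq.
have E' k : fourier (dx (hsum a)) k = dseq a k by rewrite /dx E fourier_hsum.
split=> //; apply: parseval_le => // n; under eq_bigr do rewrite E'.
exact: h1le_dseq.
Qed.

Lemma tmeas_powR f (s : R) : tmeas f -> tmeas (fun x => (normc (f x) `^ s)%:C).
Proof.
move=> mf; apply: tmeas_real; apply: (measurableT_comp (measurable_powR s)).
exact: measurable_normc.
Qed.

Lemma L2_nonlinearity sigma M a : 1 <= sigma -> h1le M a -> L2 (nonlinearity sigma (hsum a)).
Proof.
move=> s1 aM; have [L _ _] := dx_hsum aM; have la := h1le_ell1 aM.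
have [S S0 HS] := h1le_sup M.
apply: (@L2Mbdd _ _ _ (S `^ (2 * sigma))) => //; first exact: tmeas_powR (tmeas_hsum la).
move=> x _; rewrite normc_real ger0_norm ?powR_ge0//.
have s0 : 0 <= 2 * sigma by lra.
by rewrite ge0_ler_powR// ?nnegrE ?normc_ge0//; apply: normc_hsum; exact: HS.
Qed.

(* With phi = |u|^(2 sigma), w = u_x and eps = 0 this is the continuity of the
   nonlinearity; the general form allows for its polynomial approximation. *)
Lemma nonlinearity_weak_cvg (I : Type) (F : set_system I) {FF : Filter F}
    sigma M (a : I -> int -> R[i]) b (phi w : I -> R -> R[i]) (eps : I -> R) :
  1 <= sigma -> (forall i, h1le M (a i)) -> h1le M b ->
  (forall k, normc (a i k - b k) @[i --> F] --> 0) ->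
  (forall i, L2 (w i)) -> (forall i, msq (w i) <= M) ->
  (forall i k, fourier (w i) k = dseq (a i) k) ->
  (forall i, tmeas (phi i)) ->
  (forall i x, normc (phi i x - (normc (hsum (a i) x) `^ (2 * sigma))%:C) <= eps i) ->
  eps @ F --> 0 ->
  forall k, normc (fourier (fun x => phi i x * w i x) k -
                   fourier (nonlinearity sigma (hsum b)) k) @[i --> F] --> 0.
Proof.
move=> s1 aM bM ab Lw wM wa mphi phia eps0 k.
have [dd d0] := ell1_dist_cvg aM bM ab.
have [S S0 HS] := h1le_sup M.
have [L0 hL0] := @powR_lipschitz R (2 * sigma) S ltac:(lra).
have [Lb fb bb] := dx_hsum bM.
have W := @weak_product_cvg R I F FF w phi (dx (hsum b)) (fun x => (normc (hsum b x) `^ (2 * sigma))%:C)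
  (fun i => eps i + `|L0| * ell1_dist (a i) b) M (S `^ (2 * sigma)) Lw wM Lb.
rewrite /nonlinearity; apply: W mphi _ _ _ _ _.
- move=> j.
  have -> : (fun i => normc (fourier (w i) j - fourier (dx (hsum b)) j)) =
      (fun i => normc (dmul j) * normc (a i j - b j)).
    by apply/funext => i; rewrite fb wa /dseq -mulrBr normcM.
  have := cvgM (cvg_cst (normc (dmul j))) (ab j); rewrite mulr0; exact.
- exact: tmeas_powR (tmeas_hsum (h1le_ell1 bM)).
- move=> x _; rewrite normc_real ger0_norm ?powR_ge0//.
  have s0 : 0 <= 2 * sigma by lra.
  by rewrite ge0_ler_powR// ?nnegrE ?normc_ge0//; apply: normc_hsum; exact: HS.
- move=> i x _; rewrite -(subrK (normc (hsum (a i) x) `^ (2 * sigma))%:C (phi i x)) -addrA.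
  apply: normcD_le => //; rewrite -rmorphB normc_real.
  apply: le_trans (hL0 _ _ _ _) _.
  + by rewrite normc_ge0 normc_hsum// => n; exact: HS.
  + by rewrite normc_ge0 normc_hsum// => n; exact: HS.
  apply: le_trans (ler_wpM2r (normr_ge0 _) (ler_norm L0)) _; rewrite ler_wpM2l//.
  exact: le_trans (ler_dist_normc _ _) (dd i x).
- rewrite -[X in _ --> X](_ : 0 + `|L0| * 0 = 0); last by rewrite mulr0 addr0.
  by apply: cvgD => //; apply: cvgM => //; exact: cvg_cst.
Qed.

End NonlinearLimits.

(** * Integrals of step functions and Riemann sums *)

Section StepIntegrals.
Context {R : realType}.
Local Notation mu := (@lebesgue_measure R).
Implicit Types (D : set R) (s t h : R).

Lemma Rintegral_sum_indic (I : Type) (r : seq I) (A : I -> set R) (c : I -> R) D :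
  measurable D -> (mu D < +oo)%E -> (forall j, measurable (A j)) ->
  mu.-integrable D (EFin \o (fun s => \sum_(j <- r) c j * \1_(A j) s)) /\
  \int[mu]_(s in D) (\sum_(j <- r) c j * \1_(A j) s) =
    \sum_(j <- r) c j * fine (mu (A j `&` D)).
Proof.
move=> mD fD mA; elim: r => [|j r [IH1 IH2]].
  under eq_fun do rewrite big_nil; rewrite big_nil; split.
    exact: (@integrable0 _ _ _ mu D).
  by rewrite Rintegral_cst// mul0r.
have iA : mu.-integrable D (EFin \o (\1_(A j) : R -> R)).
  apply: measurable_bounded_integrable => //.
    by apply: (@measurable_indic _ _ R D (A j)).
  exists 1; split => [|M /ltW M1 x _] /=; rewrite ?num_real// indicE.
  by apply: le_trans _ M1; case: (_ \in _); rewrite ?normr1 ?normr0.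
have iA' : mu.-integrable D (EFin \o (fun s => c j * \1_(A j) s)).
  by have := @integrableZl _ _ _ mu D mD (c j) _ iA.
under eq_fun do rewrite big_cons; rewrite big_cons; split.
  exact: (@integrableD _ _ _ mu D mD _ _ iA' IH1).
rewrite (@RintegralD _ _ _ mu D _ _ mD iA' IH1) IH2; congr (_ + _).
rewrite (@RintegralZl _ _ _ mu D _ _ mD iA); congr (_ * _).
by rewrite /Rintegral integral_indic//; exact: mA.
Qed.

Definition step_set h (j : nat) : set R := [set` `[j%:R * h, j.+1%:R * h[].

Lemma step_setE h (j : nat) s : 0 < h -> 0 <= s ->
  \1_(step_set h j) s = (j == Num.truncn (s / h))%:R :> R.
Proof.
move=> h0 s0; rewrite indicE /step_set eq_sym truncn_eq ?divr_ge0 ?(ltW h0)//.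
rewrite ler_pdivlMr// ltr_pdivrMr//; congr (nat_of_bool _)%:R.
by rewrite mem_setE in_itv.
Qed.

Lemma sum_step_set h (m : nat) (c : nat -> R) s : 0 < h -> 0 <= s ->
  \sum_(j <- iota 0 m) c j * \1_(step_set h j) s =
  if (Num.truncn (s / h) < m)%N then c (Num.truncn (s / h)) else 0.
Proof.
move=> h0 s0; under eq_bigr do rewrite step_setE//.
case: ifPn => im.
  rewrite (bigD1_seq (Num.truncn (s / h))) ?iota_uniq ?mem_iota//= eqxx mulr1 big1 ?addr0//.
  by move=> j /negbTE ->; rewrite mulr0.
rewrite big_seq big1// => j; rewrite mem_iota add0n => /andP[_ jm].
by case: eqP => [jE|]; rewrite ?mulr0//; rewrite -jE jm in im.
Qed.

Lemma mu_step_set h (j : nat) t : 0 < h -> j.+1%:R * h <= t ->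
  fine (mu (step_set h j `&` [set` `[0, t[])) = h.
Proof.
move=> h0 jt.
have -> : step_set h j `&` [set` `[0, t[] = [set` `[j%:R * h, j.+1%:R * h[].
  rewrite setIidl// => s; rewrite /step_set /= !in_itv /= => /andP[s1 s2].
  by rewrite (lt_le_trans s2 jt) andbT (le_trans _ s1)// mulr_ge0// ltW.
rewrite lebesgue_measure_itv /= lte_fin ltr_pM2r// ltr_nat ltnSn /=.
by rewrite -mulrBl -natrB// subSnn mul1r.
Qed.

(** The sum is the integral over [0, t[ of the step function F n, which is bounded and converges
    pointwise to g. Dominated convergence concludes, with no regularity of g in advance. *)
Lemma riemann_sum_cvg t (B : R) (h : nat -> R) (C : nat -> nat -> R) (g : R -> R) :
  0 <= t -> (forall n, 0 < h n) ->
  h @ \oo --> 0 -> (forall n l, l.+1%:R * h n <= t -> `|C n l| <= B) ->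
  (forall s, 0 <= s < t -> C n (Num.truncn (s / h n)) @[n --> \oo] --> g s) ->
  h n * \sum_(l <- iota 0 (Num.truncn (t / h n))) C n l @[n --> \oo] -->
    \int[mu]_(s in [set` `[0, t]]) g s.
Proof.
move=> t0 h0 hc CB Cg; pose m n := Num.truncn (t / h n).
have mlt n l : (l < m n)%N -> l.+1%:R * h n <= t.
  move=> lm; rewrite -ler_pdivlMr// (@le_trans _ _ (m n)%:R)// ?ler_nat//.
  by rewrite /m truncn_le divr_ge0// ltW.
pose F n s := \sum_(j <- iota 0 (m n)) C n j * \1_(step_set (h n) j) s.
have fD : (mu [set` `[0%R, t[] < +oo)%E.
  by rewrite lebesgue_measure_itv /=; case: ifP => _; rewrite ?ltry// -EFinB ltry.
have mA n j : measurable (step_set (h n) j) by exact: measurable_itv.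
have mD : measurable [set` `[(0:R), t[] by exact: measurable_itv.
have S n := @Rintegral_sum_indic _ (iota 0 (m n)) (step_set (h n)) (C n) _ mD fD (mA n).
have icst : mu.-integrable [set` `[0%R, t[] (EFin \o (fun=> `|B|)).
  apply: measurable_bounded_integrable => //.
  by exists `|B|; split => [|M /ltW BM x _] /=; rewrite ?num_real ?normr_id.
have [||||ig cv] := @Rintegral_dominated_cvg R [set` `[0, t[] F g (fun=> `|B|) mD.
- by move=> n; have [/measurable_int/measurable_EFinP] := S n.
- move=> s; rewrite /= in_itv/= => /andP[s0 st].
  apply: cvg_trans (Cg s _); last by rewrite s0.
  apply: near_eq_cvg; have st0 : 0 < t - s by rewrite subr_gt0.
  (* F n vanishes on the incomplete cell before t; as soon as h n < t - s, the point s lies in a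
     complete one. *)
  move/cvgr0Pnorm_lt: hc => /(_ _ st0); apply: filterS => n /(le_lt_trans (ler_norm _)) hn.
  rewrite /F sum_step_set//; case: ifPn => //; rewrite -leqNgt => mi.
  have : t / h n < (m n).+1%:R by rewrite /m; have /andP[] := truncn_itv (divr_ge0 t0 (ltW (h0 n))).
  rewrite ltr_pdivrMr// => h1.
  have : (m n)%:R * h n <= s.
    rewrite -ler_pdivlMr//; apply: (@le_trans _ _ (Num.truncn (s / h n))%:R); first by rewrite ler_nat.
    by rewrite truncn_le divr_ge0// ltW.
  by move: h1; rewrite -natr1 mulrDl mul1r; lra.
- exact: icst.
- move=> n s; rewrite /= in_itv/= => /andP[s0 st]; rewrite /F sum_step_set//.
  case: ifPn => [/mlt lm|_]; last by rewrite normr0.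
  by apply: le_trans (CB _ _ lm) _; exact: ler_norm.
rewrite -Rintegral_itv_bndo_bndc//.
apply: cvg_trans cv; apply: near_eq_cvg; apply: nearW => n.
rewrite /F (S n).2 mulr_sumr big_seq [RHS]big_seq; apply: eq_bigr => j.
rewrite mem_iota add0n => /andP[_ jm]; have E := mu_step_set (h0 n) (mlt _ _ jm).
by rewrite [RHS]mulrC; congr (_ * _); exact E.
Qed.

End StepIntegrals.

(** * Limit of the Galerkin approximations *)

Section GalerkinLimit.
Context {R : realType}.
Local Notation mu := (@lebesgue_measure R).
Variables (alpha : int -> R[i]) (sigma T K M Q : R).
Hypotheses (sigma1 : 1 <= sigma) (T0 : 0 < T) (K0 : 0 <= K) (Q0 : 0 <= Q).
Variable X : forall N, galerkin_approx alpha sigma T K M Q N.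
Implicit Types (s t : R) (N : nat) (k : int).

Let h N := T / (apx_m (X N))%:R.

Let m0 N : 0 < (apx_m (X N))%:R :> R.
Proof. by rewrite ltr0n apx_m_gt0. Qed.

Let h0 N : 0 < h N. Proof. by rewrite divr_gt0. Qed.

Let h_cvg : h @ \oo --> 0.
Proof.
apply/cvgr0Pnorm_le => e e0; near=> N; rewrite (ger0_norm (ltW (h0 N))).
apply: le_trans (apx_h (X N)) _; near: N.
by have := near_infty_natSinv_lt (PosNum e0); apply: filterS => n /ltW.
Unshelve. all: by end_near. Qed.

(* Evaluating at clamp t extends functions on [0, T] to R, with the same Lipschitz
   constants. *)
Definition clamp t := Num.max 0 (Num.min t T).

Lemma clamp_itv t : 0 <= clamp t <= T.
Proof. by rewrite /clamp le_max lexx /= ge_max (ltW T0) ge_min lexx orbT. Qed.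

Lemma clamp_id t : 0 <= t <= T -> clamp t = t.
Proof. by move=> /andP[t0 tT]; rewrite /clamp min_l// max_r. Qed.

Lemma clamp_lip s t : `|clamp t - clamp s| <= `|t - s|.
Proof.
have lmin (x y : R) : `|Num.min x T - Num.min y T| <= `|x - y|.
  have := ler_norm (x - y); have := ler_norm (y - x); rewrite (distrC y x) => h1 h2.
  by case: (leP x T) => ?; case: (leP y T) => ?; rewrite ler_norml; apply/andP; split; lra.
have lmax (x y : R) : `|Num.max 0 x - Num.max 0 y| <= `|x - y|.
  have := ler_norm (x - y); have := ler_norm (y - x); rewrite (distrC y x) => h1 h2.
  by case: (leP 0 x) => ?; case: (leP 0 y) => ?; rewrite ler_norml; apply/andP; split; lra.
exact: le_trans (lmax _ _) (lmin _ _).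
Qed.

Let idx N t := Num.truncn (clamp t / h N).

Lemma idx_le N t : (idx N t <= apx_m (X N))%N.
Proof.
have /andP[t0 tT] := clamp_itv t.
rewrite -(ler_nat R); apply: (@le_trans _ _ (clamp t / h N)).
  by rewrite truncn_le divr_ge0// ltW.
by rewrite ler_pdivrMr// /h mulrCA divff ?gt_eqF// mulr1.
Qed.

Lemma idx_close N t : `|clamp t - (idx N t)%:R * h N| <= h N.
Proof.
have /andP[t0 tT] := clamp_itv t.
have /andP[] := truncn_itv (divr_ge0 t0 (ltW (h0 N))).
rewrite ler_pdivlMr// ltr_pdivrMr// -/(idx N t) -natr1 mulrDl mul1r => h1 h2.
by rewrite ger0_norm ?subr_ge0//; lra.
Qed.

Let A N t : int -> R[i] := apx_a (X N) (idx N t).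

Lemma galerkin_h1le N t : h1le M (A N t).
Proof. by move=> n; apply: apx_h1; exact: idx_le. Qed.

Let c k : R := (k%:~R ^+ 2 + Q) * Num.sqrt M.

Let c0 k : 0 <= c k.
Proof. by rewrite mulr_ge0 ?sqrtr_ge0// addr_ge0// sqr_ge0. Qed.

(** The extra [h N] pays for rounding both times down to the grid. *)
Lemma galerkin_lip N s t k : normc (A N t k - A N s k) <= (`|clamp t - clamp s| + h N) * c k.
Proof.
wlog st : s t / clamp s <= clamp t.
  move=> W; have [/W//|/ltW/W] := leP (clamp s) (clamp t).
  by rewrite normcB distrC.
have /andP[s0 _] := clamp_itv s.
have ij : (idx N s <= idx N t)%N.
  rewrite truncn_ge_nat; last by rewrite divr_ge0 ?(le_trans s0 st)// ltW.
  apply: (@le_trans _ _ (clamp s / h N)); first by rewrite truncn_le divr_ge0// ltW.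
  by rewrite ler_wpM2r// invr_ge0 ltW.
apply: le_trans (apx_lip k ij (idx_le N t)) _.
rewrite -/(h N) -/(c k) mulrA; apply: ler_wpM2r; first exact: c0.
rewrite natrB// mulrBl ger0_norm ?subr_ge0//.
have /andP[a1 a2] := truncn_itv (divr_ge0 s0 (ltW (h0 N))).
have /andP[b1 b2] := truncn_itv (divr_ge0 (le_trans s0 st) (ltW (h0 N))).
move: a1 a2 b1 b2; rewrite -/(idx N s) -/(idx N t) !ler_pdivlMr// !ltr_pdivrMr//.
by rewrite -!natr1 !mulrDl !mul1r; lra.
Qed.

Lemma galerkin_normc N t k : normc (A N t k) <= Num.sqrt M.
Proof. exact: h1le_normc (galerkin_h1le N t). Qed.

Lemma galerkin_subsequence : exists (phi : nat -> nat) (a : R -> int -> R[i]),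
  (forall n, (n <= phi n)%N) /\
  forall t k, normc (A (phi n) t k - a t k) @[n --> \oo] --> 0.
Proof.
have [|i t n|i|||phi [l [phin hl]]] := @equicontinuous_subsequence R (int * bool)%type T
  (fun kb t n => if kb.2 then cRe (A n t kb.1) else cIm (A n t kb.1))
  (fun=> Num.sqrt M) (fun kb => c kb.1) h.
- exact: T0.
- by case: ifP => _; apply: le_trans (galerkin_normc n t i.1); [exact: ler_Re|exact: ler_Im].
- exact: c0.
- exact: h_cvg.
- move=> i s t n sT tT; have := galerkin_lip n s t i.1; rewrite !clamp_id//.
  apply: le_trans; case: ifP => _.
  + by rewrite -cReN -cReD; exact: ler_Re.
  + by rewrite -cImN -cImD; exact: ler_Im.
exists phi, (fun t k => l (k, true) (clamp t) +i* l (k, false) (clamp t)); split=> // t k.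
have AE n : A n t = A n (clamp t) by rewrite /A /idx (clamp_id (clamp_itv t)).
apply/cvgr0Pnorm_le => e e0; have e2 : 0 < e / 2 by rewrite divr_gt0.
have h1 := hl (k, true) _ (clamp_itv t); have h2 := hl (k, false) _ (clamp_itv t).
have H1 : \forall n \near \oo, `|l (k, true) (clamp t) - cRe (A (phi n) (clamp t) k)| <= e / 2.
  by apply: cvgr_dist_le => //; exact: h1.
have H2 : \forall n \near \oo, `|l (k, false) (clamp t) - cIm (A (phi n) (clamp t) k)| <= e / 2.
  by apply: cvgr_dist_le => //; exact: h2.
apply: filterS2 H1 H2 => n H1 H2; rewrite AE ger0_norm ?normc_ge0//.
rewrite (le_trans (ler_ReIm _))// cReD cImD cReN cImN /= (splitr e) lerD//.
- by rewrite distrC.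
- by rewrite distrC.
Qed.

Section Subsequence.
Variables (phi : nat -> nat) (a : R -> int -> R[i]).
Hypothesis phin : forall n, (n <= phi n)%N.
Hypothesis Aa : forall t k, normc (A (phi n) t k - a t k) @[n --> \oo] --> 0.

Lemma subsequence_cvg0 (u : nat -> R) : u @ \oo --> 0 -> u (phi n) @[n --> \oo] --> 0.
Proof.
move=> u0; apply/cvgr0Pnorm_le => e e0; move/cvgr0Pnorm_le: u0 => /(_ e e0)[N _ HN].
by exists N => // n Nn; apply: HN; exact: leq_trans (phin n).
Qed.

Lemma limit_lip s t k : normc (a t k - a s k) <= `|t - s| * c k.
Proof.
have cv : normc (A (phi n) t k - a t k) + normc (A (phi n) s k - a s k) +
   (`|t - s| + h (phi n)) * c k @[n --> \oo] --> 0 + 0 + (`|t - s| + 0) * c k.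
  apply: cvgD; first by apply: cvgD; exact: Aa.
  apply: cvgM; last exact: cvg_cst.
  by apply: cvgD; [exact: cvg_cst|exact: subsequence_cvg0].
have -> : `|t - s| * c k = limn (fun n => normc (A (phi n) t k - a t k) +
    normc (A (phi n) s k - a s k) + (`|t - s| + h (phi n)) * c k).
  by rewrite (cvg_lim (@Rhausdorff R) cv) !addr0 add0r.
apply: limr_ge; first by apply/cvg_ex; eexists; exact: cv.
apply: nearW => n.
have -> : a t k - a s k = - (A (phi n) t k - a t k) + (A (phi n) s k - a s k) +
   (A (phi n) t k - A (phi n) s k) by ring.
apply: normcD_le; first by apply: normcD_le; rewrite ?normcN.
apply: le_trans (galerkin_lip _ _ _ _) _; apply: ler_wpM2r; first exact: c0.
by rewrite lerD2r clamp_lip.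
Qed.

Lemma limit_normc_cvg t k : normc (A (phi n) t k) @[n --> \oo] --> normc (a t k).
Proof.
apply/cvgrPdist_le => e e0; move/cvgr0Pnorm_le: (Aa t k) => /(_ e e0).
apply: filterS => n; rewrite ger0_norm ?normc_ge0// distrC.
exact: le_trans (ler_dist_normc _ _).
Qed.

Lemma limit_h1le t : h1le M (a t).
Proof.
move=> n.
have cv : \sum_(k <- zs n) (1 + k%:~R ^+ 2) * normc (A (phi i) t k) ^+ 2 @[i --> \oo] -->
    \sum_(k <- zs n) (1 + k%:~R ^+ 2) * normc (a t k) ^+ 2.
  apply: (@cvg_sum_seq R _ _ _ _ (zs n) (fun k i => (1 + k%:~R ^+ 2) * normc (A (phi i) t k) ^+ 2)) => k.
  apply: cvgM; first exact: cvg_cst.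
  by rewrite expr2; under eq_fun do rewrite expr2; apply: cvgM; exact: limit_normc_cvg.
rewrite -(cvg_lim (@Rhausdorff R) cv); apply: limr_le.
  by apply/cvg_ex; eexists; exact: cv.
by apply: nearW => i; exact: galerkin_h1le.
Qed.

Lemma limit_init k : a 0 k = alpha k.
Proof.
apply/eqP; rewrite -subr_eq0; apply/eqP; apply: eq0_normc.
have cv := Aa 0 k.
have : normc (A (phi n) 0 k - a 0 k) @[n --> \oo] --> normc (alpha k - a 0 k).
  apply: cvg_near_cst; near=> n; rewrite /A /idx clamp_id ?lexx ?ltW// mul0r truncn0 apx_init.
  rewrite ifT//; apply: leq_trans (phin n); near: n; exact: nbhs_infty_ge.
have L := cvg_lim (@Rhausdorff R) cv.
by move=> /(cvg_lim (@Rhausdorff R)); rewrite L normcB.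
Unshelve. all: by end_near. Qed.

Lemma galerkin_trunc N t : A N t = trunc N (A N t).
Proof.
apply/funext => k; rewrite /trunc; case: ifPn => // kN; rewrite /A.
by case: (idx N t) => [|j]; rewrite ?apx_init ?apx_step (negbTE kN).
Qed.

Lemma tmeas_horner (q : {poly R}) f : tmeas f -> tmeas (fun x => (q.[normc (f x) ^+ 2])%:C).
Proof.
move=> mf; apply: tmeas_real; apply: (@measurableT_comp _ _ _ _ _ _ (fun x => q.[x])).
  apply: continuous_measurable_fun; exact: continuous_horner.
exact: measurable_normc2.
Qed.

Let G N s k := fourier (nlin (apx_q (X N)) N (A N s)) k.
Let NL s k := fourier (nonlinearity sigma (hsum (a s))) k.

Lemma galerkin_nonlinearity_cvg s k : normc (G (phi n) s k - NL s k) @[n --> \oo] --> 0.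
Proof.
have hsumA N : hsum (A N s) = trig N (A N s) by rewrite {1}galerkin_trunc hsum_trunc.
apply: (@nonlinearity_weak_cvg R nat _ _ sigma M (fun n => A (phi n) s) (a s)
  (fun n x => ((apx_q (X (phi n))).[normc (trig (phi n) (A (phi n) s) x) ^+ 2])%:C)
  (fun n => trig (phi n) (dseq (A (phi n) s))) (fun n => (phi n).+1%:R^-1)).
- exact: sigma1.
- by move=> n; exact: galerkin_h1le.
- exact: limit_h1le.
- exact: Aa.
- by move=> n; exact: L2_trig.
- by move=> n; rewrite msq_dseq; exact: h1le_kinetic (galerkin_h1le (phi n) s).
- move=> n j; rewrite fourier_trig; case: ifPn => // jn.
  by rewrite galerkin_trunc /dseq /trunc (negbTE jn) mulr0.
- by move=> n; apply: tmeas_horner; have [] := L2_trig (phi n) (A (phi n) s).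
- move=> n x; rewrite hsumA -rmorphB normc_real.
  set z := normc _; have z0 : 0 <= z by exact: normc_ge0.
  have zK : z <= K by apply: apx_sup; exact: idx_le.
  rewrite powRrM powR_mulrn//; apply: apx_close; rewrite sqr_ge0 /=.
  by rewrite ler_sqr ?nnegrE.
- apply: (@subsequence_cvg0 (fun N => N.+1%:R^-1)); apply/cvgr0Pnorm_le => e e0; near=> N.
  rewrite ger0_norm ?invr_ge0//; near: N.
  by have := near_infty_natSinv_lt (PosNum e0); apply: filterS => n /ltW.
Unshelve. all: by end_near. Qed.

(** An exact identity: the scheme treats the linear part exactly, so after multiplication by the
    inverse phase each step is a plain increment. *)
Lemma discrete_duhamel N (j : nat) k : (`|k| <= N)%N ->
  expi (k%:~R ^+ 2 * (j%:R * h N)) * apx_a (X N) j k = alpha k -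
  (h N)%:C * \sum_(0 <= l < j) expi (k%:~R ^+ 2 * (l%:R * h N)) *
     fourier (nlin (apx_q (X N)) N (apx_a (X N) l)) k.
Proof.
move=> kN; elim: j => [|j IH].
  by rewrite big_geq// mulr0 subr0 mul0r mulr0 expi0 mul1r apx_init kN.
rewrite big_nat_recr//= mulrDr opprD addrA -IH apx_step kN /lawson -/(h N).
rewrite -natr1 mulrDl mul1r mulrDr expiD -mulrA (expiNK (k%:~R ^+ 2 * h N)).
by ring.
Qed.

Lemma cvg_normc_Re (z : nat -> R[i]) w : normc (z n - w) @[n --> \oo] --> 0 ->
  cRe (z n) @[n --> \oo] --> cRe w /\ cIm (z n) @[n --> \oo] --> cIm w.
Proof.
move=> zw; split; apply/cvgrPdist_le => e e0; move/cvgr0Pnorm_le: zw => /(_ e e0);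
  apply: filterS => n; rewrite ger0_norm ?normc_ge0// distrC; apply: le_trans.
- by rewrite -cReN -cReD; exact: ler_Re.
- by rewrite -cImN -cImD; exact: ler_Im.
Qed.

Lemma normc_expiB x y : normc (expi x - expi y) <= `|x - y| :> R.
Proof.
have -> : expi x - expi y = expi y * (expi (x - y) - 1).
  by rewrite mulrBr mulr1 -expiD (addrC y) subrK.
by rewrite normcM normc_expi mul1r normc_expiB1.
Qed.

Lemma phase_cvg (z : nat -> R[i]) w B s k : (forall n, normc (z n) <= B) ->
  0 <= s <= T -> normc (z n - w) @[n --> \oo] --> 0 ->
  normc (expi (k%:~R ^+ 2 * ((idx (phi n) s)%:R * h (phi n))) * z n -
         expi (k%:~R ^+ 2 * s) * w) @[n --> \oo] --> 0.
Proof.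
move=> zB sT zw.
have cv : k%:~R ^+ 2 * h (phi n) * B + normc (z n - w) @[n --> \oo] --> (0 : R).
  rewrite -[X in _ --> X](_ : k%:~R ^+ 2 * 0 * B + 0 = 0); last by rewrite mulr0 mul0r addr0.
  apply: cvgD => //; apply: cvgM; last exact: cvg_cst.
  by apply: cvgM; [exact: cvg_cst|exact: subsequence_cvg0].
apply/cvgr0Pnorm_le => e e0; move/cvgr0Pnorm_le: cv => /(_ e e0); apply: filterS => n.
move=> /(le_trans (ler_norm _)); apply: le_trans; rewrite ger0_norm ?normc_ge0//.
set u := expi _; set v := expi _.
have -> : u * z n - v * w = (u - v) * z n + v * (z n - w) by ring.
apply: normcD_le; last by rewrite normcM normc_expi mul1r.
apply: normcM_le => //; apply: le_trans (normc_expiB _ _) _.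
rewrite -mulrBr normrM ger0_norm ?sqr_ge0//; apply: ler_wpM2l; first exact: sqr_ge0.
by rewrite distrC -{1}(clamp_id sT); exact: idx_close.
Qed.

(** Limit of [discrete_duhamel], whose sum is a left Riemann sum with bounded terms converging at
    each time s < t. *)
Lemma limit_duhamel t k : 0 <= t <= T -> expi (k%:~R ^+ 2 * t) * a t k = alpha k -
  cintegral [set` `[0, t]] (fun s => expi (k%:~R ^+ 2 * s) * NL s k).
Proof.
move=> tT; have /andP[t0 tT'] := tT.
pose C n l := expi (k%:~R ^+ 2 * (l%:R * h (phi n))) *
   fourier (nlin (apx_q (X (phi n))) (phi n) (apx_a (X (phi n)) l)) k.
have CB n (l : nat) : l.+1%:R * h (phi n) <= t -> normc (C n l) <= Q * Num.sqrt M.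
  move=> lt; rewrite /C normcM normc_expi mul1r; apply: apx_nl.
  rewrite -(ler_nat R) -(ler_pM2r (h0 (phi n))); apply: (@le_trans _ _ t).
    by apply: le_trans lt; rewrite ler_pM2r// ler_nat.
  by rewrite /h mulrCA divff ?gt_eqF// mulr1.
have idxE n s : 0 <= s < t -> Num.truncn (s / h (phi n)) = idx (phi n) s.
  by move=> /andP[s0 st]; rewrite /idx clamp_id// s0 (le_trans (ltW st)).
have Cc s : 0 <= s < t ->
    normc (C n (Num.truncn (s / h (phi n))) - expi (k%:~R ^+ 2 * s) * NL s k) @[n --> \oo] --> 0.
  move=> st; have sT : 0 <= s <= T.
    by move/andP: st => [-> st]; rewrite (le_trans (ltW st)).
  have cv := phase_cvg k (B := Q * Num.sqrt M) _ sT (galerkin_nonlinearity_cvg s k).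
  under eq_fun do rewrite idxE//; apply: cv => n; apply: apx_nl; exact: idx_le.
have hphi := subsequence_cvg0 h_cvg.
(* P stands for [cRe] and [cIm], so that a single real argument serves both. *)
have key (P : R[i] -> R) : {morph P : x y / x + y} -> P 0 = 0 -> {morph P : x / - x} ->
    (forall r z, P (r%:C * z) = r * P z) -> (forall z, `|P z| <= normc z) ->
    (forall (z : nat -> R[i]) w, normc (z n - w) @[n --> \oo] --> 0 ->
       P (z n) @[n --> \oo] --> P w) ->
    P (expi (k%:~R ^+ 2 * t) * a t k) = P (alpha k) -
      \int[mu]_(s in [set` `[0, t]]) P (expi (k%:~R ^+ 2 * s) * NL s k).
  move=> PD P0 PN PZ Ple Pcv.
  have c1 := Pcv _ _ (phase_cvg k (fun n => galerkin_normc (phi n) t k) tT (Aa t k)).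
  have c2 := @riemann_sum_cvg R t (Q * Num.sqrt M) (fun n => h (phi n)) (fun n l => P (C n l))
    (fun s => P (expi (k%:~R ^+ 2 * s) * NL s k)) t0 (fun n => h0 (phi n)) hphi
    (fun n l lt => le_trans (Ple _) (CB n l lt)) (fun s st => Pcv _ _ (Cc s st)).
  have /(_ _ _)c3 := cvgB (cvg_cst (P (alpha k))) c2.
  rewrite -(cvg_lim (@Rhausdorff R) c3); apply/esym/(cvg_lim (@Rhausdorff R)).
  apply: cvg_trans c1; apply: near_eq_cvg; near=> n.
  have kn : (`|k| <= phi n)%N by apply: leq_trans (phin n); near: n; exact: nbhs_infty_ge.
  rewrite /A discrete_duhamel// PD PN PZ (big_morph P PD P0) /index_iota subn0 /=.
  by rewrite /idx (clamp_id tT).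
apply: complexP.
- rewrite cReD cReN; apply: key cReD erefl cReN cReZ (@ler_Re R) _.
  by move=> z w /cvg_normc_Re[].
- rewrite cImD cImN; apply: key cImD erefl cImN cImZ (@ler_Im R) _.
  by move=> z w /cvg_normc_Re[].
Unshelve. all: by end_near. Qed.

End Subsequence.

End GalerkinLimit.

Lemma limit_solution (R : realType) (alpha : int -> R[i]) (sigma H0 : R) :
  1 <= sigma -> h1le H0 alpha ->
  exists (T M : R) (c : int -> R) (a : R -> int -> R[i]),
  [/\ 0 < T, forall t, h1le M (a t),
      forall s t k, normc (a t k - a s k) <= `|t - s| * c k,
      forall k, a 0 k = alpha k &
      forall t k, 0 <= t <= T -> expi (k%:~R ^+ 2 * t) * a t k = alpha k -
        cintegral [set` `[0, t]] (fun s => expi (k%:~R ^+ 2 * s) *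
          fourier (nonlinearity sigma (hsum (a s))) k)].
Proof.
move=> s1 aH; have [T [K [M [Q [T0 K0 M0 Q0 HX]]]]] := galerkin s1 aH.
pose X N := projT1 (cid (HX N)).
have [phi [a [phin Aa]]] := galerkin_subsequence T0 Q0 X.
exists T, M, (fun k => (k%:~R ^+ 2 + Q) * Num.sqrt M), a; split=> //.
- move=> t; exact: (@limit_h1le R alpha sigma T K M Q T0 X phi a Aa t).
- move=> s t k; exact: (@limit_lip R alpha sigma T K M Q T0 Q0 X phi a phin Aa s t k).
- move=> k; exact: (@limit_init R alpha sigma T K M Q T0 X phi a phin Aa k).
- move=> t k tT.
  exact: (@limit_duhamel R alpha sigma T K M Q s1 T0 K0 X phi a phin Aa t k tT).
Qed.

(** * Bochner integrals *)

Section UniformContinuity.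
Context {R : realType}.
Implicit Types (s t : R) (k : int).

Lemma heine_cantor (g : R -> R[i]) (T e : R) :
  (forall t, normc (g s - g t) @[s --> t] --> 0) -> 0 < e ->
  exists2 d : R, 0 < d & forall s t, 0 <= s <= T -> 0 <= t <= T -> `|s - t| <= d ->
    normc (g s - g t) <= e.
Proof.
move=> gc e0; have [//|no] := pselect (exists2 d : R, 0 < d &
  forall s t, 0 <= s <= T -> 0 <= t <= T -> `|s - t| <= d -> normc (g s - g t) <= e).
exfalso.
have /choice[x hx] (n : nat) : exists st : R * R, [/\ 0 <= st.1 <= T, 0 <= st.2 <= T,
    `|st.1 - st.2| <= n.+1%:R^-1 & e < normc (g st.1 - g st.2)].
  have [//|bad] := pselect (exists st : R * R, [/\ 0 <= st.1 <= T, 0 <= st.2 <= T,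
    `|st.1 - st.2| <= n.+1%:R^-1 & e < normc (g st.1 - g st.2)]).
  exfalso; apply: no; exists n.+1%:R^-1; first by rewrite invr_gt0.
  move=> s t sT tT st; rewrite leNgt; apply/negP => lt.
  by apply: bad; exists (s, t).
have [phi [l [phin hl]]] := @diagonal_subsequence R unit (fun _ n => (x n).1) (fun=> T)
  (fun _ n => ltac:(by have [/andP[h1 h2] _ _ _] := hx n; rewrite ger0_norm)).
have e2 : 0 < e / 2 / 2 by rewrite !divr_gt0.
have /cvgr0Pnorm_le/(_ _ e2)/nbhs_ballP[d /= d0 Hd] := gc (l tt).
have d2 : 0 < d / 2 by rewrite divr_gt0.
have H1 : \forall n \near \oo, `|l tt - (x (phi n)).1| <= d / 2 / 2.
  by apply: cvgr_dist_le; [exact: hl|rewrite divr_gt0].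
have H2 : \forall n \near \oo, (n.+1%:R^-1 : R) < d / 2 / 2.
  by apply: (near_infty_natSinv_lt (PosNum (divr_gt0 d2 (ltr0Sn _ 1)))).
have [n [/= h1 h2]] := filter_ex (filterI H1 H2).
have [_ _ xy] := hx (phi n); apply/negP; rewrite -leNgt.
have h3 : `|(x (phi n)).1 - (x (phi n)).2| <= d / 2 / 2.
  apply: le_trans xy (le_trans _ (ltW h2)).
  by rewrite lef_pV2 ?posrE// ler_nat ltnS.
have b1 : normc (g (x (phi n)).1 - g (l tt)) <= e / 2.
  rewrite -[leLHS]ger0_norm ?normc_ge0//; apply: le_trans (Hd _ _) _.
    by rewrite /ball /=; lra.
  lra.
have b2 : normc (g (x (phi n)).2 - g (l tt)) <= e / 2.
  rewrite -[leLHS]ger0_norm ?normc_ge0//; apply: le_trans (Hd _ _) _; last by lra.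
  rewrite /ball /= -(subrK (x (phi n)).1 (l tt)) -addrA.
  by apply: le_lt_trans (ler_normD _ _) _; lra.
have -> : g (x (phi n)).1 - g (x (phi n)).2 =
  (g (x (phi n)).1 - g (l tt)) - (g (x (phi n)).2 - g (l tt)) by ring.
rewrite (splitr e); apply: normcD_le => //; by rewrite normcN.
Qed.

Lemma heine_cantor_seq (f : R -> int -> R[i]) (r : seq int) (T e : R) :
  (forall t k, normc (f s k - f t k) @[s --> t] --> 0) -> 0 < e ->
  exists2 d : R, 0 < d & forall s t k, k \in r -> 0 <= s <= T -> 0 <= t <= T ->
    `|s - t| <= d -> normc (f s k - f t k) <= e.
Proof.
move=> fc e0; elim: r => [|j r [d d0 Hd]]; first by exists 1.
have [d' d'0 Hd'] := @heine_cantor (fun s => f s j) T e (fun t => fc t j) e0.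
exists (Num.min d d'); first by rewrite lt_min d0.
move=> s t k; rewrite in_cons => /orP[/eqP->|kr] sT tT; rewrite le_min => /andP[h1 h2].
- exact: Hd'.
- exact: Hd.
Qed.

(** The tolerance is divided by the number 2 n + 1 of frequencies, so that the weighted sum of the
    errors is at most 1 / (n + 1). *)
Lemma uniform_grid (f : R -> int -> R[i]) (w : int -> R) (T : R) (n : nat) : 0 < T ->
  (forall k, 0 <= w k) ->
  (forall t k, normc (f s k - f t k) @[s --> t] --> 0) ->
  exists m : nat, [/\ (0 < m)%N, T / m%:R <= n.+1%:R^-1 & forall s t, 0 <= s <= T -> 0 <= t <= T ->
    `|s - t| <= T / m%:R -> forall k, (`|k| <= n)%N ->
    w k * normc (f s k - f t k) ^+ 2 <= n.+1%:R^-1 / n.*2.+1%:R].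
Proof.
move=> T0 w0 fc; pose W := \sum_(k <- zs n) w k + 1.
have W0 : 0 < W by rewrite ltr_wpDl// sumr_ge0.
pose tol : R := n.+1%:R^-1 / n.*2.+1%:R.
have tol0 : 0 < tol by rewrite divr_gt0 ?invr_gt0.
pose e := Num.sqrt (tol / W).
have e0 : 0 < e by rewrite sqrtr_gt0 divr_gt0.
have [d d0 Hd] := @heine_cantor_seq f (zs n) T e fc e0.
pose d' := Num.min d n.+1%:R^-1.
have d'0 : 0 < d' by rewrite lt_min d0 invr_gt0 ltr0Sn.
have Tm : T / (Num.truncn (T / d')).+1%:R <= d'.
  rewrite ler_pdivrMr ?ltr0Sn//; have := truncnS_gt (T / d').
  by rewrite ltr_pdivrMr// mulrC => /ltW.
have [md mn] : T / (Num.truncn (T / d')).+1%:R <= d /\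
    T / (Num.truncn (T / d')).+1%:R <= n.+1%:R^-1.
  by split; apply: le_trans Tm _; rewrite /d' ge_min lexx ?orbT.
exists (Num.truncn (T / d')).+1; split=> // s t sT tT st k kn.
have kW : w k <= W.
  rewrite /W (big_rem k) ?mem_zs//= -addrA lerDl addr_ge0// sumr_ge0//.
apply: (@le_trans _ _ (W * e ^+ 2)); last first.
  by rewrite sqr_sqrtr ?divr_ge0 ?(ltW tol0) ?(ltW W0)// mulrC divfK// gt_eqF.
apply: ler_pM; rewrite ?sqr_ge0//.
rewrite ler_sqr ?nnegrE ?normc_ge0 ?(ltW e0)//.
by apply: Hd => //; [rewrite mem_zs|exact: le_trans st md].
Qed.

Lemma ler_zs_cst n (g : int -> R) (c : R) :
  (forall k, (`|k| <= n)%N -> g k <= c / n.*2.+1%:R) -> \sum_(k <- zs n) g k <= c.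
Proof.
move=> gc; apply: (@le_trans _ _ (\sum_(k <- zs n) c / n.*2.+1%:R)).
  by rewrite big_seq [leRHS]big_seq; apply: ler_sum => k; rewrite mem_zs; exact: gc.
by rewrite big_const_seq count_predT size_zs iter_addr_0 -[leLHS]mulr_natr divfK// pnatr_eq0.
Qed.

(** The factor 2 comes from bounding the real and imaginary parts separately. The weight c stays
    inside so that the result can be summed over frequencies. *)
Lemma cintegral_bound (D : set R) (g : R -> R[i]) (c e : R) : measurable D ->
  (lebesgue_measure D < +oo)%E ->
  lebesgue_measure.-integrable D (EFin \o (fun s => cRe (g s))) ->
  lebesgue_measure.-integrable D (EFin \o (fun s => cIm (g s))) ->
  0 <= c -> 0 <= e -> (forall s, D s -> c * normc (g s) ^+ 2 <= e) ->
  c * normc (cintegral D g) ^+ 2 <= 2 * e * (fine (lebesgue_measure D)) ^+ 2.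
Proof.
move=> mD fD iR iI c0 e0 ge.
have [->|cn0] := eqVneq c 0; first by rewrite mul0r; apply: mulr_ge0; [exact: mulr_ge0|exact: sqr_ge0].
have c1 : 0 < c by rewrite lt_neqAle eq_sym cn0.
pose M := Num.sqrt (e / c).
have gM s : D s -> normc (g s) <= M.
  move=> Ds; rewrite -[leLHS]ger0_norm ?normc_ge0// -sqrtr_sqr ler_wsqrtr//.
  by rewrite ler_pdivlMr// mulrC ge.
have icst : (@lebesgue_measure R).-integrable D (EFin \o (fun=> M)).
  apply: measurable_bounded_integrable => //.
  by exists M; split => [|B /ltW BM x _] /=; rewrite ?num_real// ger0_norm// sqrtr_ge0.
have H (r : R -> R) : lebesgue_measure.-integrable D (EFin \o r) ->
    (forall s, D s -> `|r s| <= M) ->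
    (\int[lebesgue_measure]_(s in D) r s) ^+ 2 <= (e / c) * (fine (lebesgue_measure D)) ^+ 2.
  move=> ir rM; rewrite -[leLHS]real_normK ?num_real//.
  have -> : e / c = M ^+ 2 by rewrite sqr_sqrtr// divr_ge0.
  rewrite -exprMn ler_sqr ?nnegrE ?normr_ge0 ?mulr_ge0 ?sqrtr_ge0 ?fine_ge0//.
  rewrite -Rintegral_cst//.
  apply: (@le_trans _ _ (\int[lebesgue_measure]_(s in D) `|r s|)).
    by apply: le_normr_Rintegral.
  apply: le_Rintegral => //; exact: (@integrable_norm _ _ _ _ _ _ ir).
rewrite normc_sqr /=.
have hR := H _ iR (fun s Ds => le_trans (ler_Re _) (gM s Ds)).
have hI := H _ iI (fun s Ds => le_trans (ler_Im _) (gM s Ds)).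
apply: le_trans (ler_wpM2l c0 (lerD hR hI)) _.
by rewrite le_eqVlt; apply/orP; left; apply/eqP; field.
Qed.

End UniformContinuity.

(** * Simple functions on a time grid, for a norm N dominated by a weighted sum of coefficients *)

Section SimpleApproximation.
Context {R : realType}.
Local Notation mu := (@lebesgue_measure R).
Variables (T : R) (f : R -> int -> R[i]) (F : R -> R -> R[i]).
Variables (N : (R -> R[i]) -> \bar R) (w : int -> R) (C B : R).
Hypothesis T0 : 0 < T.
Hypothesis fc : forall t k, normc (f s k - f t k) @[s --> t] --> 0.
Hypothesis LF : forall t, 0 <= t <= T -> L2 (F t).
Hypothesis Ff : forall t k, 0 <= t <= T -> fourier (F t) k = f t k.
Hypothesis w0 : forall k, 0 <= w k.
Hypothesis fB : forall t n, \sum_(k <- zs n) w k * normc (f t k) ^+ 2 <= B.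
Hypothesis C0 : 0 <= C.
Hypothesis N0 : forall v, (0 <= N v)%E.
Hypothesis NP : forall v S, L2 v ->
  (forall n, \sum_(k <- zs n) w k * normc (fourier v k) ^+ 2 <= S) ->
  (N v <= (Num.sqrt (C * S))%:E)%E.
Variable m : nat -> nat.
Hypothesis m0 : forall n, (0 < m n)%N.
Hypothesis grid : forall n s t, 0 <= s <= T -> 0 <= t <= T -> `|s - t| <= T / (m n)%:R ->
  forall k, (`|k| <= n)%N -> w k * normc (f s k - f t k) ^+ 2 <= n.+1%:R^-1 / n.*2.+1%:R.
Implicit Types (s t : R) (k : int).

Let h n := T / (m n)%:R.

Let h0 n : 0 < h n. Proof. by rewrite divr_gt0// ltr0n. Qed.

Let mh n : (m n)%:R * h n = T.
Proof. by rewrite /h mulrC divfK// pnatr_eq0 -lt0n. Qed.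

Let node n (j : nat) : R := j%:R * h n.

Lemma trig_N_finite n a : (N (trig n a) < +oo)%E.
Proof.
apply: le_lt_trans (ltry (Num.sqrt (C * \sum_(k <- zs n) w k * normc (a k) ^+ 2))).
apply: NP; first exact: L2_trig.
move=> p; apply: (@le_trans _ _ (\sum_(k <- zs n) w k * normc (fourier (trig n a) k) ^+ 2)).
  apply: sum_zs_trunc => k; first by rewrite mulr_ge0// sqr_ge0.
  by move=> nk; rewrite fourier_trig leqNgt nk normc0 expr0n mulr0.
rewrite big_seq [leRHS]big_seq; apply: ler_sum => k.
by rewrite mem_zs fourier_trig => ->.
Qed.

(** The cells are half-open, so one more than [m n] is taken in order to cover the endpoint T. *)
Definition grid_simple n : simple_function N :=
  @SimpleFunction R N (m n).+1 (fun j => step_set (h n) j)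
    (fun j => trig n (f (node n j))) (fun j => measurable_itv _)
    (fun j => trig_N_finite n _).

Let idx n s := Num.truncn (s / h n).

Lemma grid_idx n s : 0 <= s <= T -> [/\ (idx n s <= m n)%N, 0 <= node n (idx n s) <= T &
  `|s - node n (idx n s)| <= h n].
Proof.
move=> /andP[s0 sT]; have /andP[] := truncn_itv (divr_ge0 s0 (ltW (h0 n))).
rewrite ler_pdivlMr// ltr_pdivrMr// -/(idx n s) -natr1 mulrDl mul1r => h1 h2.
have sn : node n (idx n s) <= T by exact: le_trans h1 sT.
split; last 2 first.
- by rewrite sn andbT mulr_ge0// ltW.
- by rewrite ger0_norm ?subr_ge0// /node; lra.
- by rewrite -(ler_nat R) -(ler_pM2r (h0 n)) mh.
Qed.

Lemma grid_simpleE n s : 0 <= s <= T ->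
  sf_eval (grid_simple n) s = trig n (f (node n (idx n s))).
Proof.
move=> sT; have [im _ _] := grid_idx n sT; have /andP[s0 _] := sT.
apply/funext => x; rewrite /sf_eval /=.
rewrite (bigD1 (Ordinal (im : idx n s < (m n).+1)%N))//= step_setE// eqxx mul1r big1 ?addr0//.
by move=> j ji; rewrite step_setE// (negbTE (_ : val j != idx n s)) ?mul0r.
Qed.

(** The tail beyond n as a limit of partial sums, which gives its measurability in s. *)
Definition wtail n s : R :=
  limn (fun p => \sum_(k <- zs p) w k * normc (f s k) ^+ 2) -
  \sum_(k <- zs n) w k * normc (f s k) ^+ 2.

Let mono s : {homo (fun p => \sum_(k <- zs p) w k * normc (f s k) ^+ 2) : m n / (m <= n)%N >-> m <= n}.
Proof. by move=> p q pq; apply: ler_zs_sum => // k; rewrite mulr_ge0// sqr_ge0. Qed.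

Let cvs s : cvgn (fun p => \sum_(k <- zs p) w k * normc (f s k) ^+ 2).
Proof.
by apply: nondecreasing_is_cvgn; [exact: mono|exists B => _ [p _ <-]].
Qed.

Lemma wtail_ge n p s : (n <= p)%N ->
  \sum_(k <- zs p | (n < `|k|)%N) w k * normc (f s k) ^+ 2 <= wtail n s.
Proof.
move=> np; rewrite /wtail lerBrDl.
by rewrite -(big_zs_split _ np); apply: nondecreasing_cvgn_le; [exact: mono|exact: cvs].
Qed.

Lemma wtail_itv n s : 0 <= wtail n s <= B.
Proof.
apply/andP; split.
  by rewrite subr_ge0; apply: nondecreasing_cvgn_le; [exact: mono|exact: cvs].
apply: (@le_trans _ _ (limn (fun p => \sum_(k <- zs p) w k * normc (f s k) ^+ 2))).
  by rewrite gerBl sumr_ge0// => k _; rewrite mulr_ge0// sqr_ge0.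
by apply: limr_le; [exact: cvs|apply: nearW => p].
Qed.

Lemma wtail_cvg s : wtail n s @[n --> \oo] --> 0.
Proof.
have cs : \sum_(k <- zs p) w k * normc (f s k) ^+ 2 @[p --> \oo] -->
    limn (fun p => \sum_(k <- zs p) w k * normc (f s k) ^+ 2) := @cvs s.
have /(_ _ _)c := cvgB (cvg_cst (limn (fun p => \sum_(k <- zs p) w k * normc (f s k) ^+ 2))) cs.
by rewrite subrr in c; exact: c.
Qed.

Lemma measurable_normc_coef k : measurable_fun setT (fun s => normc (f s k)).
Proof.
apply: continuous_measurable_fun => s; apply/cvgrPdist_le => e e0.
move/cvgr0Pnorm_le: (fc s k) => /(_ e e0); apply: filterS => t.
rewrite ger0_norm ?normc_ge0// distrC; exact: le_trans (ler_dist_normc _ _).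
Qed.

Lemma measurable_wsum p : measurable_fun setT (fun s => \sum_(k <- zs p) w k * normc (f s k) ^+ 2).
Proof.
apply: measurable_sum => k; apply: measurable_funM; first exact: measurable_cst.
apply: measurable_funX; exact: measurable_normc_coef.
Qed.

Lemma measurable_wtail n : measurable_fun setT (wtail n).
Proof.
apply: measurable_funB; last exact: measurable_wsum.
apply: (@measurable_fun_cvg _ _ _ _ (fun p s => \sum_(k <- zs p) w k * normc (f s k) ^+ 2)).
  exact: measurable_wsum.
by move=> s _; exact: cvs.
Qed.

(** 1 / (n + 1) accounts for time discretisation of the frequencies |k| <= n, the tail for those cut
    off. *)
Definition grid_error n s : R := Num.sqrt (C * (n.+1%:R^-1 + wtail n s)).

Lemma grid_simple_error n s : 0 <= s <= T ->
  (N (F s \- sf_eval (grid_simple n) s)%R <= (grid_error n s)%:E)%E.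
Proof.
move=> sT; rewrite grid_simpleE//; have [_ nT sn] := grid_idx n sT.
set a := f (node n (idx n s)).
apply: NP => [|p]; first by apply: L2B; [exact: LF|exact: L2_trig].
have E k : fourier (F s \- trig n a) k = f s k - (if (`|k| <= n)%N then a k else 0).
  rewrite (fourierB (f := F s) (g := trig n a)); [|exact: L2_cint (LF sT)|exact: cint_trig].
  by rewrite Ff// fourier_trig.
under eq_bigr do rewrite E.
apply: (@le_trans _ _ (\sum_(k <- zs (maxn n p)) w k *
  normc (f s k - (if (`|k| <= n)%N then a k else 0)) ^+ 2)).
  by apply: ler_zs_sum => [|k]; [exact: leq_maxr|rewrite mulr_ge0// sqr_ge0].
rewrite (big_zs_split _ (leq_maxl n p)); apply: lerD.
  apply: ler_zs_cst => k kn; rewrite kn; exact: grid sT nT sn k kn.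
apply: le_trans (wtail_ge s (leq_maxl n p)); apply: ler_sum => k nk.
by rewrite leqNgt nk subr0.
Qed.

Lemma grid_error_cvg s : grid_error n s @[n --> \oo] --> 0.
Proof.
have c1 : C * (n.+1%:R^-1 + wtail n s) @[n --> \oo] --> C * (0 + 0).
  apply: cvgM; first exact: cvg_cst.
  apply: cvgD; last exact: wtail_cvg.
  apply/cvgr0Pnorm_le => e e0; near=> p.
  rewrite ger0_norm ?invr_ge0//; near: p.
  by have := near_infty_natSinv_lt (PosNum e0); apply: filterS => n /ltW.
have := cvg_comp _ _ c1 (@sqrt_continuous R (C * (0 + 0))).
by rewrite addr0 mulr0 sqrtr0.
Unshelve. all: by end_near. Qed.

Lemma grid_error_bound n s : 0 <= grid_error n s <= Num.sqrt (C * (1 + B)).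
Proof.
rewrite sqrtr_ge0 /= ler_wsqrtr// ler_wpM2l// lerD//; last by have /andP[] := wtail_itv n s.
by rewrite invf_le1// ler1n.
Qed.

Lemma measurable_grid_error n : measurable_fun setT (grid_error n).
Proof.
apply: (@measurableT_comp _ _ _ _ _ _ (@Num.sqrt R)).
  by apply: continuous_measurable_fun; exact: sqrt_continuous.
apply: measurable_funM; first exact: measurable_cst.
by apply: measurable_funD; [exact: measurable_cst|exact: measurable_wtail].
Qed.

Lemma grid_strongly_measurable (D : set R) : (forall s, D s -> 0 <= s <= T) ->
  strongly_measurable N D F.
Proof.
move=> DT; exists grid_simple; apply: aeW => s /DT sT.
apply: (@squeeze_cvge _ _ _ _ (cst 0%E) _ (fun n => (grid_error n s)%:E)).
- by apply: nearW => n; rewrite N0 grid_simple_error.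
- exact: cvg_cst.
- by apply: cvg_EFin; [exact: nearW|exact: grid_error_cvg].
Qed.

(* No measurability is needed: the integral of a nonnegative function is a
   supremum over the simple functions below it. *)
Lemma le_nonneg_integral (D : set R) (f1 f2 : R -> \bar R) :
  (forall x, D x -> (0 <= f1 x)%E) -> (forall x, D x -> (f1 x <= f2 x)%E) ->
  (\int[mu]_(x in D) f1 x <= \int[mu]_(x in D) f2 x)%E.
Proof.
move=> f10 f12; have f20 x : D x -> (0 <= f2 x)%E by move=> Dx; exact: le_trans (f10 x Dx) (f12 x Dx).
rewrite !ge0_integralE//; apply: le_ereal_sup => _ [g /= gf <-]; exists g => // x.
apply: le_trans (gf x) _; rewrite /patch; case: ifPn => // /set_mem; exact: f12.
Qed.

(** Dominated convergence is applied to [grid_error], whose measurability in s is known, and not to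
    the norm that it bounds. *)
Lemma grid_integral_error (D : set R) : measurable D -> (mu D < +oo)%E ->
  (forall s, D s -> 0 <= s <= T) ->
  (\int[mu]_(s in D) N (F s \- sf_eval (grid_simple n) s)%R)%E @[n --> \oo] --> 0%E.
Proof.
move=> mD fD DT.
have icst : mu.-integrable D (EFin \o (fun=> Num.sqrt (C * (1 + B)))).
  apply: measurable_bounded_integrable => //.
  by exists (Num.sqrt (C * (1 + B))); split => [|M /ltW BM x _] /=;
     rewrite ?num_real// ger0_norm// sqrtr_ge0.
have mE n : measurable_fun D (grid_error n) by apply: measurable_funTS; exact: measurable_grid_error.
have bE n s : D s -> `|grid_error n s| <= Num.sqrt (C * (1 + B)).
  by move=> _; have /andP[g0 gB] := grid_error_bound n s; rewrite ger0_norm.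
have iE n : mu.-integrable D (EFin \o grid_error n).
  apply: (@le_integrable _ _ _ mu D mD _ _ _ _ icst); first by apply/measurable_EFinP; exact: mE.
  by move=> s Ds; rewrite /= lee_fin (le_trans (bE n s Ds))// ler_norm.
have [_ cv] := @Rintegral_dominated_cvg R D grid_error (fun=> 0) _ mD mE
  (fun s _ => grid_error_cvg s) icst bE.
rewrite Rintegral_cst// mul0r in cv.
apply: (@squeeze_cvge _ _ _ _ (cst 0%E) _ (fun n => (\int[mu]_(s in D) grid_error n s)%:E)).
- apply: nearW => n; rewrite integral_ge0/=; last by move=> s _; exact: N0.
  rewrite /Rintegral fineK; last exact: integrable_fin_num (iE n).
  apply: le_nonneg_integral => s Ds; first exact: N0.
  by apply: grid_simple_error; exact: DT.
- exact: cvg_cst.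
- by apply: cvg_EFin; [exact: nearW|exact: cv].
Qed.


Let coef_continuous (P : R[i] -> R) k : (forall z z', P z - P z' = P (z - z')) ->
  (forall z, `|P z| <= normc z) -> continuous (fun s => P (f s k)).
Proof.
move=> PB Ple s; apply/cvgrPdist_le => e e0.
move/cvgr0Pnorm_le: (fc s k) => /(_ e e0); apply: filterS => t.
by rewrite ger0_norm ?normc_ge0// distrC PB; exact: le_trans (Ple _).
Qed.

Lemma integrable_coef (P : R[i] -> R) k (D : set R) :
  (forall z z', P z - P z' = P (z - z')) -> (forall z, `|P z| <= normc z) ->
  measurable D -> (forall s, D s -> 0 <= s <= T) ->
  mu.-integrable D (EFin \o (fun s => P (f s k))).
Proof.
move=> PB Ple mD DT.
have iT : mu.-integrable [set` `[0, T]] (EFin \o (fun s => P (f s k))).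
  apply: continuous_compact_integrable; first exact: segment_compact.
  by apply: continuous_subspaceT; exact: coef_continuous.
have sub : D `<=` [set` `[0, T]] by move=> s /DT; rewrite /= in_itv.
have mT : measurable [set` `[(0:R), T]] by exact: measurable_itv.
exact: (@integrableS _ _ _ mu _ D _ mT mD sub iT).
Qed.

Lemma grid_integral (P : R[i] -> R) n k (D : set R) :
  measurable D -> (mu D < +oo)%E -> (forall s, D s -> 0 <= s <= T) ->
  mu.-integrable D (EFin \o (fun s => P (f (node n (idx n s)) k))) /\
  \int[mu]_(s in D) P (f (node n (idx n s)) k) =
    \sum_(j < (m n).+1) P (f (node n j) k) * fine (mu (step_set (h n) j `&` D)).
Proof.
move=> mD fD DT.
have [i1 e1] := @Rintegral_sum_indic R nat (iota 0 (m n).+1) (step_set (h n))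
  (fun j => P (f (node n j) k)) D mD fD (fun j => measurable_itv _).
have E s : D s -> \sum_(j <- iota 0 (m n).+1) P (f (node n j) k) * \1_(step_set (h n) j) s =
    P (f (node n (idx n s)) k).
  move=> Ds; have sT := DT s Ds; have [im _ _] := grid_idx n sT; have /andP[s0 _] := sT.
  by rewrite (@sum_step_set R (h n) _ (fun j => P (f (node n j) k)))// ltnS im.
split.
  apply: (@eq_integrable _ _ _ mu D mD _ _ _ i1) => s /set_mem Ds.
  by rewrite /= E.
rewrite -(@big_mkord _ _ _ (m n).+1 xpredT (fun j => P (f (node n j) k) * fine (mu (step_set (h n) j `&` D)))).
rewrite /index_iota subn0 -e1; apply: eq_Rintegral => s /set_mem Ds; by rewrite E.
Qed.

Lemma sf_integral_grid n (D : set R) :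
  measurable D -> (mu D < +oo)%E -> (forall s, D s -> 0 <= s <= T) ->
  sf_integral D (grid_simple n) =
  trig n (fun k => cintegral D (fun s => f (node n (idx n s)) k)).
Proof.
move=> mD fD DT; apply/funext => x; rewrite /sf_integral /trig /=.
under eq_bigr do rewrite mulr_sumr.
rewrite exchange_big /=; apply: eq_bigr => k _.
under eq_bigr do rewrite mulrA; rewrite -mulr_suml; congr (_ * _).
apply: complexP.
- rewrite cRe_sum /= (grid_integral (@complex.Re R) n k mD fD DT).2.
  by apply: eq_bigr => j _; rewrite cReZ mulrC.
- rewrite cIm_sum /= (grid_integral (@complex.Im R) n k mD fD DT).2.
  by apply: eq_bigr => j _; rewrite cImZ mulrC.
Qed.

(** For |k| <= n the error is the integral of a coefficient minus its grid values, controlled by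
    [cintegral_bound]; beyond n it is the tail of v. *)
Lemma grid_sf_integral_error (D : set R) v B' : measurable D -> (mu D < +oo)%E ->
  (forall s, D s -> 0 <= s <= T) -> L2 v ->
  (forall n, \sum_(k <- zs n) w k * normc (fourier v k) ^+ 2 <= B') ->
  (forall k, fourier v k = cintegral D (fun s => f s k)) ->
  (N (v \- sf_integral D (grid_simple n))) @[n --> \oo] --> 0%E.
Proof.
move=> mD fD DT Lv vB vf.
have monov : {homo (fun p => \sum_(k <- zs p) w k * normc (fourier v k) ^+ 2) : m n / (m <= n)%N >-> m <= n}.
  by move=> p q pq; apply: ler_zs_sum => // k; rewrite mulr_ge0// sqr_ge0.
have cRB (z z' : R[i]) : cRe z - cRe z' = cRe (z - z') by rewrite cReD cReN.
have cIB (z z' : R[i]) : cIm z - cIm z' = cIm (z - z') by rewrite cImD cImN.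
pose c n := fun k => cintegral D (fun s => f (node n (idx n s)) k).
pose L := 2 * fine (mu D) ^+ 2.
have L0 : 0 <= L by rewrite mulr_ge0// sqr_ge0.
have dk n k : (`|k| <= n)%N ->
    w k * normc (fourier v k - c n k) ^+ 2 <= (L * n.+1%:R^-1) / n.*2.+1%:R.
  move=> kn.
  have iR1 := integrable_coef k cRB (@ler_Re R) mD DT.
  have iI1 := integrable_coef k cIB (@ler_Im R) mD DT.
  have iR2 := (grid_integral (@complex.Re R) n k mD fD DT).1.
  have iI2 := (grid_integral (@complex.Im R) n k mD fD DT).1.
  have -> : fourier v k - c n k = cintegral D (fun s => f s k - f (node n (idx n s)) k).
    rewrite vf /c; apply: complexP => /=.
    - by rewrite -RintegralB//; apply: eq_Rintegral => s _; rewrite cReD cReN.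
    - by rewrite -RintegralB//; apply: eq_Rintegral => s _; rewrite cImD cImN.
  apply: le_trans (@cintegral_bound R D _ (w k) (n.+1%:R^-1 / n.*2.+1%:R) mD fD _ _ _ _ _) _ => //.
  - have := @integrableB _ _ _ mu D mD _ _ iR1 iR2; congr (_.-integrable _ _).
    by apply/funext => s /=; rewrite cReD cReN.
  - have := @integrableB _ _ _ mu D mD _ _ iI1 iI2; congr (_.-integrable _ _).
    by apply/funext => s /=; rewrite cImD cImN.
  - by move=> s Ds; have [_ nT sn] := grid_idx n (DT s Ds); exact: grid (DT s Ds) nT sn k kn.
  - by rewrite /L le_eqVlt; apply/orP; left; apply/eqP; ring.
have key n e : 0 <= e -> (forall p, (n <= p)%N ->
    \sum_(k <- zs p) w k * normc (fourier v k) ^+ 2 -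
    \sum_(k <- zs n) w k * normc (fourier v k) ^+ 2 <= e) ->
    (N (v \- sf_integral D (grid_simple n))%R <= (Num.sqrt (C * (L * n.+1%:R^-1 + e)))%:E)%E.
  move=> e0 He; rewrite sf_integral_grid//.
  apply: NP => [|p]; first by apply: L2B => //; exact: L2_trig.
  have E k : fourier (v \- trig n (c n)) k = fourier v k - (if (`|k| <= n)%N then c n k else 0).
    rewrite (fourierB (f := v) (g := trig n (c n))); [|exact: L2_cint|exact: cint_trig].
    by rewrite fourier_trig.
  under eq_bigr do rewrite E.
  apply: (@le_trans _ _ (\sum_(k <- zs (maxn n p)) w k *
    normc (fourier v k - (if (`|k| <= n)%N then c n k else 0)) ^+ 2)).
    by apply: ler_zs_sum => [|k]; [exact: leq_maxr|rewrite mulr_ge0// sqr_ge0].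
  rewrite (big_zs_split _ (leq_maxl n p)); apply: lerD.
    by apply: ler_zs_cst => k kn; rewrite kn; exact: dk.
  apply: le_trans (He _ (leq_maxl n p)); rewrite (big_zs_split _ (leq_maxl n p)) /= addrAC subrr add0r.
  by apply: ler_sum => k nk; rewrite leqNgt nk subr0.
pose tl n := limn (fun p => \sum_(k <- zs p) w k * normc (fourier v k) ^+ 2) -
   \sum_(k <- zs n) w k * normc (fourier v k) ^+ 2.
have cvv : cvgn (fun p => \sum_(k <- zs p) w k * normc (fourier v k) ^+ 2).
  by apply: nondecreasing_is_cvgn => //; exists B' => _ [p _ <-].
have le_lim p : \sum_(k <- zs p) w k * normc (fourier v k) ^+ 2 <=
    limn (fun p => \sum_(k <- zs p) w k * normc (fourier v k) ^+ 2).
  exact: nondecreasing_cvgn_le.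
have c1 : Num.sqrt (C * (L * n.+1%:R^-1 + tl n)) @[n --> \oo] --> 0.
  have tlc : tl n @[n --> \oo] --> 0.
    have /(_ _ _)cc := cvgB (cvg_cst (limn (fun p => \sum_(k <- zs p) w k * normc (fourier v k) ^+ 2))) cvv.
    by rewrite subrr in cc; exact: cc.
  have nc : (n.+1%:R^-1 : R) @[n --> \oo] --> 0.
    apply/cvgr0Pnorm_le => e e0; near=> p.
    rewrite ger0_norm ?invr_ge0//; near: p.
    by have := near_infty_natSinv_lt (PosNum e0); apply: filterS => n /ltW.
  have cc : C * (L * n.+1%:R^-1 + tl n) @[n --> \oo] --> C * (L * 0 + 0).
    apply: cvgM; first exact: cvg_cst.
    by apply: cvgD => //; apply: cvgM => //; exact: cvg_cst.
  have := cvg_comp _ _ cc (@sqrt_continuous R (C * (L * 0 + 0))).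
  by rewrite mulr0 addr0 mulr0 sqrtr0.
apply: (@squeeze_cvge _ _ _ _ (cst 0%E) _ (fun n => (Num.sqrt (C * (L * n.+1%:R^-1 + tl n)))%:E)).
- apply: nearW => n; rewrite N0 /=; apply: key; first by rewrite subr_ge0.
  by move=> p np; rewrite /tl lerD2r.
- exact: cvg_cst.
- by apply: cvg_EFin; [exact: nearW|exact: c1].
Unshelve. all: by end_near. Qed.

End SimpleApproximation.

(** * Regularity in time and the mild equation for the limit *)

Section Assembly.
Context {R : realType}.
Local Notation mu := (@lebesgue_measure R).
Implicit Types (s t T M sigma : R) (k : int).

Lemma nonlinearity_msq sigma M : 1 <= sigma -> exists Bn : R, forall a, h1le M a ->
  msq (nonlinearity sigma (hsum a)) <= Bn.
Proof.
move=> s1; have [S S0 HS] := h1le_sup M.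
exists ((S `^ (2 * sigma)) ^+ 2 * M) => a aM.
have [_ i1] := L2_nonlinearity s1 aM; have [[_ i2] _ dM] := dx_hsum aM.
apply: (@le_trans _ _ ((S `^ (2 * sigma)) ^+ 2 * msq (dx (hsum a)))); last first.
  by apply: ler_wpM2l => //; exact: sqr_ge0.
rewrite /msq -rmeanZ//; apply: ler_rmean => //; first exact: tintZ.
move=> x _; rewrite /nonlinearity normcM exprMn; apply: ler_wpM2r; first exact: sqr_ge0.
rewrite normc_real ger0_norm ?powR_ge0// ler_sqr ?nnegrE ?powR_ge0//.
have s0 : 0 <= 2 * sigma by lra.
by rewrite ge0_ler_powR// ?nnegrE ?normc_ge0//; apply: normc_hsum; exact: HS.
Qed.

Lemma nonlinearity_continuous sigma M (a : R -> int -> R[i]) : 1 <= sigma ->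
  (forall t, h1le M (a t)) -> (forall t k, normc (a s k - a t k) @[s --> t] --> 0) ->
  forall t k, normc (fourier (nonlinearity sigma (hsum (a s))) k -
                     fourier (nonlinearity sigma (hsum (a t))) k) @[s --> t] --> 0.
Proof.
move=> s1 aM ac t k.
apply: (@nonlinearity_weak_cvg R R (nbhs t) _ sigma M a (a t)
  (fun s x => (normc (hsum (a s) x) `^ (2 * sigma))%:C) (fun s => dx (hsum (a s))) (fun=> 0)) => //.
- by move=> s; have [] := dx_hsum (aM s).
- by move=> s; have [] := dx_hsum (aM s).
- by move=> s; have [] := dx_hsum (aM s).
- by move=> s; exact: tmeas_powR (tmeas_hsum (h1le_ell1 (aM s))).
- by move=> s x; rewrite subrr normc0.
- exact: cvg_cst.
Qed.

Lemma phase_continuous (z : R -> R[i]) (b c B : R) t : (forall s, normc (z s) <= B) ->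
  normc (z s - z t) @[s --> t] --> 0 ->
  normc (expi (b * s + c) * z s - expi (b * t + c) * z t) @[s --> t] --> 0.
Proof.
move=> zB zc.
have cv : `|b| * `|s - t| * B + normc (z s - z t) @[s --> t] --> (0 : R).
  rewrite -[X in _ --> X](_ : `|b| * `|t - t| * B + 0 = 0); last by rewrite subrr normr0 mulr0 mul0r addr0.
  apply: cvgD => //; apply: cvgM; last exact: cvg_cst.
  apply: cvgM; first exact: cvg_cst.
  by apply: cvg_norm; apply: cvgB; [exact: cvg_id|exact: cvg_cst].
apply/cvgr0Pnorm_le => e e0; move/cvgr0Pnorm_le: cv => /(_ e e0); apply: filterS => s.
move=> /(le_trans (ler_norm _)); apply: le_trans; rewrite ger0_norm ?normc_ge0//.
set u := expi _; set v := expi _.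
have -> : u * z s - v * z t = (u - v) * z s + v * (z s - z t) by ring.
apply: normcD_le; last by rewrite normcM normc_expi mul1r.
apply: normcM_le => //; apply: le_trans (normc_expiB _ _) _.
have -> : b * s + c - (b * t + c) = b * (s - t) by ring.
by rewrite normrM.
Qed.

Lemma cintegralZ (D : set R) (g : R -> R[i]) (z : R[i]) : measurable D ->
  mu.-integrable D (EFin \o (fun s => cRe (g s))) ->
  mu.-integrable D (EFin \o (fun s => cIm (g s))) ->
  cintegral D (fun s => z * g s) = z * cintegral D g.
Proof.
move=> mD iR iI.
have iZ (r : R) (f : R -> R) : mu.-integrable D (EFin \o f) ->
    mu.-integrable D (EFin \o (fun s => r * f s)).
  by move=> i; have := @integrableZl _ _ _ mu D mD r _ i.
apply: complexP; rewrite ?cReM ?cImM /=.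
- under eq_Rintegral do rewrite cReM.
  by rewrite (@RintegralB _ _ _ mu D _ _ mD (iZ _ _ iR) (iZ _ _ iI)) !RintegralZl.
- under eq_Rintegral do rewrite cImM.
  by rewrite (@RintegralD _ _ _ mu D _ _ mD (iZ _ _ iI) (iZ _ _ iR)) !RintegralZl.
Qed.

Lemma schrodingerP t f : L2 f -> L2 (schrodinger t f) /\
  forall k, fourier (schrodinger t f) k = expi (- (k%:~R ^+ 2 * t)) * fourier f k.
Proof.
move=> Lf; apply: (@fmultP R _ f (msq f)) => n.
by under eq_bigr do rewrite normcM normc_expi mul1r; exact: bessel.
Qed.

Lemma Linfty_hsum T M (a : R -> int -> R[i]) : 0 < T -> (forall t, h1le M (a t)) ->
  (forall t k, normc (a s k - a t k) @[s --> t] --> 0) ->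
  Linfty (Hnorm 1) T (fun t => hsum (a t)).
Proof.
move=> T0 aM ac.
have w0 k : 0 <= 1 + k%:~R ^+ 2 :> R by rewrite addr_ge0// sqr_ge0.
have NP (v : R -> R[i]) S : L2 v -> (forall n, \sum_(k <- zs n) (1 + k%:~R ^+ 2) * normc (fourier v k) ^+ 2 <= S) ->
    (Hnorm 1 v <= (Num.sqrt (1 * S))%:E)%E.
  move=> Lv vS; rewrite mul1r; apply: Hnorm_le => // n.
  by under eq_bigr do rewrite sobw1.
split; last first.
  exists (Num.sqrt (1 * M)); apply: aeW => t _; apply: NP; first exact: L2_hsum (h1le_ell1 (aM t)).
  by have la := h1le_ell1 (aM t) => n; under eq_bigr do rewrite fourier_hsum//; exact: aM.
have /choice[m Hm] n := uniform_grid n T0 w0 ac.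
apply: (@grid_strongly_measurable R T a _ (Hnorm 1) (fun k => 1 + k%:~R ^+ 2) 1 M T0 _ _ w0 _ _ NP m).
- by move=> t _; exact: L2_hsum (h1le_ell1 (aM t)).
- by move=> t k _; rewrite fourier_hsum//; exact: h1le_ell1 (aM t).
- by move=> t n; exact: aM.
- exact: Hnorm_ge0.
- by move=> n; have [] := Hm n.
- by move=> n; have [] := Hm n.
- by move=> s; rewrite /= in_itv/= => /andP[/ltW-> /ltW->].
Qed.

(** Since s < 1, the weight (1 + k^2)^s is a small multiple of 1 + k^2 at high frequencies, where
    the H^1 bound suffices; the finitely many others are continuous in time. *)
Lemma continuous_in_time_hsum s T M (a : R -> int -> R[i]) : s < 1 ->
  (forall t, h1le M (a t)) ->
  (forall t k, normc (a t' k - a t k) @[t' --> t] --> 0) ->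
  continuous_in_time (Hnorm s) T (fun t => hsum (a t)).
Proof.
move=> s1 aM ac t _.
have la r := h1le_ell1 (aM r).
have HM r : (Hnorm s (hsum (a r)) <= (Num.sqrt M)%:E)%E.
  apply: Hnorm_le; first exact: L2_hsum.
  move=> n; apply: le_trans (aM r n); apply: ler_sum => k _; rewrite fourier_hsum//.
  by apply: ler_wpM2r; [exact: sqr_ge0|exact: sobw_le (ltW s1)].
split; first exact: le_lt_trans (HM t) (ltry _).
have M0 : 0 <= M := h1le_ge0 (aM t).
have diffM r n : \sum_(k <- zs n) (1 + k%:~R ^+ 2) * normc (a r k - a t k) ^+ 2 <= 4 * M.
  have -> : 4 * M = 2 * M + 2 * M by ring.
  apply: le_trans (lerD (ler_wpM2l _ (aM r n)) (ler_wpM2l _ (aM t n))) => //.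
  rewrite !mulr_sumr -big_split /=; apply: ler_sum => k _.
  rewrite [leRHS](_ : _ = (1 + k%:~R ^+ 2) * (2 * normc (a r k) ^+ 2 + 2 * normc (a t k) ^+ 2)); last by ring.
  rewrite ler_wpM2l ?addr_ge0 ?sqr_ge0//; apply: le_trans (normcD2 _ _) _; by rewrite normcN.
have E r k : fourier (hsum (a r) \- hsum (a t)) k = a r k - a t k.
  rewrite (fourierB (f := hsum (a r)) (g := hsum (a t))).
  - by rewrite !fourier_hsum.
  - by apply: L2_cint; exact: L2_hsum.
  - by apply: L2_cint; exact: L2_hsum.
have LD r : L2 (hsum (a r) \- hsum (a t)) by apply: L2B; exact: L2_hsum.
have fin r : Hnorm s (hsum (a r) \- hsum (a t)) \is a fin_num.
  rewrite ge0_fin_numE ?Hnorm_ge0//; apply: le_lt_trans (ltry (Num.sqrt (4 * M))).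
  apply: Hnorm_le => // n; apply: le_trans (diffM r n); apply: ler_sum => k _; rewrite E.
  by apply: ler_wpM2r; [exact: sqr_ge0|exact: sobw_le (ltW s1)].
apply: cvg_EFin; first exact: nearW.
apply/cvgr0Pnorm_le => e e0.
have e2 : 0 < e ^+ 2 / 2 by rewrite divr_gt0// exprn_gt0.
pose r1 := 1 - s; have r0 : 0 < r1 by rewrite subr_gt0.
(* 4 M bounds the squared H^1 norm of a difference, and J is such that (1 + k^2)^(1 - s) >= Dl
   beyond it: the high frequencies contribute at most 4 M / Dl <= e^2 / 2. *)
pose Dl := (4 * M + 1) / (e ^+ 2 / 2).
have Dl0 : 0 < Dl by rewrite divr_gt0// ltr_wpDl// mulr_ge0.
pose J := (Num.truncn (Dl `^ r1^-1)).+1.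
have J1 : (1 : R) <= J%:R by rewrite ler1n.
have hJ : Dl `^ r1^-1 <= 1 + J%:R ^+ 2.
  have /ltW h1 : Dl `^ r1^-1 < J%:R by exact: truncnS_gt.
  by apply: le_trans h1 _; nra.
have tailw k : (J < `|k|)%N -> sobw s k <= Dl^-1 * (1 + k%:~R ^+ 2).
  move=> Jk; have kJ : J%:R ^+ 2 <= k%:~R ^+ 2 :> R.
    rewrite -[leRHS]real_normK ?num_real// ler_sqr ?nnegrE//.
    by rewrite -intr_norm -abszE -pmulrn ler_nat ltnW.
  have k1 : 0 < 1 + k%:~R ^+ 2 :> R by rewrite ltr_pwDl// sqr_ge0.
  have h2 : Dl <= (1 + k%:~R ^+ 2) `^ r1.
    have {1}-> : Dl = (Dl `^ r1^-1) `^ r1.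
      by rewrite -powRrM mulVf ?gt_eqF// powRr1// ltW.
    rewrite ge0_ler_powR ?nnegrE ?powR_ge0 ?(ltW r0) ?(ltW k1)//.
    by apply: le_trans hJ _; rewrite lerD2l.
  have -> : sobw s k = ((1 + k%:~R ^+ 2) `^ r1)^-1 * (1 + k%:~R ^+ 2).
    rewrite /sobw -powRN -[X in _ = _ * X]powRr1 ?(ltW k1)// -powRD.
      by congr (_ `^ _); rewrite /r1; ring.
    by rewrite (gt_eqF k1) implybT.
  apply: ler_wpM2r; first exact: ltW.
  by rewrite lef_pV2 ?posrE ?powR_gt0.
have c0 : \sum_(k <- zs J) sobw s k * normc (a t' k - a t k) ^+ 2 @[t' --> t] --> (0 : R).
  rewrite -[X in _ --> X](_ : \sum_(k <- zs J) sobw s k * 0 ^+ 2 = 0); last first.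
    by rewrite big1// => k _; rewrite expr0n mulr0.
  apply: (@cvg_sum_seq R _ _ (nbhs t) _ (zs J) (fun k t' => sobw s k * normc (a t' k - a t k) ^+ 2)
    (fun k => sobw s k * 0 ^+ 2)) => k.
  apply: cvgM; first exact: cvg_cst.
  by rewrite expr2; under eq_fun do rewrite expr2; apply: cvgM; exact: ac.
move/cvgr0Pnorm_le: c0 => /(_ _ e2); apply: filterS => t' + _.
move=> /(le_trans (ler_norm _)) ht'.
rewrite ger0_norm ?fine_ge0 ?Hnorm_ge0// -lee_fin fineK//.
have -> : e = Num.sqrt (e ^+ 2) by rewrite sqrtr_sqr ger0_norm// ltW.
apply: Hnorm_le => // n; under eq_bigr do rewrite E.
apply: (@le_trans _ _ (\sum_(k <- zs (maxn J n)) sobw s k * normc (a t' k - a t k) ^+ 2)).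
  apply: ler_zs_sum => [|k]; first exact: leq_maxr.
  by apply: mulr_ge0; [exact: ltW (sobw_gt0 s k)|exact: sqr_ge0].
rewrite (big_zs_split _ (leq_maxl J n)) (splitr (e ^+ 2)); apply: lerD => //.
apply: (@le_trans _ _ (Dl^-1 * (4 * M))); last first.
  rewrite /Dl invf_div mulrAC ler_pdivrMr ?ltr_wpDl ?mulr_ge0//.
  by rewrite ler_wpM2l ?(ltW e2)// lerDl.
apply: le_trans (ler_wpM2l _ (diffM t' (maxn J n))); last by rewrite invr_ge0 ltW.
rewrite (big_zs_split _ (leq_maxl J n)) mulrDr mulr_sumr [X in _ + X]mulr_sumr.
apply: ler_wpDl.
  apply: sumr_ge0 => k _; apply: mulr_ge0; first by rewrite invr_ge0 ltW.
  by apply: mulr_ge0; [rewrite addr_ge0// sqr_ge0|exact: sqr_ge0].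
apply: ler_sum => k Jk; rewrite [leRHS]mulrA; apply: ler_wpM2r; first exact: sqr_ge0.
exact: tailw.
Qed.

Lemma mild_solution_hsum sigma T M u0 (a : R -> int -> R[i]) : 1 <= sigma -> 0 < T ->
  L2 u0 -> (forall t, h1le M (a t)) ->
  (forall t k, normc (a t' k - a t k) @[t' --> t] --> 0) ->
  (forall t k, 0 <= t <= T -> expi (k%:~R ^+ 2 * t) * a t k = fourier u0 k -
     cintegral [set` `[0, t]] (fun s => expi (k%:~R ^+ 2 * s) *
       fourier (nonlinearity sigma (hsum (a s))) k)) ->
  mild_solution sigma T u0 (fun t => hsum (a t)).
Proof.
move=> s1 T0 Lu0 aM ac duh t; rewrite in_itv/= => tT; have /andP[t0 tT'] := tT.
pose NL s k := fourier (nonlinearity sigma (hsum (a s))) k.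
have LN s := L2_nonlinearity s1 (aM s).
have [Bn HBn] := @nonlinearity_msq sigma M s1.
have NLB s k : normc (NL s k) <= Num.sqrt `|Bn|.
  rewrite -[leLHS]ger0_norm ?normc_ge0// -sqrtr_sqr ler_wsqrtr//.
  apply: le_trans (normc_fourier_msq k (LN s)) (le_trans (HBn _ (aM s)) (ler_norm _)).
have NLc := nonlinearity_continuous s1 aM ac.
pose f s k := expi (- (k%:~R ^+ 2 * (t - s))) * NL s k.
have fc t1 k : normc (f s k - f t1 k) @[s --> t1] --> 0.
  have := phase_continuous (k%:~R ^+ 2) (- (k%:~R ^+ 2 * t)) (NLB^~ k) (NLc t1 k).
  have P s : k%:~R ^+ 2 * s - k%:~R ^+ 2 * t = - (k%:~R ^+ 2 * (t - s)) by ring.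
  by rewrite P; under eq_fun do rewrite P.
have gc t1 k : normc (expi (k%:~R ^+ 2 * s) * NL s k - expi (k%:~R ^+ 2 * t1) * NL t1 k)
    @[s --> t1] --> 0.
  have := phase_continuous (k%:~R ^+ 2) 0 (NLB^~ k) (NLc t1 k).
  by rewrite addr0; under eq_fun do rewrite addr0.
pose F s := schrodinger (t - s) (nonlinearity sigma (hsum (a s))).
have LF s : L2 (F s) by have [] := schrodingerP (t - s) (LN s).
have Ff s k : fourier (F s) k = f s k by have [_ ->] := schrodingerP (t - s) (LN s).
have mD : measurable [set` `[(0 : R), t]] by exact: measurable_itv.
have fD : (mu [set` `[0%R, t]] < +oo)%E.
  by rewrite lebesgue_measure_itv /=; case: ifP => _; rewrite ?ltry// -EFinB ltry.
have DT s : [set` `[0, t]] s -> 0 <= s <= T.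
  by rewrite /= in_itv/= => /andP[-> st]; exact: le_trans st tT'.
have [LS SE] := schrodingerP t Lu0.
(* With I defined by the equation itself, what remains is that I is the Bochner integral. Its
   coefficients are the integrals of those of F by Duhamel's formula multiplied by the phase at time
   t. *)
pose I x := schrodinger t u0 x - hsum (a t) x.
have LI : L2 I by apply: L2B => //; apply: L2_hsum; exact: h1le_ell1 (aM t).
have IE k : fourier I k = cintegral [set` `[0, t]] (fun s => f s k).
  rewrite /I fourierB; [|exact: L2_cint|by apply: L2_cint; apply: L2_hsum; exact: h1le_ell1 (aM t)].
  rewrite SE fourier_hsum; last exact: h1le_ell1 (aM t).
  have -> : a t k = expi (- (k%:~R ^+ 2 * t)) * (expi (k%:~R ^+ 2 * t) * a t k) by rewrite expiKN.
  rewrite duh// -mulrBr subKr -cintegralZ//.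
  - congr cintegral; apply/funext => s; rewrite /f mulrA -expiD; congr (expi _ * _); ring.
  - by apply: (integrable_coef gc) DT => // [z z'|z]; [rewrite cReD cReN|exact: ler_Re].
  - by apply: (integrable_coef gc) DT => // [z z'|z]; [rewrite cImD cImN|exact: ler_Im].
have w0 (k : int) : 0 <= 1 :> R by exact: ler01.
have sum1 (b : int -> R[i]) n : \sum_(k <- zs n) 1 * normc (b k) ^+ 2 = \sum_(k <- zs n) normc (b k) ^+ 2.
  by apply: eq_bigr => k _; rewrite mul1r.
have NP (v : R -> R[i]) S : L2 v -> (forall n, \sum_(k <- zs n) 1 * normc (fourier v k) ^+ 2 <= S) ->
    (L2norm v <= (Num.sqrt (2 * pi * S))%:E)%E.
  by move=> Lv vS; apply: L2norm_le => // n; rewrite -sum1.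
have fB s n : \sum_(k <- zs n) 1 * normc (f s k) ^+ 2 <= Bn.
  rewrite sum1; apply: le_trans (le_trans (bessel n (LN s)) (HBn _ (aM s))).
  by apply: ler_sum => k _; rewrite /f normcM normc_expi mul1r.
have /choice[m Hm] n := uniform_grid n T0 w0 fc.
have m0 n : (0 < m n)%N by have [] := Hm n.
have grid n : forall s t, 0 <= s <= T -> 0 <= t <= T -> `|s - t| <= T / (m n)%:R ->
  forall k, (`|k| <= n)%N -> 1 * normc (f s k - f t k) ^+ 2 <= n.+1%:R^-1 / n.*2.+1%:R.
  by have [] := Hm n.
exists I; last by apply: aeW => x _; rewrite /I; ring.
have LF' s : 0 <= s <= T -> L2 (F s) by move=> _; exact: LF.
have Ff' s k : 0 <= s <= T -> fourier (F s) k = f s k by move=> _; exact: Ff.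
have IB n : \sum_(k <- zs n) 1 * normc (fourier I k) ^+ 2 <= msq I by rewrite sum1; exact: bessel.
have pi0 : 0 <= 2 * pi :> R by exact: ltW pi2_gt0.
split.
- exact: (@grid_strongly_measurable R T f F (@L2norm R) (fun=> 1) (2 * pi) Bn T0 LF' Ff' w0 fB
    (@L2norm_ge0 R) NP m m0 grid _ DT).
- eexists; split.
  + exact: (@grid_integral_error R T f F (@L2norm R) (fun=> 1) (2 * pi) Bn T0 fc LF' Ff' w0 fB pi0
      (@L2norm_ge0 R) NP m m0 grid _ mD fD DT).
  + exact: (@grid_sf_integral_error R T f (@L2norm R) (fun=> 1) (2 * pi) T0 fc w0
      (@L2norm_ge0 R) NP m m0 grid _ I (msq I) mD fD DT LI IB IE).
Qed.

End Assembly.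

Theorem theorem1p1 (R : realType) (sigma : R) (hsigma : 1 <= sigma)
    (u0 : R -> R[i]) (hu0 : (Hnorm 1 u0 < +oo)%E) :
  exists (T : R) (u : R -> R -> R[i]),
    [/\ 0 < T,
        Linfty (Hnorm 1) T u,
        mild_solution sigma T u0 u &
        forall s : R, 0 <= s -> s < 1 -> continuous_in_time (Hnorm s) T u].
Proof.
have [Lu0 [B hB]] := Hnorm_finP hu0.
have aB : h1le B (fourier u0).
  by move=> n; apply: le_trans (hB n); under [leRHS]eq_bigr do rewrite sobw1.
have [T [M [c [a [T0 aM alip a0 duh]]]]] := limit_solution hsigma aB.
have ac t k : normc (a s k - a t k) @[s --> t] --> 0.
  have cv : `|s - t| * c k @[s --> t] --> `|t - t| * c k.
    apply: cvgM; last exact: cvg_cst.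
    by apply: cvg_norm; apply: cvgB; [exact: cvg_id|exact: cvg_cst].
  rewrite subrr normr0 mul0r in cv.
  apply/cvgr0Pnorm_le => e e0; move/cvgr0Pnorm_le: cv => /(_ e e0); apply: filterS => s.
  by move=> /(le_trans (ler_norm _)); apply: le_trans; rewrite ger0_norm ?normc_ge0.
exists T, (fun t => hsum (a t)); split=> //.
- exact: Linfty_hsum T0 aM ac.
- exact: mild_solution_hsum hsigma T0 Lu0 aM ac duh.
- by move=> s _ s1; exact: continuous_in_time_hsum s1 aM ac.
Qed.
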